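(* Let $d\ge 1$ be an integer, let $J^-\le J^+$ be real numbers, and let $J=\max(|J^-|,|J^+|)$. There exists a value $\beta_d(J)>0$ of the inverse temperature such that, for every $\beta\in[0,\beta_d(J))$ and every realization $\omega\in\Omega=[J^-,J^+]^{\mathbb{B}_d}$ of the potential, the first non-trivial branch $\sigma^{(1)}_\beta$ of the spectrum of the generator $L(\beta,\omega)$ of the heat bath dynamics is contained in the interval $[g_d^-(\beta),g_d^+(\beta)]$, where $g_d^-$ and $g_d^+$ are analytic functions of $\beta$ (not depending on $\omega$) such that $$g_d^{\pm}(\beta)=1\pm 2dJ\beta+o(\beta)\qquad(\beta\to 0).$$
   Context: Setting. $\mathbb{B}_d=\{\{x,y\}\subset\mathbb{Z}^d:|x-y|=1\}$ is the set of nearest-neighbour bonds of $\mathbb{Z}^d$. The potential is $\omega=(\omega_b)_{b\in\mathbb{B}_d}\in\Omega=[J^-,J^+]^{\mathbb{B}_d}$; in the model the $\omega_b$ are i.i.d. random variables with values in $[J^-,J^+]$ whose distribution is absolutely continuous with respect to Lebesgue measure. Write $\omega_{x,y}=\omega_{\{x,y\}}$. No ferromagnetic assumption is made. Spin system. $\mathcal{S}=\{-1,+1\}^{\mathbb{Z}^d}$. The formal Hamiltonian is $H^\omega(\sigma)=-\frac12\sum_{x,y\in\mathbb{Z}^d:|x-y|=1}\sigma_x\omega_{x,y}\sigma_y$ (sum over ordered pairs). For $\sigma\in\mathcal{S}$, $\sigma^x$ is the configuration obtained from $\sigma$ by flipping the spin at $x$, and $$\Delta_xH^\omega(\sigma)=H^\omega(\sigma)-H^\omega(\sigma^x)=-2\sigma_x\sum_{y:|x-y|=1}\omega_{x,y}\sigma_y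 .$$ $\mu^{\beta,\omega}$ denotes a Gibbs state on $\mathcal{S}$ for $H^\omega$ at inverse temperature $\beta$ (weights proportional to $e^{-\beta H^\omega}$); it is unique for all sufficiently small $\beta$, uniformly in $\omega\in\Omega$. Heat bath dynamics. The generator is the closure in $L^2(\mathcal{S},\mu^{\beta,\omega})$ of the operator acting on cylinder functions $f$ by $$L(\beta,\omega)f(\sigma)=\sum_{x\in\mathbb{Z}^d}w_x^{\beta,\omega}(\sigma)\,[f(\sigma)-f(\sigma^x)],\qquad w_x^{\beta,\omega}(\sigma)=\frac{1}{1+e^{-\beta\Delta_xH^\omega(\sigma)}} .$$ It is a nonnegative self-adjoint operator (the semigroup is $e^{-tL}$). First non-trivial branch. At $\beta=0$ the spectrum of $L$ is $\{0,1,2,\dots\}$. For $\beta$ sufficiently small (uniformly in $\omega\in\Omega$), the part of the spectrum of $L(\beta,\omega)$ near $1$ is separated from the rest of the spectrum. The first non-trivial branch (1-particle branch) $\sigma_\beta^{(1)}$ is this part: it is the spectrum of the restriction of $L(\beta,\omega)$ to the range of the Riesz projector $P_1(\beta,\omega)=\oint_{|z-1|=r}\frac{dz}{2\pi i}(z-L(\beta,\omega))^{-1}$, where the circle (e.g. $r=1/2$) lies in the resolvent set and encloses exactly this part of the spectrum. *)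

(* Defs.v *)
From HB Require Import structures.
From mathcomp Require Export all_boot all_order all_algebra.
From mathcomp Require Export finmap complex.
From mathcomp Require Export all_classical all_reals all_analysis.
Export Order.TTheory GRing.Theory Num.Theory numFieldNormedType.Exports.

#[export] Set Implicit Arguments.
#[export] Unset Strict Implicit.
#[export] Unset Printing Implicit Defensive.

Open Scope classical_set_scope.
Open Scope complex_scope.
Open Scope ring_scope.

Definition site (d : nat) := 'rV[int]_d.

(* |x - y| = 1, with the Euclidean norm squared so as to stay in [int]. *)
Definition nn (d : nat) (x y : site d) : Prop :=
  \sum_(i < d) (x 0 i - y 0 i) ^+ 2 = 1.

Definition bonds (d : nat) : set {fset site d} :=
  [set b | exists x y : site d, nn x y /\ b = [fset x; y]%fset].

(* A potential is a function on all finite sets of sites of which only the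
   values on bonds are constrained and used. *)
Definition Omega (R : realType) (d : nat) (Jm Jp : R) :
    set ({fset site d} -> R) :=
  [set omega | forall b, bonds b -> Jm <= omega b <= Jp].

Definition coordinate_sets (d : nat) : set (set (site d -> bool)) :=
  [set A | exists (x : site d) (b : bool), A = [set s | s x = b]].

(* {-1,+1}^(Z^d) with its product sigma-algebra; [true] encodes +1. *)
Definition config (d : nat) := g_sigma_algebraType (@coordinate_sets d).

Definition spin (R : realType) (d : nat) (s : config d) (x : site d) : R :=
  if s x then 1 else -1.

Definition flip (d : nat) (s : config d) (x : site d) : config d :=
  fun y => if y == x then ~~ s y else s y.

(* Part of the formal Hamiltonian that involves the spins in [L]. *)
Definition energy (R : realType) (d : nat) (omega : {fset site d} -> R)
    (L : {fset site d}) (s : config d) : R :=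
  - 2^-1 * \sum_(p \in [set p : site d * site d |
                        nn p.1 p.2 /\ (p.1 \in L \/ p.2 \in L)])
             spin R s p.1 * omega [fset p.1; p.2]%fset * spin R s p.2.

Definition same_outside (d : nat) (L : {fset site d}) (s : config d) :
    set (config d) :=
  [set t | forall x, x \notin L -> t x = s x].

Definition boltzmann (R : realType) (d : nat) (beta : R)
    (omega : {fset site d} -> R) (L : {fset site d}) (t : config d) : R :=
  expR (- beta * energy omega L t).

(* Conditional probability of [A] given that the configuration is [s]
   outside [L]. *)
Definition specification (R : realType) (d : nat) (beta : R)
    (omega : {fset site d} -> R) (L : {fset site d}) (s : config d)
    (A : set (config d)) : R :=
  (\sum_(t \in same_outside L s `&` A) boltzmann beta omega L t) /
  (\sum_(t \in same_outside L s) boltzmann beta omega L t).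

(* Gibbs states are defined by the Dobrushin-Lanford-Ruelle equations. *)
Definition gibbs (R : realType) (d : nat) (beta : R)
    (omega : {fset site d} -> R) (mu : probability (config d) R) : Prop :=
  forall (L : {fset site d}) (A : set (config d)), measurable A ->
    mu A = (\int[mu]_s (specification beta omega L s A)%:E)%E.

Definition DeltaH (R : realType) (d : nat) (omega : {fset site d} -> R)
    (x : site d) (s : config d) : R :=
  - 2 * spin R s x *
    \sum_(y \in [set y | nn x y]) omega [fset x; y]%fset * spin R s y.

Definition rate (R : realType) (d : nat) (beta : R)
    (omega : {fset site d} -> R) (x : site d) (s : config d) : R :=
  (1 + expR (- beta * DeltaH omega x s))^-1.

Definition cylinder (R : realType) (d : nat) (f : config d -> R[i]) : Prop :=
  exists L : {fset site d}, forall s t : config d,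
    (forall x, x \in L -> s x = t x) -> f s = f t.

(* For a cylinder function the summand vanishes for all but finitely many
   sites, so that the sum over all of Z^d is a genuine finite sum. *)
Definition pregenerator (R : realType) (d : nat) (beta : R)
    (omega : {fset site d} -> R) (f : config d -> R[i]) : config d -> R[i] :=
  fun s => \sum_(x \in [set: site d])
             (rate beta omega x s)%:C * (f s - f (flip s x)).

(* Elements of the complex space L^2(mu) are handled through their
   representatives [T -> R[i]]. A possibly unbounded operator is given by its
   graph; the graphs used below are stable under mu-a.e. equality. *)
Definition L2 (R : realType) (dT : measure_display) (T : measurableType dT)
    (mu : probability T R) : set (T -> R[i]) :=
  [set f | (fun t => complex.Re (f t)) \in Lfun mu 2%:E /\
           (fun t => complex.Im (f t)) \in Lfun mu 2%:E].

Definition L2norm (R : realType) (dT : measure_display) (T : measurableType dT)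
    (mu : probability T R) (f : T -> R[i]) : \bar R :=
  Lnorm mu 2%:E (fun t => (ComplexField.Normc.normc (f t))%:E).

Definition Cintegral (R : realType) (dT : measure_display)
    (T : measurableType dT) (mu : {measure set T -> \bar R}) (D : set T)
    (f : T -> R[i]) : R[i] :=
  (\int[mu]_(t in D) complex.Re (f t)) +i* (\int[mu]_(t in D) complex.Im (f t)).

Definition inner (R : realType) (dT : measure_display) (T : measurableType dT)
    (mu : probability T R) (f g : T -> R[i]) : R[i] :=
  Cintegral mu setT (fun t => (f t)^*%C * g t).

Definition graph_closure (R : realType) (dT : measure_display)
    (T : measurableType dT) (mu : probability T R)
    (A : set ((T -> R[i]) * (T -> R[i]))) : set ((T -> R[i]) * (T -> R[i])) :=
  [set p | [/\ L2 mu p.1, L2 mu p.2 &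
    exists u : nat -> (T -> R[i]) * (T -> R[i]),
      [/\ forall n, A (u n),
          L2norm mu (fun t => (u n).1 t - p.1 t) @[n --> \oo] --> 0%E &
          L2norm mu (fun t => (u n).2 t - p.2 t) @[n --> \oo] --> 0%E]]].

Definition generator (R : realType) (d : nat) (beta : R)
    (omega : {fset site d} -> R) (mu : probability (config d) R) :
    set ((config d -> R[i]) * (config d -> R[i])) :=
  graph_closure mu [set p | cylinder p.1 /\ p.2 = pregenerator beta omega p.1].

(* Resolvent set of the operator with graph [A] in the subspace [M] of
   L^2(mu), where [A] is contained in [M `*` M]: z - A is onto [M], and is
   injective with bounded inverse. *)
Definition resolvent_set (R : realType) (dT : measure_display)
    (T : measurableType dT) (mu : probability T R) (M : set (T -> R[i]))
    (A : set ((T -> R[i]) * (T -> R[i]))) : set R[i] :=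
  [set z |
    (forall g, M g -> exists f, A (f, fun t => z * f t - g t)) /\
    (exists C : R, forall f h, A (f, h) ->
       (L2norm mu f <= C%:E * L2norm mu (fun t => z * f t - h t)%R)%E)].

Definition spectrum (R : realType) (dT : measure_display)
    (T : measurableType dT) (mu : probability T R) (M : set (T -> R[i]))
    (A : set ((T -> R[i]) * (T -> R[i]))) : set R[i] :=
  ~` resolvent_set mu M A.

(* A representative of (z - A)^-1 g. *)
Definition resolvent (R : realType) (T : Type)
    (A : set ((T -> R[i]) * (T -> R[i]))) (z : R[i]) (g : T -> R[i]) :
    T -> R[i] :=
  xget (fun=> 0) [set f | A (f, fun t => z * f t - g t)].

Definition circle_integral (R : realType) (c : R[i]) (r : R)
    (phi : R[i] -> R[i]) : R[i] :=
  Cintegral lebesgue_measure `[0 : R, 2 * pi] (fun theta =>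
    let e := r%:C * (cos theta +i* sin theta) in phi (c + e) * ('i%C * e)).

(* Graph of the Riesz projector, the contour integral of the resolvent being
   taken in the weak sense. *)
Definition riesz_projector (R : realType) (dT : measure_display)
    (T : measurableType dT) (mu : probability T R)
    (A : set ((T -> R[i]) * (T -> R[i]))) (c : R[i]) (r : R) :
    set ((T -> R[i]) * (T -> R[i])) :=
  [set p | [/\ L2 mu p.1, L2 mu p.2 & forall k, L2 mu k ->
    inner mu k p.2 = ((2 * pi)%:C * 'i%C)^-1 *
      circle_integral c r (fun z => inner mu k (resolvent A z p.1))]].

Definition riesz_range (R : realType) (dT : measure_display)
    (T : measurableType dT) (mu : probability T R)
    (A : set ((T -> R[i]) * (T -> R[i]))) (c : R[i]) (r : R) :
    set (T -> R[i]) :=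
  [set h | exists g, riesz_projector mu A c r (g, h)].

Definition restriction (T U : Type) (A : set ((T -> U) * (T -> U)))
    (M : set (T -> U)) : set ((T -> U) * (T -> U)) :=
  [set p | [/\ A p, M p.1 & M p.2]].

Definition first_branch (R : realType) (d : nat) (beta : R)
    (omega : {fset site d} -> R) (mu : probability (config d) R) : set R[i] :=
  let A := generator beta omega mu in
  let M := riesz_range mu A 1 2^-1 in
  spectrum mu M (restriction A M).

Definition analytic_at (R : realType) (g : R -> R) (x : R) : Prop :=
  exists (a : nat -> R) (r : R), 0 < r /\ forall y, `|y - x| < r ->
    series (fun n => a n * (y - x) ^+ n) @ \oo --> g y.

(* Main.v *)
(* With w_x the heat-bath rate and E_x the conditional expectation given the spins
   off x, D_x f = w_x (f - f o flip_x) is the orthogonal projection 1 - E_x of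
   L^2(mu), and the generator L is the sum of the D_x. D_x and D_y commute unless
   x and y are neighbours, in which case |D_x D_y E_x f| <= c |D_y E_x f| with
   c = beta J exp(4 d J beta).
   If L f = lam f in finite volume, put a = sum_x ||D_x f||^2 and
   b = sum_{x <> y} ||D_y D_x f||^2. Since (lam - 1) a = sum_{x <> y} Re <D_x f, D_y f>
   and Re <D_x f, D_y f> is close to ||D_y D_x f||^2, one gets
   |(lam - 1) a - b| <= (2 d c + O(c^2)) a + b, and applying D_y D_x to the eigenvalue
   equation shows b = O(c^2) a when lam <= 7/4.
   So lam = 0, or |lam - 1| <= 2 d c + O(c^2), or lam >= 7/4.
   For the passage to infinite volume, say that phi is good if phi(L_n) converges
   strongly along growing boxes. The function 1/(z0 - lam) is good for the negative
   number z0 = -(6 d + 1), since finite-volume resolvents decay exponentially away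
   from the support of the data, and good functions are stable under sums, products
   and uniform limits. Hence 1/(z - lam) is good at positive distance from the
   possible eigenvalues, and so is the indicator function chi of the middle piece.
   The Riesz projector is chi(L), and off the middle piece (chi/(z - lam))(L)
   inverts z - L on its range. *)
Require Import Defs.
From mathcomp Require Import measurable_realfun sesquilinear spectral.
From mathcomp Require Import ring lra zify.
Import ComplexField.Normc HBNNSimple.

(** The generator is an unbounded closure given only by its graph, and its self-adjointness is not
    taken as an input. All spectral information is carried by the finite-volume operators [Lbox n]:
    their eigenvalues lie in one set independent of n, and [Lbox n] agrees exactly with the
    generator on a given cylinder function once the box is large. The decisive infinite-volume input
    is that z0 - L maps cylinder functions onto a dense set. The constants are tied to the circle |z
    - 1| = 1/2. Eigenvalues within 1/4 of 1, equal to 0, or at least 7/4 stay at distance 1/4 from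
    it, and 7/4 < 2 leaves 2 - lam >= 1/4 to absorb the errors of the two-particle estimate. The
    size of c comes from two facts: flipping a neighbour changes a rate by at most beta J, and any
    two rates are comparable up to exp(4 d J beta). The exponential only contributes at order
    beta^2, so the slope 2 d J survives. Elements of L^2 are functions, not classes, so the inner
    product is degenerate and identities between limits hold up to a vector of norm 0. *)

Section ComplexModulus.
Variable R : realType.
Implicit Types (z w : R[i]).

Lemma normc_ge0 z : 0 <= normc z.
Proof. by case: z => a b /=; exact: sqrtr_ge0. Qed.

Lemma Normc z : `|z| = (normc z)%:C.
Proof. by []. Qed.

Lemma normcR (x : R) : normc x%:C = `|x|.
Proof. by rewrite /= expr0n addr0 sqrtr_sqr. Qed.

Lemma normc_conj z : normc z^*%C = normc z.
Proof. by case: z => a b /=; rewrite sqrrN. Qed.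

Lemma sqr_normcE z : normc z ^+ 2 = complex.Re z ^+ 2 + complex.Im z ^+ 2.
Proof. by case: z => a b /=; rewrite sqr_sqrtr // addr_ge0 ?sqr_ge0. Qed.

Lemma conj_mul_normc z : z^*%C * z = (normc z ^+ 2)%:C.
Proof. by rewrite sqr_normcE; case: z => a b; apply/eqP; rewrite eq_complex /=; apply/andP; split; apply/eqP; ring. Qed.

Lemma normr_Re_le z : `|complex.Re z| <= normc z.
Proof.
by rewrite -(@ler_pXn2r _ 2) // ?nnegrE ?normc_ge0 ?normr_ge0 // real_normK ?num_real // sqr_normcE lerDl sqr_ge0.
Qed.

Lemma normr_Im_le z : `|complex.Im z| <= normc z.
Proof.
by rewrite -(@ler_pXn2r _ 2) // ?nnegrE ?normc_ge0 ?normr_ge0 // real_normK ?num_real // sqr_normcE lerDr sqr_ge0.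
Qed.

Lemma Re_add z w : complex.Re (z + w) = complex.Re z + complex.Re w.
Proof. by case: z; case: w. Qed.

Lemma Im_add z w : complex.Im (z + w) = complex.Im z + complex.Im w.
Proof. by case: z; case: w. Qed.

Lemma ReZ (a : R) z : complex.Re (a%:C * z) = a * complex.Re z.
Proof. by case: z => x y /=; rewrite mul0r subr0. Qed.

Lemma Re_conj z : complex.Re z^*%C = complex.Re z.
Proof. by case: z. Qed.

Lemma normc_sub z w : normc (z - w) = normc (w - z).
Proof. by rewrite -normcN opprB. Qed.

End ComplexModulus.

(** * Pre-Hilbert spaces *)

Section PreHilbert.
Variables (R : realType) (V : lmodType R[i]).

(* The form [ip] is antilinear in its first argument and may be degenerate; it
   is only constrained on [H]. *)
Record prehilbert (H : set V) (ip : V -> V -> R[i]) : Prop := {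
  prehilbertD : forall f g, H f -> H g -> H (f + g);
  prehilbertZ : forall a f, H f -> H (a *: f);
  prehilbert0 : H 0;
  ipDr : forall f g h, H f -> H g -> H h -> ip f (g + h) = ip f g + ip f h;
  ipZr : forall a f g, H f -> H g -> ip f (a *: g) = a * ip f g;
  ip_conj : forall f g, H f -> H g -> ip g f = (ip f g)^*%C;
  ip_ge0 : forall f, H f -> 0 <= complex.Re (ip f f) }.

Variables (H : set V) (ip : V -> V -> R[i]).
Hypothesis hH : prehilbert H ip.

Definition rip f g := complex.Re (ip f g).
Definition nrm f : R := Num.sqrt (rip f f).

Lemma prehilbertN f : H f -> H (- f).
Proof. by move=> Hf; rewrite -scaleN1r; apply: (prehilbertZ hH). Qed.

Lemma prehilbertB f g : H f -> H g -> H (f - g).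
Proof. by move=> Hf Hg; apply: (prehilbertD hH) => //; apply: prehilbertN. Qed.

Lemma prehilbert_sum (I : Type) (r : seq I) (P : pred I) (F : I -> V) :
  (forall i, P i -> H (F i)) -> H (\sum_(i <- r | P i) F i).
Proof.
by move=> HF; apply: big_ind => //; [apply: (prehilbert0 hH)|move=> f g; apply: (prehilbertD hH)].
Qed.

Lemma ipDl f g h : H f -> H g -> H h -> ip (g + h) f = ip g f + ip h f.
Proof.
move=> Hf Hg Hh; have Hgh := prehilbertD hH Hg Hh.
by rewrite (ip_conj hH Hf) // (ipDr hH) // rmorphD /= -!(ip_conj hH).
Qed.

Lemma ipZl a f g : H f -> H g -> ip (a *: f) g = a^*%C * ip f g.
Proof.
move=> Hf Hg; have Haf := prehilbertZ hH a Hf.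
by rewrite (ip_conj hH Hg) // (ipZr hH) // rmorphM /= -!(ip_conj hH).
Qed.

Lemma ip0r f : H f -> ip f 0 = 0.
Proof. by move=> Hf; rewrite -[0 in LHS](scale0r f) (ipZr hH) // mul0r. Qed.

Lemma ip0l f : H f -> ip 0 f = 0.
Proof. by move=> Hf; rewrite -[0 in LHS](scale0r f) ipZl // conjc0 mul0r. Qed.

Lemma ipBr f g h : H f -> H g -> H h -> ip f (g - h) = ip f g - ip f h.
Proof.
by move=> Hf Hg Hh; rewrite -scaleN1r (ipDr hH) // ?(ipZr hH) ?mulN1r //; apply: (prehilbertZ hH).
Qed.

Lemma ip_sumr (I : Type) (r : seq I) (P : pred I) (F : I -> V) f : H f ->
  (forall i, P i -> H (F i)) ->
  ip f (\sum_(i <- r | P i) F i) = \sum_(i <- r | P i) ip f (F i).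
Proof.
move=> Hf HF.
elim: r => [|i r IH]; first by rewrite !big_nil ip0r.
rewrite !big_cons; case: ifP => // Pi; rewrite (ipDr hH) ?IH //; first exact: HF.
exact: prehilbert_sum.
Qed.

Lemma ripDr f g h : H f -> H g -> H h -> rip f (g + h) = rip f g + rip f h.
Proof. by move=> *; rewrite /rip (ipDr hH) // Re_add. Qed.

Lemma rip_sym f g : H f -> H g -> rip f g = rip g f.
Proof. by move=> Hf Hg; rewrite /rip (ip_conj hH Hf Hg) Re_conj. Qed.

Lemma ripDl f g h : H f -> H g -> H h -> rip (g + h) f = rip g f + rip h f.
Proof. by move=> *; rewrite /rip ipDl // Re_add. Qed.

Lemma ripZr (a : R) f g : H f -> H g -> rip f (a%:C *: g) = a * rip f g.
Proof. by move=> *; rewrite /rip (ipZr hH) // ReZ. Qed.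

Lemma ripNr f g : H f -> H g -> rip f (- g) = - rip f g.
Proof.
move=> Hf Hg; rewrite -scaleN1r /rip (ipZr hH) //.
by rewrite mulN1r; case: (ip f g).
Qed.

Lemma ripBr f g h : H f -> H g -> H h -> rip f (g - h) = rip f g - rip f h.
Proof. by move=> *; rewrite ripDr ?ripNr //; exact: prehilbertN. Qed.

Lemma rip_sumr (I : Type) (r : seq I) (P : pred I) (F : I -> V) f : H f ->
  (forall i, P i -> H (F i)) ->
  rip f (\sum_(i <- r | P i) F i) = \sum_(i <- r | P i) rip f (F i).
Proof. by move=> Hf HF; rewrite /rip ip_sumr // (big_morph _ (@Re_add R) (erefl _)). Qed.

Lemma nrm_ge0 f : 0 <= nrm f. Proof. exact: sqrtr_ge0. Qed.

Lemma sqr_nrm f : H f -> nrm f ^+ 2 = rip f f.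
Proof. by move=> Hf; rewrite /nrm sqr_sqrtr //; exact: (ip_ge0 hH). Qed.

Lemma ip_self f : H f -> ip f f = (nrm f ^+ 2)%:C.
Proof.
move=> Hf; rewrite sqr_nrm // /rip; have := ip_conj hH Hf Hf.
by case: (ip f f) => a b [] /= /eqP; rewrite -addr_eq0 -mulr2n mulrn_eq0 /= => /eqP ->.
Qed.

Lemma nrm0 : nrm 0 = 0.
Proof. by rewrite /nrm /rip ip0r ?sqrtr0 //; exact: (prehilbert0 hH). Qed.

Lemma nrmZ a f : H f -> nrm (a *: f) = normc a * nrm f.
Proof.
move=> Hf; apply/eqP; rewrite -(@eqrXn2 _ 2) // ?nrm_ge0 ?mulr_ge0 ?nrm_ge0 ?normc_ge0 //.
have Haf := prehilbertZ hH a Hf.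
rewrite exprMn !sqr_nrm // /rip (ipZr hH) // ipZl // mulrA [a * _]mulrC conj_mul_normc.
by rewrite ReZ.
Qed.

Lemma nrmN f : H f -> nrm (- f) = nrm f.
Proof. by move=> Hf; rewrite -scaleN1r nrmZ // normcN normc1 mul1r. Qed.

Lemma nrm_sub f g : H f -> H g -> nrm (f - g) = nrm (g - f).
Proof. by move=> Hf Hg; rewrite -nrmN ?opprB //; exact: prehilbertB. Qed.

Lemma sqr_nrmD f g : H f -> H g ->
  nrm (f + g) ^+ 2 = nrm f ^+ 2 + 2 * rip f g + nrm g ^+ 2.
Proof.
move=> Hf Hg; rewrite !sqr_nrm //; last exact: (prehilbertD hH).
have Hfg := prehilbertD hH Hf Hg.
by rewrite ripDr // !ripDl // (rip_sym Hg Hf); ring.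
Qed.

(** Cauchy-Schwarz for a possibly degenerate form: |f + t g|^2 is a nonnegative quadratic in t. The
    case |g| = 0 requires its own choice of t. *)
Lemma rip_le f g : H f -> H g -> rip f g <= nrm f * nrm g.
Proof.
move=> Hf Hg.
have [r0|r0] := leP (rip f g) 0.
  by apply: le_trans r0 _; rewrite mulr_ge0 ?nrm_ge0.
have q t : 0 <= nrm f ^+ 2 + 2 * t * rip f g + t ^+ 2 * nrm g ^+ 2.
  have Hg' := prehilbertZ hH t%:C Hg.
  have -> : nrm f ^+ 2 + 2 * t * rip f g + t ^+ 2 * nrm g ^+ 2 = nrm (f + t%:C *: g) ^+ 2.
    by rewrite sqr_nrmD // ripZr // nrmZ // exprMn normcR real_normK ?num_real //; ring.
  exact: sqr_ge0.
have [g0|g0] := eqVneq (nrm g) 0.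
  (* When |g| = 0 the quadratic is affine, and at this t it equals -1. *)
  have := q (- ((nrm f ^+ 2 + 1) / (2 * rip f g))).
  rewrite g0.
  have -> : nrm f ^+ 2 + 2 * - ((nrm f ^+ 2 + 1) / (2 * rip f g)) * rip f g + (- ((nrm f ^+ 2 + 1) / (2 * rip f g))) ^+ 2 * 0 ^+ 2 = -1.
    by field; rewrite gt_eqF.
  by rewrite ler0N1.
have gp : 0 < nrm g by rewrite lt_def g0 nrm_ge0.
rewrite -(@ler_pXn2r _ 2) // ?nnegrE ?(ltW r0) ?mulr_ge0 ?nrm_ge0 // exprMn.
have := q (- (rip f g / nrm g ^+ 2)).
have -> : nrm f ^+ 2 + 2 * - (rip f g / nrm g ^+ 2) * rip f g + (- (rip f g / nrm g ^+ 2)) ^+ 2 * nrm g ^+ 2 = (nrm f ^+ 2 * nrm g ^+ 2 - rip f g ^+ 2) / nrm g ^+ 2.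
  by field; rewrite gt_eqF.
by rewrite pmulr_lge0 ?invr_gt0 ?exprn_gt0 // subr_ge0.
Qed.

Lemma normr_rip_le f g : H f -> H g -> `|rip f g| <= nrm f * nrm g.
Proof.
move=> Hf Hg; rewrite ler_norml rip_le // andbT lerNl -ripNr // -(nrmN Hg).
by apply: rip_le => //; exact: prehilbertN.
Qed.

Lemma normc_ip_le f g : H f -> H g -> normc (ip f g) <= nrm f * nrm g.
Proof.
move=> Hf Hg; have [->|z0] := eqVneq (ip f g) 0.
  by rewrite normc0 mulr_ge0 ?nrm_ge0.
(* The unimodular factor [u] rotates [ip f g] onto its modulus, which reduces the claim to real
   parts. *)
set z := ip f g; set u := z^*%C * (normc z)^-1%:C.
have zp : 0 < normc z.
  by rewrite lt_def normc_ge0 andbT; apply: contra z0 => /eqP/eq0_normc/eqP.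
have u1 : normc u = 1.
  by rewrite /u normcM normc_conj normcR ger0_norm ?invr_ge0 ?(ltW zp) // mulfV ?gt_eqF.
have := rip_le Hf (prehilbertZ hH u Hg).
rewrite nrmZ // u1 mul1r; apply: le_trans.
rewrite /rip (ipZr hH) // -/z /u mulrAC conj_mul_normc -rmorphM /=.
by rewrite expr2 -mulrA mulfV ?gt_eqF // mulr1.
Qed.

Lemma ler_nrmD f g : H f -> H g -> nrm (f + g) <= nrm f + nrm g.
Proof.
move=> Hf Hg; rewrite -(@ler_pXn2r _ 2) // ?nnegrE ?addr_ge0 ?nrm_ge0 //.
rewrite sqr_nrmD //; have := rip_le Hf Hg; lra.
Qed.

Lemma ler_nrmB f g : H f -> H g -> nrm (f - g) <= nrm f + nrm g.
Proof. by move=> Hf Hg; rewrite -(nrmN Hg) ler_nrmD //; exact: prehilbertN. Qed.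

Lemma ler_dist_nrmD h f g : H f -> H g -> H h -> nrm (f - g) <= nrm (f - h) + nrm (h - g).
Proof.
move=> Hf Hg Hh; have -> : f - g = (f - h) + (h - g) by rewrite addrA subrK.
by apply: ler_nrmD; exact: prehilbertB.
Qed.

Lemma nrm_sum (I : Type) (r : seq I) (P : pred I) (F : I -> V) :
  (forall i, P i -> H (F i)) ->
  nrm (\sum_(i <- r | P i) F i) <= \sum_(i <- r | P i) nrm (F i).
Proof.
move=> HF.
elim: r => [|i r IH]; first by rewrite !big_nil nrm0.
rewrite !big_cons; case: ifP => // Pi.
apply: le_trans (ler_nrmD (HF i Pi) (prehilbert_sum _ HF)) _; by rewrite lerD2l.
Qed.

End PreHilbert.

Lemma oppr_le_normB (R : realType) (a x : R) : a < 0 -> 0 <= x -> - a <= `|a - x|.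
Proof. by move=> a0 x0; rewrite ler0_norm; lra. Qed.

Section StrongConvergence.
Variables (R : realType) (V : lmodType R[i]) (H : set V) (ip : V -> V -> R[i]).
Hypothesis hH : prehilbert H ip.
Local Notation N := (nrm ip).

(** Convergence in a seminorm: limits are unique only up to a vector of seminorm 0, so equalities of
    limits are always stated as [N (l - l') = 0]. *)
Definition scvg (u : nat -> V) (l : V) :=
  forall e : R, 0 < e -> exists n0, forall n, (n0 <= n)%N -> N (u n - l) < e.

Definition scauchy (u : nat -> V) :=
  forall e : R, 0 < e -> exists n0, forall n m, (n0 <= n)%N -> (n0 <= m)%N -> N (u n - u m) < e.

Lemma le_eps (x : R) : (forall e, 0 < e -> x <= e) -> x <= 0.
Proof. by move=> h; apply/ler_addgt0Pr => e e0; rewrite add0r; exact: h. Qed.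

Lemma nrm_eq0_eps f : (forall e, 0 < e -> N f <= e) -> N f = 0.
Proof. by move=> h; apply/le_anti; rewrite nrm_ge0 le_eps. Qed.

Lemma scvg_unique u l l' : (forall n, H (u n)) -> H l -> H l' ->
  scvg u l -> scvg u l' -> N (l - l') = 0.
Proof.
move=> Hu Hl Hl' h h'; apply: nrm_eq0_eps => e e0.
have e20 : 0 < e / 2 by rewrite divr_gt0.
have [n1 h1] := h _ e20; have [n2 h2] := h' _ e20.
pose n := maxn n1 n2.
have := ler_dist_nrmD hH Hl Hl' (Hu n).
rewrite (nrm_sub hH Hl (Hu n)).
have := h1 n (leq_maxl _ _); have := h2 n (leq_maxr _ _); lra.
Qed.

Lemma scvgD u v l l' : (forall n, H (u n)) -> (forall n, H (v n)) -> H l -> H l' ->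
  scvg u l -> scvg v l' -> scvg (fun n => u n + v n) (l + l').
Proof.
move=> Hu Hv Hl Hl' h h' e e0.
have e20 : 0 < e / 2 by rewrite divr_gt0.
have [n1 h1] := h _ e20; have [n2 h2] := h' _ e20.
exists (maxn n1 n2) => n; rewrite geq_max => /andP[/h1 a /h2 b].
rewrite opprD addrACA; apply: le_lt_trans (ler_nrmD hH _ _) _; try exact: (prehilbertB hH).
lra.
Qed.

Lemma scvgZ a u l : (forall n, H (u n)) -> H l -> scvg u l -> scvg (fun n => a *: u n) (a *: l).
Proof.
move=> Hu Hl h e e0.
have c0 : 0 < normc a + 1 by rewrite ltr_wpDl ?normc_ge0.
have [n1 h1] := h _ (divr_gt0 e0 c0).
exists n1 => n /h1 {}h1; rewrite -scalerBr (nrmZ hH); last exact: (prehilbertB hH).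
rewrite ltr_pdivlMr // in h1.
apply: le_lt_trans h1; rewrite mulrC ler_wpM2l ?nrm_ge0 //; lra.
Qed.

Lemma scvgB u v l l' : (forall n, H (u n)) -> (forall n, H (v n)) -> H l -> H l' ->
  scvg u l -> scvg v l' -> scvg (fun n => u n - v n) (l - l').
Proof.
move=> Hu Hv Hl Hl' h h'.
rewrite -(scaleN1r l'); have := scvgD Hu _ Hl _ h (scvgZ (-1) Hv Hl' h').
under [X in scvg X]eq_fun do rewrite scaleN1r.
by apply=> [n|]; [rewrite scaleN1r; exact: (prehilbertN hH)|exact: (prehilbertZ hH)].
Qed.

Lemma scvg_near u v l : (exists n0, forall n, (n0 <= n)%N -> u n = v n) -> scvg u l -> scvg v l.
Proof.
move=> [n0 uv] h e /h[n1 h1]; exists (maxn n0 n1) => n.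
by rewrite geq_max => /andP[/uv <- /h1].
Qed.

Lemma scvg_cst l : scvg (fun=> l) l.
Proof. by move=> e e0; exists 0%N => n _; rewrite subrr (nrm0 hH). Qed.

Lemma scvg_eq u l l' : (forall n, H (u n)) -> H l -> H l' -> N (l - l') = 0 ->
  scvg u l -> scvg u l'.
Proof.
move=> Hu Hl Hl' ll' h e /h[n0 h0]; exists n0 => n /h0 {}h0.
by apply: le_lt_trans (ler_dist_nrmD hH (Hu n) Hl' Hl) _; rewrite ll' addr0.
Qed.

Lemma scvg_nrm_le u l B : (forall n, H (u n)) -> H l -> scvg u l ->
  (exists n0, forall n, (n0 <= n)%N -> N (u n) <= B) -> N l <= B.
Proof.
move=> Hu Hl h [n0 h0]; rewrite -subr_le0; apply: le_eps => e /h[n1 h1].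
have := h1 _ (leq_maxr n0 n1); have := h0 _ (leq_maxl n0 n1).
set n := maxn n0 n1; rewrite (nrm_sub hH (Hu n) Hl) => a b.
have := ler_nrmD hH (prehilbertB hH Hl (Hu n)) (Hu n); rewrite subrK; lra.
Qed.

Lemma scvg_cauchy u l : (forall n, H (u n)) -> H l -> scvg u l -> scauchy u.
Proof.
move=> Hu Hl h e e0; have [n0 h0] := h _ (divr_gt0 e0 (ltr0Sn _ 1)).
exists n0 => n m /h0 hn /h0 hm.
apply: le_lt_trans (ler_dist_nrmD hH (Hu n) (Hu m) Hl) _.
rewrite (nrm_sub hH Hl (Hu m)); lra.
Qed.

Definition sdense (K : set V) :=
  forall g, H g -> forall e : R, 0 < e -> exists2 f, K f & N (f - g) < e.

End StrongConvergence.

(** * Functional calculus by strong limits *)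

(* [ev n] is a finite orthonormal system of eigenvectors, with eigenvalues
   [lam n] in [Sg], of a self-adjoint operator A_n; [fcalc phi n] is phi(A_n)
   on their span and 0 on its orthogonal complement. A function [phi] on [Sg]
   is good when phi(A_n) converges strongly, and [fop phi] is then its limit
   (for other [phi] the value of [fop] is meaningless). *)
Section GoodFunctions.
Variables (R : realType) (V : lmodType R[i]) (H : set V) (ip : V -> V -> R[i]).
Hypothesis hH : prehilbert H ip.
Local Notation N := (nrm ip).
Hypothesis complete : forall u, (forall n, H (u n)) -> scauchy ip u ->
  exists2 l, H l & scvg ip u l.
Variables (dim : nat -> nat) (ev : forall n, 'I_(dim n) -> V)
  (lam : forall n, 'I_(dim n) -> R) (Sg : set R).
Hypothesis evH : forall n i, H (@ev n i).
Hypothesis ev_ortho : forall n i j, ip (@ev n i) (@ev n j) = (i == j)%:R.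
Hypothesis lamSg : forall n i, Sg (@lam n i).

Definition fcalc (phi : R -> R[i]) n g := \sum_i (phi (@lam n i) * ip (@ev n i) g) *: @ev n i.

Lemma fcalcH phi n g : H (fcalc phi n g).
Proof. by apply: (prehilbert_sum hH) => i _; apply: (prehilbertZ hH). Qed.

Lemma ip_ev_fcalc phi n g j : ip (@ev n j) (fcalc phi n g) = phi (@lam n j) * ip (@ev n j) g.
Proof.
rewrite (ip_sumr hH) // => [|i _]; last exact: (prehilbertZ hH).
rewrite (bigD1 j) //= big1 ?addr0 => [|i ij]; rewrite (ipZr hH) // ev_ortho.
  by rewrite eqxx mulr1.
by rewrite eq_sym (negPf ij) mulr0.
Qed.

Lemma fcalcM phi psi n g : fcalc (fun x => phi x * psi x) n g = fcalc phi n (fcalc psi n g).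
Proof. by apply: eq_bigr => i _; rewrite ip_ev_fcalc mulrA. Qed.

Lemma fcalcD phi psi n g : fcalc (fun x => phi x + psi x) n g = fcalc phi n g + fcalc psi n g.
Proof. by rewrite -big_split; apply: eq_bigr => i _; rewrite mulrDl scalerDl. Qed.

Lemma fcalcZ a phi n g : fcalc (fun x => a * phi x) n g = a *: fcalc phi n g.
Proof. by rewrite scaler_sumr; apply: eq_bigr => i _; rewrite scalerA mulrA. Qed.

Lemma fcalc_eq phi psi n g : (forall x, Sg x -> phi x = psi x) -> fcalc phi n g = fcalc psi n g.
Proof. by move=> h; apply: eq_bigr => i _; rewrite h. Qed.

Lemma fcalcBr phi n g h : H g -> H h -> fcalc phi n (g - h) = fcalc phi n g - fcalc phi n h.
Proof.
move=> Hg Hh; rewrite -sumrB; apply: eq_bigr => i _.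
by rewrite (ipBr hH) // mulrBr scalerBl.
Qed.

Lemma ip_fcalc phi n k g : H k -> ip k (fcalc phi n g) =
  \sum_i phi (@lam n i) * (ip (@ev n i) g * ip k (@ev n i)).
Proof.
move=> Hk; rewrite (ip_sumr hH) // => [|i _]; last exact: (prehilbertZ hH).
by apply: eq_bigr => i _; rewrite (ipZr hH) // mulrA.
Qed.

Lemma sqr_nrm_fcalc phi n g : H g ->
  N (fcalc phi n g) ^+ 2 = \sum_i (normc (phi (@lam n i)) ^+ 2 * normc (ip (@ev n i) g) ^+ 2).
Proof.
move=> Hg; have Hf := fcalcH phi n g; apply: (@complexI R); rewrite -(ip_self hH) //.
rewrite ip_fcalc // rmorph_sum; apply: eq_bigr => i _.
rewrite (ip_conj hH (evH i) Hf) ip_ev_fcalc rmorphM /=.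
by rewrite rmorphM /= -!conj_mul_normc; ring.
Qed.

(** Expand |g - f|^2 >= 0 for f the orthogonal projection of g, using Re <g, f> = |f|^2. *)
Lemma bessel n g : H g -> \sum_i normc (ip (@ev n i) g) ^+ 2 <= N g ^+ 2.
Proof.
move=> Hg; set f := fcalc (fun=> 1) n g; have Hf : H f := fcalcH _ n g.
have e : N f ^+ 2 = \sum_i normc (ip (@ev n i) g) ^+ 2.
  by rewrite sqr_nrm_fcalc //; apply: eq_bigr => i _; rewrite normc1 expr1n mul1r.
have gf : rip ip g f = N f ^+ 2.
  apply: (@complexI R); rewrite e rmorph_sum /rip.
  have -> : ip g f = (\sum_i normc (ip (@ev n i) g) ^+ 2)%:C.
    rewrite ip_fcalc // rmorph_sum; apply: eq_bigr => i _.
    by rewrite mul1r (ip_conj hH (evH i) Hg) mulrC conj_mul_normc.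
  by rewrite /= rmorph_sum.
have := sqr_nrmD hH (prehilbertN hH Hf) Hg.
rewrite (nrmN hH Hf) (rip_sym hH) // ?(ripNr hH) // ?gf; last exact: (prehilbertN hH).
have := sqr_ge0 (N (- f + g)); rewrite -e; lra.
Qed.

Lemma nrm_fcalc_le phi B n g : H g -> 0 <= B -> (forall x, Sg x -> normc (phi x) <= B) ->
  N (fcalc phi n g) <= B * N g.
Proof.
move=> Hg B0 h; rewrite -(@ler_pXn2r _ 2) ?nnegrE ?mulr_ge0 ?nrm_ge0 //.
rewrite sqr_nrm_fcalc // exprMn; apply: le_trans (ler_wpM2l _ (bessel n Hg)); last exact: sqr_ge0.
rewrite mulr_sumr; apply: ler_sum => i _; apply: ler_wpM2r; first exact: sqr_ge0.
by rewrite ler_pXn2r ?nnegrE ?normc_ge0 //; exact: h.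
Qed.

(** A bound on [Sg] bounds the operators [fcalc phi n] uniformly in n, which is what allows strong
    limits to be multiplied and extended from dense sets. *)
Definition fbounded (phi : R -> R[i]) := exists2 B : R, 0 <= B & forall x, Sg x -> normc (phi x) <= B.

Definition good (phi : R -> R[i]) := fbounded phi /\
  forall g, H g -> exists2 h, H h & scvg ip (fun n => fcalc phi n g) h.

(** A three-epsilon argument: the operators are bounded uniformly in n, so the Cauchy property
    passes from [K] to its closure. *)
Lemma good_sdense (K : set V) phi : K `<=` H -> sdense H ip K -> fbounded phi ->
  (forall f, K f -> exists2 h, H h & scvg ip (fun n => fcalc phi n f) h) -> good phi.
Proof.
move=> KH dK bphi hK; split => // g Hg; apply: complete => [n|e e0]; first exact: fcalcH.
have [B B0 hB] := bphi.
have d0 : 0 < e / (3 * (B + 1)) by rewrite divr_gt0 // mulr_gt0 //; lra.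
have [f Kf fg] := dK g Hg _ d0; have Hf := KH _ Kf.
have [h Hh cv] := hK f Kf.
have [n0 h0] := scvg_cauchy hH (fun n => fcalcH phi n f) Hh cv (divr_gt0 e0 (ltr0Sn _ 2)).
exists n0 => n m nn mm; have := h0 n m nn mm.
have b k : N (fcalc phi k (f - g)) < e / 3.
  apply: le_lt_trans (nrm_fcalc_le k (prehilbertB hH Hf Hg) B0 hB) _.
  have -> : e / 3 = (B + 1) * (e / (3 * (B + 1))) by field; rewrite gt_eqF //; lra.
  apply: (@le_lt_trans _ _ ((B + 1) * N (f - g))).
    by rewrite ler_wpM2r ?nrm_ge0 //; lra.
  by rewrite ltr_pM2l //; lra.
have := b n; have := b m; rewrite !fcalcBr // => b1 b2 b3.
have := ler_dist_nrmD hH (fcalcH phi n g) (fcalcH phi m g) (fcalcH phi n f).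
have := ler_dist_nrmD hH (fcalcH phi n f) (fcalcH phi m g) (fcalcH phi m f).
rewrite (nrm_sub hH (fcalcH phi n g) (fcalcH phi n f)); lra.
Qed.

Lemma good_eq phi psi : (forall x, Sg x -> phi x = psi x) -> good phi -> good psi.
Proof.
move=> e [[B B0 hB] hp]; split; first by exists B => // x Sx; rewrite -e //; exact: hB.
move=> g /hp[h Hh cv]; exists h => //; apply: scvg_near cv.
by exists 0%N => n _; exact: fcalc_eq.
Qed.

Lemma goodD phi psi : good phi -> good psi -> good (fun x => phi x + psi x).
Proof.
move=> [[B B0 hB] hp] [[B' B0' hB'] hp']; split.
  exists (B + B') => [|x Sx]; first exact: addr_ge0.
  by apply: le_trans (le_normcD _ _) _; apply: lerD; [exact: hB|exact: hB'].
move=> g Hg; have [h Hh cv] := hp g Hg; have [h' Hh' cv'] := hp' g Hg.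
exists (h + h'); first exact: (prehilbertD hH).
by under eq_fun do rewrite fcalcD; apply: (scvgD hH) => // n; exact: fcalcH.
Qed.

Lemma goodZ a phi : good phi -> good (fun x => a * phi x).
Proof.
move=> [[B B0 hB] hp]; split.
  exists (normc a * B) => [|x Sx]; first by rewrite mulr_ge0 ?normc_ge0.
  by rewrite normcM ler_wpM2l ?normc_ge0 //; exact: hB.
move=> g Hg; have [h Hh cv] := hp g Hg.
exists (a *: h); first exact: (prehilbertZ hH).
by under eq_fun do rewrite fcalcZ; apply: (scvgZ hH) => // n; exact: fcalcH.
Qed.

(** phi(A_n) psi(A_n) g is compared with phi(A_n) h', where h' is the limit of psi(A_n) g; the
    uniform bound on phi(A_n) controls the difference. *)
Lemma goodM phi psi : good phi -> good psi -> good (fun x => phi x * psi x).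
Proof.
move=> [[B B0 hB] hp] [[B' B0' hB'] hp']; split.
  exists (B * B') => [|x Sx]; first exact: mulr_ge0.
  by rewrite normcM ler_pM ?normc_ge0 //; [exact: hB|exact: hB'].
move=> g Hg; have [h' Hh' cv'] := hp' g Hg; have [h Hh cv] := hp h' Hh'.
exists h => //; under eq_fun do rewrite fcalcM; move=> e e0.
have d0 : 0 < e / (2 * (B + 1)) by rewrite divr_gt0 // mulr_gt0 //; lra.
have [n1 h1] := cv' _ d0; have [n2 h2] := cv _ (divr_gt0 e0 (ltr0Sn _ 1)).
exists (maxn n1 n2) => n; rewrite geq_max => /andP[/h1 {}h1 /h2 {}h2].
apply: le_lt_trans (ler_dist_nrmD hH (fcalcH _ _ _) Hh (fcalcH phi n h')) _.
rewrite -fcalcBr //; last exact: fcalcH.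
have := nrm_fcalc_le n (prehilbertB hH (fcalcH psi n g) Hh') B0 hB.
have : B * N (fcalc psi n g - h') <= (B + 1) * (e / (2 * (B + 1))).
  by apply: ler_pM; rewrite ?nrm_ge0 // ?(ltW h1) //; lra.
have -> : (B + 1) * (e / (2 * (B + 1))) = e / 2 by field; rewrite gt_eqF //; lra.
lra.
Qed.

Lemma good_lim phi : (forall e : R, 0 < e -> exists2 psi, good psi &
  forall x, Sg x -> normc (phi x - psi x) <= e) -> good phi.
Proof.
move=> happ; split.
  have [psi [[B B0 hB] _] hp] := happ 1 ltr01.
  exists (1 + B) => [|x Sx]; first by rewrite addr_ge0.
  by rewrite -(subrK (psi x) (phi x)); apply: le_trans (le_normcD _ _) _; apply: lerD;
    [exact: hp|exact: hB].
move=> g Hg; apply: complete => [n|e e0]; first exact: fcalcH.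
have N0 : 0 < 3 * (N g + 1) by rewrite mulr_gt0 // ltr_wpDl ?nrm_ge0.
have [psi [_ gpsi] hp] := happ _ (divr_gt0 e0 N0).
have [h Hh cv] := gpsi g Hg.
have [n0 h0] := scvg_cauchy hH (fun n => fcalcH psi n g) Hh cv (divr_gt0 e0 (ltr0Sn _ 2)).
exists n0 => n m nn mm; have := h0 n m nn mm.
have b k : N (fcalc phi k g - fcalc psi k g) < e / 3.
  have -> : fcalc phi k g - fcalc psi k g = fcalc (fun x => phi x - psi x) k g.
    rewrite /fcalc -sumrB; apply: eq_bigr => i _; by rewrite mulrBl scalerBl.
  apply: le_lt_trans (nrm_fcalc_le k Hg (ltW (divr_gt0 e0 N0)) hp) _.
  have -> : e / 3 = e / (3 * (N g + 1)) * (N g + 1) by field; rewrite gt_eqF // ltr_wpDl ?nrm_ge0.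
  by rewrite ltr_pM2l ?ltrDl // divr_gt0.
have := b n; have := b m; rewrite (nrm_sub hH (fcalcH phi m g) (fcalcH psi m g)) => b1 b2 b3.
have := ler_dist_nrmD hH (fcalcH phi n g) (fcalcH phi m g) (fcalcH psi n g).
have := ler_dist_nrmD hH (fcalcH psi n g) (fcalcH phi m g) (fcalcH psi m g); lra.
Qed.

Lemma good0 : good (fun=> 0).
Proof.
split; first by exists 0 => // x _; rewrite normc0.
move=> g Hg; exists 0; first exact: (prehilbert0 hH).
move=> e e0; exists 0%N => n _; rewrite subr0 /fcalc big1 ?(nrm0 hH) // => i _.
by rewrite mul0r scale0r.
Qed.

(* A Neumann series. *)
Lemma good_fix phi alpha gam (rho : R) : good alpha -> good gam -> rho < 1 ->
  (forall x, Sg x -> normc (gam x) <= rho) -> fbounded phi ->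
  (forall x, Sg x -> phi x = alpha x + gam x * phi x) -> good phi.
Proof.
move=> ga gg rho1 hrho [B B0 hB] hphi.
(* A point of [Sg] is what yields rho >= 0. *)
have [[x0 Sx0]|nS] := pselect (exists x, Sg x); last first.
  by apply: good_eq good0 => x Sx; case: nS; exists x.
have rho0 : 0 <= rho by apply: le_trans (normc_ge0 (gam x0)) (hrho _ Sx0).
pose psi m := iter m (fun (p : R -> R[i]) x => alpha x + gam x * p x) (fun=> 0).
have gpsi m : good (psi m).
  by elim: m => [|m IH]; [exact: good0|apply: goodD ga (goodM gg IH)].
(* The error after m iterations is exactly gam^m phi. *)
have err m x : Sg x -> normc (phi x - psi m x) <= rho ^+ m * B.
  move=> Sx; elim: m => [|m IH]; first by rewrite subr0 expr0 mul1r; exact: hB.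
  have -> : phi x - psi m.+1 x = gam x * (phi x - psi m x).
    by rewrite {1}hphi //= mulrBr; ring.
  by rewrite normcM exprS -mulrA ler_pM ?normc_ge0 // hrho.
apply: good_lim => e e0.
have : rho ^+ m @[m --> \oo] --> (0 : R) by apply: cvg_expr; rewrite ger0_norm.
move=> /cvgrPdist_lt /(_ (e / (B + 1))).
have B1 : 0 < B + 1 by lra.
move=> /(_ (divr_gt0 e0 B1))[m _ /(_ m (leqnn m)) /=].
rewrite sub0r normrN ger0_norm ?exprn_ge0 // ltr_pdivlMr // => hm.
exists (psi m) => // x Sx; apply: le_trans (err m x Sx) _; apply: le_trans (ltW hm).
by rewrite ler_wpM2l ?exprn_ge0 //; lra.
Qed.

Definition fop phi g : V := xget 0 [set h | H h /\ scvg ip (fun n => fcalc phi n g) h].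

Lemma fopP phi g : good phi -> H g -> H (fop phi g) /\ scvg ip (fun n => fcalc phi n g) (fop phi g).
Proof.
move=> [_ gp] Hg; rewrite /fop; case: xgetP => [h -> [] //|h0].
by have [h Hh cv] := gp g Hg; case: (h0 h).
Qed.

Lemma fopH phi g : good phi -> H g -> H (fop phi g).
Proof. by move=> gp Hg; have [] := fopP gp Hg. Qed.

Lemma fop_cvg phi g : good phi -> H g -> scvg ip (fun n => fcalc phi n g) (fop phi g).
Proof. by move=> gp Hg; have [] := fopP gp Hg. Qed.

Lemma nrm_fop_le phi B g : good phi -> H g -> 0 <= B ->
  (forall x, Sg x -> normc (phi x) <= B) -> N (fop phi g) <= B * N g.
Proof.
move=> gp Hg B0 hB; apply: (scvg_nrm_le hH _ (fopH gp Hg) (fop_cvg gp Hg)) => [n|].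
  exact: fcalcH.
by exists 0%N => n _; exact: nrm_fcalc_le.
Qed.

Lemma fop_uniq phi g h : good phi -> H g -> H h -> scvg ip (fun n => fcalc phi n g) h ->
  N (fop phi g - h) = 0.
Proof.
move=> gp Hg Hh cv; apply: (scvg_unique hH _ (fopH gp Hg) Hh (fop_cvg gp Hg) cv) => n.
exact: fcalcH.
Qed.

Lemma fopM phi psi g : good phi -> good psi -> H g ->
  N (fop (fun x => phi x * psi x) g - fop phi (fop psi g)) = 0.
Proof.
move=> gphi gpsi Hg; have Hp := fopH gpsi Hg.
apply: fop_uniq => //; [exact: goodM|exact: fopH|].
under eq_fun do rewrite fcalcM; move=> e e0.
have [[B B0 hB] _] := gphi.
have d0 : 0 < e / (2 * (B + 1)) by rewrite divr_gt0 // mulr_gt0 //; lra.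
have [n1 h1] := fop_cvg gpsi Hg d0; have [n2 h2] := fop_cvg gphi Hp (divr_gt0 e0 (ltr0Sn _ 1)).
exists (maxn n1 n2) => n; rewrite geq_max => /andP[/h1 {}h1 /h2 {}h2].
apply: le_lt_trans (ler_dist_nrmD hH (fcalcH _ _ _) (fopH gphi Hp) (fcalcH phi n (fop psi g))) _.
rewrite -fcalcBr //; last exact: fcalcH.
have := nrm_fcalc_le n (prehilbertB hH (fcalcH psi n g) Hp) B0 hB.
have : B * N (fcalc psi n g - fop psi g) <= (B + 1) * (e / (2 * (B + 1))).
  by apply: ler_pM; rewrite ?nrm_ge0 // ?(ltW h1) //; lra.
have -> : (B + 1) * (e / (2 * (B + 1))) = e / 2 by field; rewrite gt_eqF //; lra.
lra.
Qed.

Lemma fop_eq phi psi g : good phi -> good psi -> H g -> (forall x, Sg x -> phi x = psi x) ->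
  N (fop phi g - fop psi g) = 0.
Proof.
move=> gphi gpsi Hg e; apply: fop_uniq => //; first exact: fopH.
by apply: scvg_near (fop_cvg gpsi Hg); exists 0%N => n _; apply/esym/fcalc_eq.
Qed.

Lemma fop_lin phi psi a g : good phi -> good psi -> H g ->
  N (fop (fun x => a * phi x + psi x) g - (a *: fop phi g + fop psi g)) = 0.
Proof.
move=> gphi gpsi Hg; have g1 := goodZ a gphi; have Hphi := fopH gphi Hg; have Hpsi := fopH gpsi Hg.
have HaZ := prehilbertZ hH a Hphi.
apply: fop_uniq => //; [exact: goodD|exact: (prehilbertD hH)|].
under eq_fun do rewrite fcalcD fcalcZ.
apply: (scvgD hH) => // [n|n||]; try exact: fcalcH; try exact: fop_cvg.
  by apply: (prehilbertZ hH); exact: fcalcH.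
by apply: (scvgZ hH) => // [n|]; [exact: fcalcH|exact: fop_cvg].
Qed.

Lemma fopBr phi g h : good phi -> H g -> H h -> N (fop phi (g - h) - (fop phi g - fop phi h)) = 0.
Proof.
move=> gp Hg Hh; have Hgh := prehilbertB hH Hg Hh.
have Hpg := fopH gp Hg; have Hph := fopH gp Hh.
apply: fop_uniq => //; first exact: (prehilbertB hH).
under eq_fun do rewrite fcalcBr //.
by apply: (scvgB hH) => // [n|n||]; try exact: fcalcH; exact: fop_cvg.
Qed.

Lemma fop_dist phi B g h : good phi -> H g -> H h -> 0 <= B ->
  (forall x, Sg x -> normc (phi x) <= B) -> N (fop phi g - fop phi h) <= B * N (g - h).
Proof.
move=> gp Hg Hh B0 hB; have Hgh := prehilbertB hH Hg Hh.
have Hd := fopH gp Hgh; have Hpg := fopH gp Hg; have Hph := fopH gp Hh.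
apply: le_trans (nrm_fop_le gp Hgh B0 hB).
have := ler_dist_nrmD hH (prehilbertB hH Hpg Hph) (prehilbert0 hH) Hd.
by rewrite !subr0 (nrm_sub hH (prehilbertB hH Hpg Hph) Hd) fopBr // add0r.
Qed.

(** * Graph and resolvents of the limit operator *)

Variables (K : set V) (A : V -> V).
Hypothesis KH : K `<=` H.
Hypothesis AH : forall f, K f -> H (A f).
Hypothesis dK : sdense H ip K.
Hypothesis approx : forall f, K f -> exists n0, forall n, (n0 <= n)%N ->
  fcalc (fun=> 1) n f = f /\ fcalc (fun x => x%:C) n f = A f.

(** The closure of the operator A on the core [K], as a graph; in the application it is the graph of
    the generator. *)
Definition sgraph : set (V * V) :=
  [set p | [/\ H p.1, H p.2 & exists u : nat -> V, [/\ forall n, K (u n),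
    scvg ip u p.1 & scvg ip (fun n => A (u n)) p.2]]].

(** On the core, z f - A f is (z - x)(A_n) f for large n, so phi(A_n) acts on it as the product phi
    (z - x). The threshold [n0] depends on f alone. *)
Lemma fcalc_shift f : K f -> exists n0, forall n, (n0 <= n)%N -> forall phi theta z,
  (forall x, Sg x -> phi x * (z - x%:C) = theta x) -> fcalc phi n (z *: f - A f) = fcalc theta n f.
Proof.
move=> Kf; have [n0 h0] := approx Kf; exists n0 => n /h0[h1 hx] phi theta z e.
have -> : z *: f - A f = fcalc (fun x => z - x%:C) n f.
  rewrite -{1}h1 -hx -fcalcZ /fcalc -sumrB; apply: eq_bigr => i _.
  by rewrite mulr1 mulrBl scalerBl.
by rewrite -fcalcM; exact: fcalc_eq.
Qed.

Lemma shiftH z f : K f -> H (z *: f - A f).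
Proof. by move=> Kf; apply: (prehilbertB hH); [apply: (prehilbertZ hH); exact: KH|exact: AH]. Qed.

(** phi(L)(z - L) = theta(L) holds on the core by [fcalc_shift] and passes to the closed graph
    because [fop phi] and [fop theta] are bounded. With theta = 1 or theta = chi this gives
    injectivity and lower bounds for z - L. *)
Lemma sgraph_shift phi theta z f h : good phi -> good theta ->
  (forall x, Sg x -> phi x * (z - x%:C) = theta x) -> sgraph (f, h) ->
  N (fop phi (z *: f - h) - fop theta f) = 0.
Proof.
move=> gphi gtheta e [/= Hf Hh [u [Ku cu cAu]]].
have Hzf := prehilbertB hH (prehilbertZ hH z Hf) Hh.
have Hu n : H (u n) by exact: KH.
have HzA n : H (z *: u n - A (u n)) by exact: shiftH.
apply: (scvg_unique hH (u := fun j => fop phi (z *: u j - A (u j)))).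
- by move=> n; exact: fopH.
- exact: fopH.
- exact: fopH.
- have [[B B0 hB] _] := gphi => eps eps0.
  have c : scvg ip (fun n => z *: u n - A (u n)) (z *: f - h).
    apply: (scvgB hH) => // [n|n||]; try by apply: (prehilbertZ hH); rewrite ?KH.
      exact: AH.
    exact: (scvgZ hH).
  have d0 : 0 < eps / (B + 1) by rewrite divr_gt0 //; lra.
  have [n0 h0] := c _ d0; exists n0 => n /h0; rewrite ltr_pdivlMr; last by lra.
  apply: le_lt_trans; apply: le_trans (fop_dist gphi (HzA n) Hzf B0 hB) _.
  rewrite mulrC ler_wpM2l ?nrm_ge0 //; lra.
- have [[B B0 hB] _] := gtheta => eps eps0.
  have d0 : 0 < eps / (B + 1) by rewrite divr_gt0 //; lra.
  have [n0 h0] := cu _ d0; exists n0 => n /h0; rewrite ltr_pdivlMr; last by lra.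
  apply: le_lt_trans.
  apply: (@le_trans _ _ (N (fop theta (u n) - fop theta f))); last first.
    apply: le_trans (fop_dist gtheta (Hu n) Hf B0 hB) _.
    rewrite mulrC ler_wpM2l ?nrm_ge0 //; lra.
  have Ht : N (fop phi (z *: u n - A (u n)) - fop theta (u n)) = 0.
    apply: fop_uniq => //; first exact: fopH.
    have [n1 h1] := fcalc_shift (Ku n).
    apply: scvg_near (fop_cvg gtheta (Hu n)); exists n1 => m hm.
    by rewrite (h1 m hm phi theta z e).
  have := ler_dist_nrmD hH (fopH gphi (HzA n)) (fopH gtheta Hf) (fopH gtheta (Hu n)).
  by rewrite Ht add0r.
Qed.

Definition rs z (x : R) : R[i] := (z - x%:C)^-1.

Lemma normc_gt0 (z : R[i]) : (0 < normc z) = (z != 0).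
Proof.
rewrite lt_def normc_ge0 andbT; congr (~~ _); apply/eqP/eqP => [/eq0_normc //|->].
exact: normc0.
Qed.

Lemma fbounded_rs z c : 0 < c -> (forall x : R, Sg x -> c <= normc (z - x%:C)) -> fbounded (rs z).
Proof.
move=> c0 h; exists c^-1 => [|x /h hx]; first by rewrite invr_ge0 ltW.
by rewrite normcV lef_pV2 // posrE // (lt_le_trans c0).
Qed.

(** The resolvent identity rs z = rs w + (w - z) rs w rs z is a fixed-point equation for rs z,
    contracting when |z - w| <= rho |w - x| on [Sg]. *)
Lemma rs_step z w rho c : good (rs w) -> rho < 1 ->
  (forall x, Sg x -> normc (z - w) <= rho * normc (w - x%:C)) -> 0 < c ->
  (forall x : R, Sg x -> c <= normc (z - x%:C)) -> (forall x, Sg x -> w - x%:C != 0) ->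
  good (rs z).
Proof.
move=> gw rho1 hrho c0 hc w0.
apply: (good_fix gw (goodZ (w - z) gw) rho1) => [x Sx||x Sx].
- rewrite /rs normcM normcV normc_sub ler_pdivrMr ?normc_gt0 ?w0 //; exact: hrho.
- exact: fbounded_rs hc.
- have z0 : z - x%:C != 0 by rewrite -normc_gt0 (lt_le_trans c0) ?hc.
  by rewrite /rs; field; rewrite z0 w0.
Qed.

Variable z0 : R.
Hypothesis z0_lt0 : z0 < 0.
Hypothesis Sg_ge0 : forall x : R, Sg x -> 0 <= x.
Hypothesis dense_z0 : sdense H ip [set z0%:C *: f - A f | f in K].

Lemma normr_Re_sub_le (z : R[i]) (x : R) : `|complex.Re z - x| <= normc (z - x%:C).
Proof. by have := normr_Re_le (z - x%:C); rewrite Re_add /=; case: z. Qed.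

Lemma normr_Im_sub_le (z : R[i]) (x : R) : `|complex.Im z| <= normc (z - x%:C).
Proof. by have := normr_Im_le (z - x%:C); case: z => a b /=; rewrite subr0. Qed.

(** On the dense set of vectors z0 f - A f the finite-volume resolvents are eventually equal to f,
    so convergence is trivial there. *)
Lemma good_rs0 : good (rs z0%:C).
Proof.
have hc x : Sg x -> - z0 <= normc (z0%:C - x%:C).
  by move=> /Sg_ge0 x0; apply: le_trans (normr_Re_sub_le _ _); exact: oppr_le_normB.
have z0' : 0 < - z0 by rewrite oppr_gt0.
apply: (good_sdense _ dense_z0) => [_ [f Kf <-]||_ [f Kf <-]]; first exact: shiftH.
  exact: fbounded_rs hc.
exists f; first exact: KH.
have [n0 h0] := fcalc_shift Kf; have [n1 h1] := approx Kf.
apply: scvg_near (scvg_cst hH f); exists (maxn n0 n1) => n.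
rewrite geq_max => /andP[/h0 {}h0 /h1 [{}h1 _]]; rewrite (h0 _ (fun=> 1)) // => x Sx.
by rewrite /rs mulVf // -normc_gt0 (lt_le_trans z0') ?hc.
Qed.

(* The line Re w = z0 is at distance at least - z0 from [Sg], so the Neumann series
   allows vertical steps of length - z0 / 2. *)
Lemma good_rs_vertical (s : R) m : `|s| = 1 -> good (rs (z0 +i* (m%:R * (s * (- z0 / 2))))).
Proof.
move=> s1; have z0' : 0 < - z0 by rewrite oppr_gt0.
have hc y x : Sg x -> - z0 <= normc (z0 +i* y - x%:C).
  by move=> /Sg_ge0 x0; apply: le_trans (normr_Re_sub_le _ _); exact: oppr_le_normB.
elim: m => [|m IH]; first by rewrite mul0r; exact: good_rs0.
apply: (rs_step (rho := 2^-1) (c := - z0) IH) => [|x Sx||x Sx|x Sx] //.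
- lra.
- have -> : z0 +i* (m.+1%:R * (s * (- z0 / 2))) - z0 +i* (m%:R * (s * (- z0 / 2))) = (s * (- z0 / 2))%:C * 'i%C.
    by apply/eqP; rewrite eq_complex /= -natr1; apply/andP; split; apply/eqP; ring.
  rewrite normcM normcR normrM s1 mul1r ger0_norm; last by lra.
  have := hc (m%:R * (s * (- z0 / 2))) x Sx.
  have -> : normc ('i%C : R[i]) = 1 by rewrite /= expr0n add0r expr1n sqrtr1.
  lra.
- exact: hc.
- by rewrite -normc_gt0 (lt_le_trans z0') ?hc.
Qed.

(* A point z off the real axis is reached in one step from the vertical line:
   |z - (z0 + i y)| < |y| as soon as y is large and of the sign of Im z. *)
Lemma good_rs_nonreal z : complex.Im z != 0 -> good (rs z).
Proof.
move=> v0; set v := complex.Im z in v0 *; set u := complex.Re z.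
have z0' : 0 < - z0 by rewrite oppr_gt0.
set s := Num.sg v; have s1 : `|s| = 1 by rewrite normr_sg v0.
have vp : 0 < `|v| by rewrite normr_gt0.
(* |z - w|^2 = (u - z0)^2 + (v - y)^2 is below y^2 exactly when (u - z0)^2 + v^2 < 2 v y, and 2 v y
   = m |v| (- z0). *)
set q := ((u - z0) ^+ 2 + v ^+ 2) / (`|v| * - z0).
have [m hm] : exists m : nat, q < m%:R.
  by exists (Num.bound q); apply: archi_boundP; rewrite divr_ge0 ?addr_ge0 ?sqr_ge0 // mulr_ge0 // ltW.
set y := m%:R * (s * (- z0 / 2)).
have mp : 0 < m%:R :> R.
  by apply: le_lt_trans hm; rewrite divr_ge0 ?addr_ge0 ?sqr_ge0 // mulr_ge0 // ltW.
have yy : `|y| = m%:R * (- z0 / 2).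
  by rewrite normrM normr_nat normrM s1 mul1r ger0_norm // divr_ge0 ?(ltW z0').
have y0 : 0 < `|y| by rewrite yy mulr_gt0 // divr_gt0.
have vy : v * y = `|v| * `|y|.
  by rewrite yy /y [X in _ = X * _]normrEsg -/s; ring.
set w := z0 +i* y.
have small : normc (z - w) < `|y|.
  rewrite -(@ltr_pXn2r _ 2) ?nnegrE ?normc_ge0 // sqr_normcE.
  have -> : complex.Re (z - w) = u - z0 by rewrite /u; case: (z).
  have -> : complex.Im (z - w) = v - y by rewrite /v; case: (z).
  have : (u - z0) ^+ 2 + v ^+ 2 < 2 * (`|v| * `|y|).
    have -> : 2 * (`|v| * `|y|) = m%:R * (`|v| * - z0) by rewrite yy; field.
    by rewrite -ltr_pdivrMr // mulr_gt0.
  by rewrite real_normK ?num_real // -vy; lra.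
apply: (rs_step (rho := normc (z - w) / `|y|) (c := `|v|) (good_rs_vertical m s1)) => [|x Sx||x Sx|x Sx] //.
- by rewrite ltr_pdivrMr // mul1r.
- rewrite -/y -/w -mulrA ler_peMr ?normc_ge0 // mulrC ler_pdivlMr // mul1r.
  exact: (normr_Im_sub_le w).
- exact: normr_Im_sub_le.
- by rewrite -normc_gt0 (lt_le_trans y0) // (normr_Im_sub_le w).
Qed.

Lemma invf_sqrt1D_lt1 (c : R) : 0 < c -> (Num.sqrt (1 + c ^+ 2))^-1 < 1.
Proof.
move=> c0; rewrite invf_lt1 ?sqrtr_gt0 ?ltr_wpDr ?sqr_ge0 //.
by rewrite -{1}sqrtr1 ltr_sqrt ?ltrDl ?exprn_gt0 // ltr_wpDr ?sqr_ge0.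
Qed.

Lemma normc_shift_i (x y c : R) : 0 <= c -> c <= `|y - x| ->
  Num.sqrt (1 + c ^+ 2) <= normc (y +i* 1 - x%:C).
Proof.
move=> c0 h /=; rewrite ler_sqrt; last by rewrite addr_ge0 ?sqr_ge0.
rewrite subr0 expr1n addrC lerD2r -[leRHS]real_normK ?num_real //.
by rewrite ler_pXn2r ?nnegrE.
Qed.

(** A real z is reached from w = z + i: the step has length 1, while w is at distance at least
    sqrt(1 + c^2) > 1 from [Sg]. *)
Lemma good_rs z c : 0 < c -> (forall x : R, Sg x -> c <= normc (z - x%:C)) -> good (rs z).
Proof.
move=> c0 hc; have [v0|] := eqVneq (complex.Im z) 0; last exact: good_rs_nonreal.
have zE : z = (complex.Re z)%:C by move: v0; case: (z) => a b /= ->.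
set y := complex.Re z in zE; set w := y +i* 1.
have s0 : 0 < Num.sqrt (1 + c ^+ 2) by rewrite sqrtr_gt0 ltr_wpDr ?sqr_ge0.
have hw x : Sg x -> Num.sqrt (1 + c ^+ 2) <= normc (w - x%:C).
  move=> Sx; apply: normc_shift_i; first exact: ltW.
  have := hc _ Sx; have -> : z - x%:C = (y - x)%:C by rewrite rmorphB /= -zE.
  by rewrite normcR.
apply: (rs_step (w := w) (rho := (Num.sqrt (1 + c ^+ 2))^-1) (c := c)) => [||x Sx||x Sx|x Sx] //.
- by apply: good_rs_nonreal; rewrite oner_eq0.
- exact: invf_sqrt1D_lt1.
- have -> : normc (z - w) = 1.
    by rewrite zE /w /= subrr expr0n add0r sub0r sqrrN expr1n sqrtr1.
  by rewrite mulrC ler_pdivlMr // mul1r hw.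
- exact: hc.
- by rewrite -normc_gt0 (lt_le_trans s0) ?hw.
Qed.

Variable wd : R.
Hypothesis wd_le : wd <= 4^-1.
Hypothesis Sg_gap : forall x : R, Sg x -> [\/ x = 0, `|x - 1| <= wd | 7 / 4 <= x].

Definition chi (x : R) : R[i] := if `|x - 1| <= wd then 1 else 0.

Lemma Sg_away_from_one x : Sg x -> ~~ (`|x - 1| <= wd) -> 3 / 4 <= `|x - 1|.
Proof.
move=> /Sg_gap[->|->//|h] _; first by rewrite sub0r normrN1; lra.
by rewrite ger0_norm; lra.
Qed.

(* Iterating [t |-> 3 t^2 - 2 t^3] pushes values near 0 and 1 towards 0 and 1. *)
Lemma good_chi : good chi.
Proof.
(* The starting function is 1/4 times the product of the resolvents at 1 + i/2 and 1 - i/2. It is at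
   least 4/5 where |x - 1| <= 1/4 and at most 4/13 where |x - 1| >= 3/4. *)
pose T := fix T m (x : R) : R := if m is m.+1 then 3 * T m x ^+ 2 - 2 * T m x ^+ 3
  else (1 + 4 * (x - 1) ^+ 2)^-1.
pose TC m x : R[i] := (T m x)%:C.
have gT m : good (TC m).
  elim: m => [|m IH].
    have g1 : good (rs (1 +i* 2^-1)) by apply: good_rs_nonreal; rewrite /= invr_eq0 pnatr_eq0.
    have g2 : good (rs (1 -i* 2^-1)).
      by apply: good_rs_nonreal; rewrite /= oppr_eq0 invr_eq0 pnatr_eq0.
    apply: good_eq (goodZ (4^-1)%:C (goodM g1 g2)) => x _.
    rewrite /rs /TC -invfM.
    have -> : (1 +i* 2^-1 - x%:C) * (1 -i* 2^-1 - x%:C) = (4^-1 * (1 + 4 * (x - 1) ^+ 2))%:C.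
      by apply/eqP; rewrite eq_complex /=; apply/andP; split; apply/eqP; field.
    rewrite -fmorphV -rmorphM /= invfM invrK mulrA mulVf ?pnatr_eq0 // mul1r //.
  apply: good_eq (goodD (goodZ 3 (goodM IH IH)) (goodZ (-2) (goodM IH (goodM IH IH)))) => x _.
  rewrite /TC; have -> : T m.+1 x = 3 * (T m x * T m x) - 2 * (T m x * (T m x * T m x)) by rewrite /=; ring.
  by rewrite rmorphB !rmorphM /= !rmorph_nat mulNr.
(* 5/16 dominates both initial errors 1/5 and 4/13. For 0 <= r <= 5/16 one has r (3 - 2 r) <= 3 r <=
   15/16, hence the geometric rate. *)
pose ee m : R := 5 / 16 * (15 / 16) ^+ m.
have ee_le m : 0 <= ee m <= 5 / 16.
  have h1 : (15 / 16 : R) ^+ m <= 1 by apply: exprn_ile1; lra.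
  have h0 : 0 <= (15 / 16 : R) ^+ m by apply: exprn_ge0; lra.
  rewrite /ee; nra.
have hT m x : Sg x -> if `|x - 1| <= wd then 0 <= 1 - T m x <= ee m else 0 <= T m x <= ee m.
  move=> Sx; elim: m => [|m IH].
    have a2 : (x - 1) ^+ 2 = `|x - 1| ^+ 2 by rewrite real_normK ?num_real.
    have p : 0 < 1 + 4 * (x - 1) ^+ 2 by rewrite ltr_pwDl // mulr_ge0 ?sqr_ge0.
    rewrite /ee expr0 mulr1; case: ifPn => [h|/(Sg_away_from_one Sx) h] /=.
      have h2 : `|x - 1| ^+ 2 <= 4^-1 ^+ 2.
        by rewrite ler_pXn2r ?nnegrE ?normr_ge0 ?invr_ge0 // (le_trans h).
      rewrite subr_ge0 invf_le1 // lerDl mulr_ge0 ?sqr_ge0 //= lerBlDr -lerBlDl.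
      by rewrite -[leRHS]mul1r ler_pdivlMr // a2; lra.
    have h2 : (3 / 4) ^+ 2 <= `|x - 1| ^+ 2.
      by rewrite ler_pXn2r ?nnegrE ?normr_ge0 ?divr_ge0.
    by rewrite invr_ge0 (ltW p) /= -[leLHS]mul1r ler_pdivrMr // a2; lra.
  have [e0 e1] := andP (ee_le m).
  have -> : ee m.+1 = 15 / 16 * ee m by rewrite /ee exprS; ring.
  move: IH => /=; set t := T m x; case: ifP => _ /andP[t0 t1].
    set r := 1 - t in t0 t1.
    (* The cubic commutes with t -> 1 - t, so errors at 1 obey the same recursion as errors at 0. *)
    have -> : 1 - (3 * t ^+ 2 - 2 * t ^+ 3) = r ^+ 2 * (3 - 2 * r) by rewrite /r; ring.
    apply/andP; split; first by nra.
    have : r * (3 - 2 * r) <= 15 / 16 by nra.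
    nra.
  have -> : 3 * t ^+ 2 - 2 * t ^+ 3 = t ^+ 2 * (3 - 2 * t) by ring.
  apply/andP; split; first by nra.
  have : t * (3 - 2 * t) <= 15 / 16 by nra.
  nra.
apply: (good_lim) => e e0.
have : (15 / 16 : R) ^+ m @[m --> \oo] --> (0 : R) by apply: cvg_expr; rewrite ger0_norm; lra.
move=> /cvgrPdist_lt /(_ e e0)[m _ /(_ m (leqnn m)) /=].
have p0 : 0 <= (15 / 16 : R) ^+ m by apply: exprn_ge0; lra.
rewrite sub0r normrN ger0_norm // => hm; exists (TC m) => // x Sx.
have em : ee m <= e by rewrite /ee; move: hm p0; lra.
have := hT m x Sx; rewrite /chi /TC; case: ifP => _ /andP[h0 h1].
  by rewrite -[1]/(1%:C) -rmorphB normcR ger0_norm // (le_trans h1).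
by rewrite sub0r normcN normcR ger0_norm // (le_trans h1).
Qed.

Lemma sgraph_eq f h f' h' : H f' -> H h' -> N (f - f') = 0 -> N (h - h') = 0 ->
  sgraph (f, h) -> sgraph (f', h').
Proof.
move=> Hf' Hh' ef eh [/= Hf Hh [u [Ku cu cA]]]; split => //; exists u; split => //.
  by apply: (scvg_eq hH _ Hf Hf' ef cu) => n; exact: KH.
by apply: (scvg_eq hH _ Hh Hh' eh cA) => n; exact: AH.
Qed.

Lemma nrm_eq0_trans f g h : H f -> H g -> H h -> N (f - g) = 0 -> N (g - h) = 0 -> N (f - h) = 0.
Proof.
move=> Hf Hg Hh a b; apply/le_anti; rewrite nrm_ge0 andbT.
by apply: le_trans (ler_dist_nrmD hH Hf Hh Hg) _; rewrite a b addr0.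
Qed.

Lemma nrm_eq0_sym f g : H f -> H g -> N (f - g) = 0 -> N (g - f) = 0.
Proof. by move=> Hf Hg; rewrite (nrm_sub hH Hf Hg). Qed.

Lemma good1 : good (fun=> 1).
Proof.
apply: (good_sdense KH dK) => [|f Kf]; first by exists 1 => // x _; rewrite normc1.
exists f; first exact: KH.
have [n0 h0] := approx Kf; apply: scvg_near (scvg_cst hH f).
by exists n0 => n /h0[-> _].
Qed.

Lemma fop1_K f : K f -> N (fop (fun=> 1) f - f) = 0.
Proof.
move=> Kf; have Hf := KH Kf; apply: (fop_uniq good1 Hf Hf).
have [n0 h0] := approx Kf; apply: scvg_near (scvg_cst hH f).
by exists n0 => n /h0[-> _].
Qed.

Lemma fop1 g : H g -> N (fop (fun=> 1) g - g) = 0.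
Proof.
move=> Hg; have H1 := fopH good1 Hg; apply: nrm_eq0_eps.
move=> e e0; have [f Kf fg] := dK Hg (divr_gt0 e0 (ltr0Sn _ 1)).
have Hf := KH Kf; have H1f := fopH good1 Hf.
have := fop_dist (B := 1) good1 Hg Hf ler01 (fun x _ => _).
rewrite mul1r (nrm_sub hH Hg Hf) => /(_ ltac:(by rewrite normc1)) h.
have := ler_dist_nrmD hH H1 Hg H1f; have := ler_dist_nrmD hH H1f Hg Hf.
rewrite fop1_K //; lra.
Qed.

Lemma fopZr phi a g : good phi -> H g -> N (fop phi (a *: g) - a *: fop phi g) = 0.
Proof.
move=> gp Hg; have Hpg := fopH gp Hg.
apply: fop_uniq => //; try exact: (prehilbertZ hH).
have -> : (fun n => fcalc phi n (a *: g)) = (fun n => a *: fcalc phi n g).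
  apply/funext => n; rewrite /fcalc scaler_sumr; apply: eq_bigr => i _.
  by rewrite (ipZr hH) // scalerA mulrCA.
by apply: (scvgZ hH) => [n||]; [exact: fcalcH|exact: fopH|exact: fop_cvg].
Qed.

(** With psi = (z0 - x) phi, choose u_n in [K] such that (z0 - A) u_n tends to psi(L) g. Applying
    the bounded resolvent at z0 shows u_n -> phi(L) g, and then A u_n = z0 u_n - (z0 - A) u_n tends
    to theta(L) g. *)
Lemma sgraph_fop phi theta g : good phi -> good theta ->
  (forall x, Sg x -> theta x = x%:C * phi x) -> H g -> sgraph (fop phi g, fop theta g).
Proof.
move=> gphi gtheta e Hg.
pose psi x := z0%:C * phi x + (-1) * theta x.
have gpsi : good psi by apply: goodD; exact: goodZ.
have g0 := good_rs0.
have Hpsi := fopH gpsi Hg; have Hphi := fopH gphi Hg; have Htheta := fopH gtheta Hg.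
have /choice[u hu] n : exists f, K f /\ N (z0%:C *: f - A f - fop psi g) < n.+1%:R^-1.
  have p : 0 < n.+1%:R^-1 :> R by rewrite invr_gt0.
  by have [_ [f Kf <-] h] := dense_z0 Hpsi p; exists f.
have Ku n : K (u n) by have [] := hu n.
have Hu n : H (u n) := KH (Ku n).
have HA n : H (A (u n)) := AH (Ku n).
have HzA n : H (z0%:C *: u n - A (u n)) := shiftH _ (Ku n).
have cv : scvg ip (fun n => z0%:C *: u n - A (u n)) (fop psi g).
  move=> eps eps0; have [m hm] : exists m : nat, eps^-1 < m%:R.
    by exists (Num.bound eps^-1); apply: archi_boundP; rewrite invr_ge0 ltW.
  exists m => n mn; have [_ h] := hu n; apply: lt_trans h _.
  rewrite invf_plt ?posrE //; apply: lt_le_trans hm _; rewrite ler_nat; exact: leqW.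
have hc x : Sg x -> z0%:C - x%:C != 0.
  move=> /Sg_ge0 x0; rewrite -normc_gt0; apply: lt_le_trans (normr_Re_sub_le _ _) => /=.
  by apply: lt_le_trans (oppr_le_normB z0_lt0 x0); rewrite oppr_gt0.
have ur n : N (fop (rs z0%:C) (z0%:C *: u n - A (u n)) - u n) = 0.
  apply: fop_uniq => //; have [n0 h0] := fcalc_shift (Ku n); have [n1 h1] := approx (Ku n).
  apply: scvg_near (scvg_cst hH (u n)); exists (maxn n0 n1) => m.
  rewrite geq_max => /andP[/h0 {}h0 /h1[{}h1 _]]; rewrite (h0 _ (fun=> 1)) // => x Sx.
  by rewrite /rs mulVf // hc.
have pr : N (fop phi g - fop (rs z0%:C) (fop psi g)) = 0.
  apply: nrm_eq0_trans (fopM g0 gpsi Hg) => //; try exact: fopH.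
    by apply: fopH => //; exact: goodM.
  apply: fop_eq => //; first exact: goodM.
  move=> x Sx; rewrite /psi /rs e //.
  have -> : z0%:C * phi x + -1 * (x%:C * phi x) = (z0%:C - x%:C) * phi x by ring.
  by rewrite mulKf ?hc.
have cu : scvg ip u (fop phi g).
  have [[B B0 hB] _] := g0 => eps eps0.
  have d0 : 0 < eps / (B + 1) by rewrite divr_gt0 //; lra.
  have [n0 h0] := cv _ d0; exists n0 => n /h0; rewrite ltr_pdivlMr; last by lra.
  have H1 := fopH g0 (HzA n); have H2 := fopH g0 Hpsi.
  have := fop_dist g0 (HzA n) Hpsi B0 hB.
  have := ler_dist_nrmD hH (Hu n) Hphi H1; rewrite (nrm_sub hH (Hu n) H1) ur add0r.
  have := ler_dist_nrmD hH H1 Hphi H2; rewrite (nrm_sub hH H2 Hphi) pr addr0.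
  have := nrm_ge0 ip (z0%:C *: u n - A (u n) - fop psi g).
  set t := N (_ - fop psi g); set t2 := N (u n - _); move=> t0 a b c d.
  by apply: le_lt_trans d; rewrite mulrDr mulr1 mulrC; lra.
split => //; exists u; split => //.
have Hz := prehilbertZ hH z0%:C Hphi.
have H3 := prehilbertB hH Hz Hpsi.
apply: (scvg_eq hH (l := z0%:C *: fop phi g - fop psi g)) => //.
  have H4 : H (z0%:C *: fop phi g + fop (fun x => -1 * theta x) g).
    by apply: (prehilbertD hH) => //; apply: fopH => //; exact: goodZ.
  have Hm := fopH (goodZ (-1) gtheta) Hg.
  have HN := prehilbertN hH Htheta.
  have l1 := fop_lin z0%:C gphi (goodZ (-1) gtheta) Hg; rewrite -/psi in l1.
  have l2 : N (fop (fun x => -1 * theta x) g - - fop theta g) = 0.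
    apply: fop_uniq => //; first exact: goodZ.
    under eq_fun do rewrite fcalcZ; rewrite -(scaleN1r (fop theta g)); apply: (scvgZ hH) => // [n|].
      exact: fcalcH.
    exact: fop_cvg.
  have -> : z0%:C *: fop phi g - fop psi g - fop theta g =
    - ((fop psi g - (z0%:C *: fop phi g + fop (fun x => -1 * theta x) g)) +
       (fop (fun x => -1 * theta x) g - - fop theta g)).
    set p := fop psi g; set q := z0%:C *: _; set c := fop _ g.
    by rewrite opprK (opprD q) !addrA subrK opprD opprB.
  have HH1 := prehilbertB hH Hpsi H4; have HH2 := prehilbertB hH Hm HN.
  rewrite (nrmN hH); last exact: (prehilbertD hH).
  by apply/le_anti; rewrite nrm_ge0 andbT; apply: le_trans (ler_nrmD hH _ _) _ => //; rewrite l1 l2 addr0.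
have -> : (fun n => A (u n)) = (fun n => z0%:C *: u n - (z0%:C *: u n - A (u n))).
  by apply/funext => n; rewrite opprB addrC subrK.
apply: (scvgB hH) => // [n|]; first exact: (prehilbertZ hH).
exact: (scvgZ hH).
Qed.

Lemma resolvent_sgraph z c g : 0 < c -> (forall x : R, Sg x -> c <= normc (z - x%:C)) ->
  H g -> sgraph (fop (rs z) g, z *: fop (rs z) g - g).
Proof.
move=> c0 hc Hg; have gz := good_rs c0 hc.
(* On [Sg], x / (z - x) = z / (z - x) - 1, so this function plays the role of theta in
   [sgraph_fop]. *)
have gt : good (fun x => z * rs z x + (-1) * 1) by apply: goodD; apply: goodZ => //; exact: good1.
have Hz := fopH gz Hg; have Hzz := prehilbertZ hH z Hz; have H1 := fopH good1 Hg.
have HN := prehilbertB hH Hzz Hg.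
have Ht := fopH gt Hg.
apply: sgraph_eq (sgraph_fop gz gt _ Hg) => //; first by rewrite subrr (nrm0 hH).
- apply: (@nrm_eq0_trans _ (z *: fop (rs z) g - fop (fun=> 1) g)) => //.
  + exact: (prehilbertB hH).
  + apply: fop_uniq => //; first exact: (prehilbertB hH).
    under eq_fun do rewrite fcalcD !fcalcZ scaleN1r; apply: (scvgB hH) => // [n|n||].
    * by apply: (prehilbertZ hH); exact: fcalcH.
    * exact: fcalcH.
    * by apply: (scvgZ hH) => // [n|]; [exact: fcalcH|exact: fop_cvg].
    * exact: fop_cvg good1 Hg.
  + have -> : z *: fop (rs z) g - fop (fun=> 1) g - (z *: fop (rs z) g - g) = - (fop (fun=> 1) g - g).
      by rewrite !opprB addrC addrA subrK.
    by rewrite (nrmN hH) ?fop1 //; exact: (prehilbertB hH).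
- move=> x Sx; have zx : z - x%:C != 0 by rewrite -normc_gt0 (lt_le_trans c0) ?hc.
  by rewrite /rs; field.
Qed.

Lemma sgraph_bounded_below z c f h : 0 < c -> (forall x : R, Sg x -> c <= normc (z - x%:C)) ->
  sgraph (f, h) -> N f <= c^-1 * N (z *: f - h).
Proof.
move=> c0 hc gfh; have gz := good_rs c0 hc; have [/= Hf Hh _] := gfh.
have e x : Sg x -> rs z x * (z - x%:C) = 1.
  by move=> Sx; rewrite /rs mulVf // -normc_gt0 (lt_le_trans c0) ?hc.
have Hzf := prehilbertB hH (prehilbertZ hH z Hf) Hh.
have := sgraph_shift gz good1 e gfh.
have H1 := fopH good1 Hf; have H2 := fopH gz Hzf.
have ci : 0 <= c^-1 by rewrite invr_ge0 ltW.
have hci x : Sg x -> normc (rs z x) <= c^-1.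
  by move=> /hc hx; rewrite normcV lef_pV2 // posrE // (lt_le_trans c0).
have := nrm_fop_le gz Hzf ci hci => b /(nrm_eq0_sym H2 H1) a.
have t := nrm_eq0_trans Hf H1 H2 (nrm_eq0_sym H1 Hf (fop1 Hf)) a.
have := ler_nrmD hH (prehilbertB hH Hf H2) H2; rewrite subrK t add0r => h1.
exact: le_trans h1 b.
Qed.

Lemma resolvent_unique z c f g : 0 < c -> (forall x : R, Sg x -> c <= normc (z - x%:C)) ->
  H g -> sgraph (f, z *: f - g) -> N (f - fop (rs z) g) = 0.
Proof.
move=> c0 hc Hg gfh; have gz := good_rs c0 hc; have [/= Hf Hh _] := gfh.
have e x : Sg x -> rs z x * (z - x%:C) = 1.
  by move=> Sx; rewrite /rs mulVf // -normc_gt0 (lt_le_trans c0) ?hc.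
have := sgraph_shift gz good1 e gfh.
have -> : z *: f - (z *: f - g) = g by rewrite opprB addrC subrK.
move=> a.
have H1 := fopH good1 Hf; have H2 := fopH gz Hg.
apply: (@nrm_eq0_trans _ (fop (fun=> 1) f)) => //; apply: nrm_eq0_sym => //; exact: fop1.
Qed.

(** The range of the projection chi(L), described by its fixed points so as to be closed under
    modification by null vectors. *)
Definition branch_space : set V := [set h | H h /\ N (h - fop chi h) = 0].

Lemma chi_idem x : chi x * chi x = chi x.
Proof. by rewrite /chi; case: ifP; rewrite ?mul1r ?mul0r. Qed.

Lemma branch_space_fop phi g : good phi -> H g -> branch_space (fop (fun x => chi x * phi x) g).
Proof.
move=> gp Hg; have g1 := goodM good_chi gp; have Hc := fopH g1 Hg; split => //.
apply: nrm_eq0_sym => //; first by apply: fopH => //; exact: good_chi.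
have Hcc := fopH good_chi Hc.
have g2 := goodM good_chi g1.
apply: (nrm_eq0_trans Hcc (fopH g2 Hg)) => //.
  by apply: nrm_eq0_sym; [exact: fopH| |exact: fopM good_chi g1 Hg].
by apply: fop_eq => // x _; rewrite mulrA chi_idem.
Qed.

Lemma branch_space_eq f g : branch_space f -> H g -> N (f - g) = 0 -> branch_space g.
Proof.
move=> [Hf cf] Hg fg; split => //; have gf := nrm_eq0_sym Hf Hg fg.
have H1 := fopH good_chi Hf; have H2 := fopH good_chi Hg.
apply: (nrm_eq0_trans Hg Hf H2 gf); apply: (nrm_eq0_trans Hf H1 H2 cf).
apply/le_anti; rewrite nrm_ge0 andbT.
have := fop_dist (B := 1) good_chi Hf Hg ler01; rewrite fg mulr0; apply => x _.
by rewrite /chi; case: ifP; rewrite ?normc1 ?normc0.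
Qed.

Lemma branch_space_sub a f g : branch_space f -> branch_space g -> branch_space (a *: f - g).
Proof.
move=> [Hf cf] [Hg cg]; have Haf := prehilbertZ hH a Hf.
have Hd := prehilbertB hH Haf Hg; split => //.
have H1 := fopH good_chi Hf; have H2 := fopH good_chi Hg; have H3 := fopH good_chi Hd.
have H4 := fopH good_chi Haf; have H5 := prehilbertZ hH a H1.
have e1 := fopBr good_chi Haf Hg; have e2 := fopZr a good_chi Hf.
apply: nrm_eq0_sym => //; apply: (nrm_eq0_trans H3 (prehilbertB hH H4 H2) Hd e1).
have -> : fop chi (a *: f) - fop chi g - (a *: f - g) =
  (fop chi (a *: f) - a *: fop chi f) - a *: (f - fop chi f) + (g - fop chi g).
  rewrite scalerBr; move: (fop chi (a *: f)) (fop chi g) (a *: f) (a *: fop chi f) => p q x y.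
  by rewrite !opprB [_ + (y - x)]addrA subrK [g - x]addrC addrACA [- q + g]addrC.
have Hcf := prehilbertB hH Hf H1; have Hcg := prehilbertB hH Hg H2.
have Haa := prehilbertB hH H4 H5; have Hz := prehilbertZ hH a Hcf.
apply/le_anti; rewrite nrm_ge0 andbT.
apply: le_trans (ler_nrmD hH (prehilbertB hH Haa Hz) Hcg) _.
rewrite cg addr0; apply: le_trans (ler_nrmB hH Haa Hz) _.
by rewrite e2 (nrmZ hH) // cf mulr0 addr0.
Qed.

(** Here z may sit on 0 or on the upper part of [Sg], where [rs z] alone is not controlled; the
    factor [chi] removes these points. A real z is again reached from z + i, now with the cut-off
    resolvent in the fixed-point equation. *)
Lemma good_chi_rs z : (complex.Im z != 0) \/ (wd < `|complex.Re z - 1|) ->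
  good (fun x => chi x * rs z x).
Proof.
have [v0|v0] := eqVneq (complex.Im z) 0; last by move=> _; exact: goodM good_chi (good_rs_nonreal v0).
case=> // y1; have zE : z = (complex.Re z)%:C by move: v0; case: (z) => a b /= ->.
set y := complex.Re z in zE y1; set w := y +i* 1; set c := `|y - 1| - wd.
have c0 : 0 < c by rewrite subr_gt0.
have gw : good (rs w) by apply: good_rs_nonreal; rewrite oner_eq0.
have s0 : 0 < Num.sqrt (1 + c ^+ 2) by rewrite sqrtr_gt0 ltr_wpDr ?sqr_ge0.
have hc x : `|x - 1| <= wd -> c <= `|y - x|.
  by move=> hx; rewrite /c lerBlDr; have := ler_distD x y 1; lra.
have hw x : `|x - 1| <= wd -> Num.sqrt (1 + c ^+ 2) <= normc (w - x%:C).
  by move=> hx; apply: normc_shift_i; [exact: ltW|exact: hc].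
have hz x : `|x - 1| <= wd -> c <= normc (z - x%:C).
  by move=> hx; apply: le_trans (normr_Re_sub_le _ _); exact: hc.
have gcw := goodM good_chi gw.
apply: (good_fix gcw (goodZ (w - z) gcw) (invf_sqrt1D_lt1 c0)) => [x Sx||x Sx].
- have -> : w - z = 'i%C.
    by rewrite zE /w; apply/eqP; rewrite eq_complex /= subrr subr0 !eqxx.
  rewrite normcM; have -> : normc ('i%C : R[i]) = 1 by rewrite /= expr0n add0r expr1n sqrtr1.
  rewrite mul1r /chi; case: ifPn => hx; last by rewrite mul0r normc0 invr_ge0 ltW.
  rewrite mul1r /rs normcV lef_pV2 ?posrE ?hw //.
  exact: lt_le_trans s0 (hw _ hx).
- exists c^-1 => [|x Sx]; first by rewrite invr_ge0 ltW.
  rewrite /chi; case: ifPn => hx; last by rewrite mul0r normc0 invr_ge0 ltW.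
  rewrite mul1r /rs normcV lef_pV2 ?posrE ?hz //.
  exact: lt_le_trans c0 (hz _ hx).
- rewrite /chi; case: ifPn => hx; last by rewrite !(mul0r,mulr0) addr0.
  have zn : z - x%:C != 0 by rewrite -normc_gt0 (lt_le_trans c0) ?hz.
  have wn : w - x%:C != 0 by rewrite -normc_gt0 (lt_le_trans s0) ?hw.
  by rewrite /rs !mul1r; field; rewrite zn wn.
Qed.

Lemma chi_rs_shift z x : (complex.Im z != 0) \/ (wd < `|complex.Re z - 1|) ->
  chi x * rs z x * (z - x%:C) = chi x.
Proof.
move=> hz; rewrite /chi; case: ifPn => hx; last by rewrite !mul0r.
rewrite mul1r /rs mulVf //; apply/eqP => zx.
have {zx} zE : z = x%:C by apply/eqP; rewrite -subr_eq0 zx.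
by case: hz; rewrite zE /= ?eqxx // ltNge hx.
Qed.

(** The preimage is S(L) g with S = chi / (z - x): since x S = z S - chi, it satisfies (z - L) S(L)
    g = chi(L) g, which is g on the branch space. *)
Lemma branch_onto z g : (complex.Im z != 0) \/ (wd < `|complex.Re z - 1|) ->
  branch_space g -> exists f, [/\ sgraph (f, z *: f - g), branch_space f & branch_space (z *: f - g)].
Proof.
move=> hz Mg; have [Hg cg] := Mg; have gS := good_chi_rs hz.
set S := fun x => chi x * rs z x in gS.
have gt : good (fun x => z * S x + (-1) * chi x) by apply: goodD; apply: goodZ => //; exact: good_chi.
have HS := fopH gS Hg; have HzS := prehilbertZ hH z HS; have Hc := fopH good_chi Hg.
have Hd := prehilbertB hH HzS Hg; have Ht := fopH gt Hg.
have MS : branch_space (fop S g).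
  have gcS := goodM good_chi gS.
  apply: (branch_space_eq (branch_space_fop gS Hg) HS).
  by apply: fop_eq => // x _; rewrite /S mulrA chi_idem.
exists (fop S g); split => //; last exact: branch_space_sub.
apply: sgraph_eq (sgraph_fop gS gt _ Hg) => //; first by rewrite subrr (nrm0 hH).
- apply: (@nrm_eq0_trans _ (z *: fop S g - fop chi g)) => //.
  + exact: (prehilbertB hH).
  + apply: fop_uniq => //; first exact: (prehilbertB hH).
    under eq_fun do rewrite fcalcD !fcalcZ scaleN1r; apply: (scvgB hH) => // [n|n||].
    * by apply: (prehilbertZ hH); exact: fcalcH.
    * exact: fcalcH.
    * by apply: (scvgZ hH) => // [n|]; [exact: fcalcH|exact: fop_cvg].
    * exact: fop_cvg good_chi Hg.
  + have -> : z *: fop S g - fop chi g - (z *: fop S g - g) = g - fop chi g.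
      by rewrite opprB addrC addrA subrK.
    by [].
- move=> x Sx; rewrite -(chi_rs_shift x hz) /S; ring.
Qed.

Lemma branch_bounded_below z : (complex.Im z != 0) \/ (wd < `|complex.Re z - 1|) ->
  exists C : R, forall f h, sgraph (f, h) -> branch_space f -> N f <= C * N (z *: f - h).
Proof.
move=> hz; have gS := good_chi_rs hz; have [[B B0 hB] _] := gS; exists B => f h gfh [Hf cf].
have [/= _ Hh _] := gfh.
have Hzf := prehilbertB hH (prehilbertZ hH z Hf) Hh.
have t := sgraph_shift gS good_chi (fun x _ => chi_rs_shift x hz) gfh.
have H1 := fopH good_chi Hf; have H2 := fopH gS Hzf.
have a := nrm_eq0_trans Hf H1 H2 cf (nrm_eq0_sym H2 H1 t).
have := ler_nrmD hH (prehilbertB hH Hf H2) H2; rewrite subrK a add0r => h1.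
exact: le_trans h1 (nrm_fop_le gS Hzf B0 hB).
Qed.

(** On [Sg], |x - 1| is at most 1/4 or at least 3/4, and the circle of radius 1/2 lies midway. *)
Lemma Sg_circle z x : Sg x -> normc (z - 1) = 2^-1 -> 4^-1 <= normc (z - x%:C).
Proof.
move=> Sx hz.
have d1 : normc (z - 1) <= normc (z - x%:C) + `|x - 1|.
  have -> : z - 1 = (z - x%:C) + (x - 1)%:C by rewrite rmorphB addrA subrK.
  by apply: le_trans (le_normcD _ _) _; rewrite normcR.
have d2 : `|x - 1| <= normc (z - x%:C) + normc (z - 1).
  rewrite -(normcR (x - 1)) rmorphB rmorph1.
  have -> : x%:C - 1 = - (z - x%:C) + (z - 1) by rewrite opprB addrA subrK.
  by apply: le_trans (le_normcD _ _) _; rewrite normcN.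
move: d1 d2; rewrite hz.
have [h|/(Sg_away_from_one Sx) h] := boolP (`|x - 1| <= wd); move: h wd_le; lra.
Qed.

End GoodFunctions.

(** * Spectral gap for almost commuting projections *)

(* The heat-bath operators [D x = 1 - E x] as abstract orthogonal projections
   that commute up to an error of relative size [c] between neighbours. *)
Record local_projections (R : realType) (V : lmodType R[i]) (H : set V) (ip : V -> V -> R[i])
  (X : eqType) (D : X -> V -> V) (adj : rel X) (c : R) : Prop := {
  lp_ge0 : 0 <= c;
  lp_adjC : symmetric adj;
  lp_H : forall x f, H f -> H (D x f);
  lp_lin : forall x a f g, D x (a *: f + g) = a *: D x f + D x g;
  lp_idem : forall x f, D x (D x f) = D x f;
  lp_sym : forall x f g, H f -> H g -> ip (D x f) g = ip f (D x g);
  lp_comm : forall x y f, x != y -> ~~ adj x y -> D x (D y f) = D y (D x f);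
  lp_adj : forall x y f, H f -> adj x y ->
    nrm ip (D x (D y (f - D x f))) <= c * nrm ip (D y (f - D x f)) }.

Section LocalProjections.
Variables (R : realType) (V : lmodType R[i]) (H : set V) (ip : V -> V -> R[i]).
Hypothesis hH : prehilbert H ip.
Local Notation N := (nrm ip).
Local Notation rip := (rip ip).
Variables (X : eqType) (D : X -> V -> V) (adj : rel X) (c : R).
Hypothesis hD : local_projections H ip D adj c.
Let c_ge0 := lp_ge0 hD.
Let DH := lp_H hD.
Let Dlin := lp_lin hD.
Let D_idem := lp_idem hD.
Let D_sym := lp_sym hD.
Let D_comm := lp_comm hD.
Let D_adj := lp_adj hD.

Lemma projD x f g : D x (f + g) = D x f + D x g.
Proof. by rewrite -[f]scale1r Dlin !scale1r. Qed.

Lemma proj0 x : D x 0 = 0.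
Proof. by apply: (addIr (D x 0)); rewrite -projD !add0r. Qed.

Lemma projZ x a f : D x (a *: f) = a *: D x f.
Proof. by rewrite -[a *: f]addr0 Dlin proj0 addr0. Qed.

Lemma projB x f g : D x (f - g) = D x f - D x g.
Proof. by rewrite projD -scaleN1r projZ scaleN1r. Qed.

Lemma proj_sum x (I : Type) (r : seq I) (P : pred I) (F : I -> V) :
  D x (\sum_(i <- r | P i) F i) = \sum_(i <- r | P i) D x (F i).
Proof. exact: (big_morph _ (projD x) (proj0 x)). Qed.

Lemma proj_rip x f g : H f -> H g -> rip (D x f) g = rip f (D x g).
Proof. by move=> Hf Hg; rewrite /rip D_sym. Qed.

Lemma proj_rip_sqr x f : H f -> rip f (D x f) = N (D x f) ^+ 2.
Proof.
move=> Hf; have HD := DH x Hf.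
by rewrite (sqr_nrm hH) // proj_rip // D_idem.
Qed.

Lemma nrm_proj x f : H f -> N (D x f) <= N f.
Proof.
move=> Hf; have HD := DH x Hf.
have [->|n0] := eqVneq (N (D x f)) 0; first exact: nrm_ge0.
have np : 0 < N (D x f) by rewrite lt_def n0 nrm_ge0.
by rewrite -(ler_pM2r np) -expr2 -proj_rip_sqr //; exact: (rip_le hH).
Qed.

Definition comm x y f := D x (D y f) - D y (D x f).

Lemma commH x y f : H f -> H (comm x y f).
Proof. by move=> Hf; apply: (prehilbertB hH); do 2! apply: DH. Qed.

Lemma comm_far x y f : x != y -> ~~ adj x y -> comm x y f = 0.
Proof. by move=> xy a; rewrite /comm D_comm // subrr. Qed.

(* [E x o D y o D x] is the adjoint of [D x o D y o E x]. *)
Lemma nrm_EDD x y f : H f -> adj x y ->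
  N (D y (D x f) - D x (D y (D x f))) <= c * N (D x f).
Proof.
move=> Hf a; set g := D y (D x f); set p := g - D x g.
have Hx := DH x Hf; have Hg : H g by exact: DH.
have HDg := DH x Hg; have Hp : H p by exact: (prehilbertB hH).
have Dp : D x p = 0 by rewrite projB D_idem subrr.
have [->|n0] := eqVneq (N p) 0; first by rewrite mulr_ge0 ?nrm_ge0.
have np : 0 < N p by rewrite lt_def n0 nrm_ge0.
rewrite -(ler_pM2r np) -expr2 (sqr_nrm hH) //.
have -> : rip p p = rip p g.
  rewrite {2}/p (ripBr hH) // -proj_rip // Dp.
  by rewrite /rip (ip0l hH) // subr0.
have Hpp : H (D y (p - D x p)) by apply: DH; rewrite Dp subr0.
have -> : rip p g = rip (D x f) (D x (D y (p - D x p))).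
  by rewrite -proj_rip // D_idem Dp subr0 -[RHS]proj_rip // (rip_sym hH).
apply: le_trans (rip_le hH Hx (DH x Hpp)) _.
have := D_adj Hp a; have := nrm_proj y (_ : H (p - D x p)).
rewrite Dp subr0 => /(_ Hp) h1 h2; rewrite [c * _]mulrC -mulrA ler_wpM2l ?nrm_ge0 //.
by apply: le_trans h2 _; rewrite ler_wpM2l.
Qed.

Lemma nrm_DyE x y f : H f -> N (D y (f - D x f)) <= N (D y f) + N (D y (D x f)).
Proof. by move=> Hf; rewrite projB (ler_nrmB hH) //; do ?apply: DH. Qed.

(** Writing E_x = 1 - D_x, the commutator is D_x D_y E_x f - E_x D_y D_x f; the first term is small
    by assumption and the second is controlled by its adjoint. *)
Lemma nrm_comm x y f : H f -> adj x y ->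
  N (comm x y f) <= 2 * c * (N (D x f) + N (D y f)).
Proof.
move=> Hf a; have HD := DH x Hf; have HfD := prehilbertB hH Hf HD.
have Hyx := DH y HD; have Hxyx := DH x Hyx.
have -> : comm x y f = D x (D y (f - D x f)) - (D y (D x f) - D x (D y (D x f))).
  by rewrite /comm !projB opprB addrA subrK.
have Hd := prehilbertB hH Hyx Hxyx.
apply: le_trans (ler_nrmB hH (DH x (DH y HfD)) Hd) _.
have h1 := D_adj Hf a; have h2 := nrm_DyE x y Hf.
have h3 := nrm_EDD Hf a; have h4 := nrm_proj y HD.
have h5 : c * N (D y (f - D x f)) <= c * (N (D y f) + N (D x f)).
  by rewrite ler_wpM2l //; apply: le_trans h2 _; rewrite lerD2l.
have := mulr_ge0 c_ge0 (nrm_ge0 ip (D y f)); rewrite mulrDr in h5; lra.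
Qed.

(** Splitting D_y f into D_y D_x f and D_y E_x f, the difference is <D_x f, D_x D_y E_x f>. *)
Lemma rip_DD_adj x y f : H f -> adj x y ->
  `|rip (D x f) (D y f) - N (D y (D x f)) ^+ 2| <=
  c * N (D x f) * (N (D y f) + N (D y (D x f))).
Proof.
move=> Hf a; have HD := DH x Hf; have HfD := prehilbertB hH Hf HD.
have HE := DH y HfD.
have -> : rip (D x f) (D y f) - N (D y (D x f)) ^+ 2 = rip (D x f) (D x (D y (f - D x f))).
  rewrite -proj_rip_sqr // -(ripBr hH) //; do ?apply: DH => //.
  by rewrite -projB -[RHS]proj_rip // D_idem.
apply: le_trans (normr_rip_le hH HD (DH x HE)) _.
rewrite [c * _]mulrC -mulrA ler_wpM2l ?nrm_ge0 //.
by apply: le_trans (D_adj Hf a) _; rewrite ler_wpM2l // nrm_DyE.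
Qed.

Lemma rip_DD_far x y f : H f -> x != y -> ~~ adj x y ->
  rip (D x f) (D y f) = N (D y (D x f)) ^+ 2.
Proof.
move=> Hf xy a; have HD := DH x Hf.
by rewrite -proj_rip_sqr // -D_comm // -[RHS]proj_rip ?D_idem //; exact: DH.
Qed.

End LocalProjections.

(** * Localisation of finite-volume eigenvalues *)

Section Localisation.
Variables (R : realType) (V : lmodType R[i]) (H : set V) (ip : V -> V -> R[i]).
Hypothesis hH : prehilbert H ip.
Local Notation N := (nrm ip).
Local Notation rip := (rip ip).
Variables (X : finType) (D : X -> V -> V) (adj : rel X) (c k : R).
Hypothesis hD : local_projections H ip D adj c.
Let c_ge0 := lp_ge0 hD.
Let adjC := lp_adjC hD.
Let DH := lp_H hD.
Hypothesis adj_irr : forall x, ~~ adj x x.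
Hypothesis k_ge1 : 1 <= k.
Hypothesis deg : forall x, \sum_(y | adj x y) 1 <= k.

Lemma sum_adj_l (F : X -> R) : (forall x, 0 <= F x) ->
  \sum_x \sum_(y | adj x y) F x <= k * \sum_x F x.
Proof.
move=> F0; rewrite mulr_sumr; apply: ler_sum => x _.
have -> : \sum_(y | adj x y) F x = (\sum_(y | adj x y) 1) * F x.
  by rewrite mulr_suml; apply: eq_bigr => y _; rewrite mul1r.
by rewrite ler_wpM2r.
Qed.

Lemma sum_adj_r (F : X -> R) : (forall x, 0 <= F x) ->
  \sum_x \sum_(y | adj x y) F y <= k * \sum_x F x.
Proof.
move=> F0; rewrite (exchange_big_dep xpredT) //=.
under eq_bigr do under eq_bigl do rewrite adjC.
exact: sum_adj_l.
Qed.

Variables (f : V) (lam : R).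
Hypothesis Hf : H f.
Hypothesis eig : \sum_z D z f = lam%:C *: f.

Let U x := N (D x f).
(** Two-particle amplitudes. The diagonal is set to 0 because D_x D_x f = D_x f is already the
    one-particle amplitude [U x]. *)
Let b y x := if y == x then 0 else N (D y (D x f)).
Let a2 := \sum_x U x ^+ 2.
Let b2 := \sum_x \sum_y b y x ^+ 2.

Lemma U_ge0 x : 0 <= U x. Proof. exact: nrm_ge0. Qed.
Lemma b_ge0 y x : 0 <= b y x. Proof. by rewrite /b; case: ifP => // _; exact: nrm_ge0. Qed.

Lemma one_particle_eq : lam * N f ^+ 2 = a2.
Proof.
have HD x : H (D x f) by exact: DH.
have -> : lam * N f ^+ 2 = rip f (lam%:C *: f) by rewrite (ripZr hH) // (sqr_nrm hH).
rewrite -eig (rip_sumr hH) //; apply: eq_bigr => x _.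
by rewrite (proj_rip_sqr hH hD).
Qed.

(** [b2] carries the same weight on both sides: it cancels in the lower bound for lam and appears
    twice in the upper bound, where [two_particle_bound] makes it O(c^2) a2. *)
Lemma one_particle_bound : `|(lam - 1) * a2 - b2| <= (k * c + k * c ^+ 2 / 4) * a2 + b2.
Proof.
have HD x : H (D x f) by exact: DH.
have e1 : lam * a2 = \sum_x \sum_z rip (D x f) (D z f).
  rewrite mulr_sumr; apply: eq_bigr => x _.
  rewrite -(rip_sumr hH) // eig (ripZr hH) // (rip_sym hH) // (proj_rip_sqr hH hD) //.
have e2 : a2 = \sum_x \sum_z (if z == x then U x ^+ 2 else 0).
  by apply: eq_bigr => x _; rewrite -big_mkcond big_pred1_eq.
have -> : (lam - 1) * a2 - b2 = \sum_x \sum_z (rip (D x f) (D z f) -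
    ((if z == x then U x ^+ 2 else 0) + b z x ^+ 2)).
  under eq_bigr do rewrite sumrB big_split /=.
  by rewrite sumrB big_split /= -e2 -e1 -/b2; ring.
have bd x z : `|rip (D x f) (D z f) - ((if z == x then U x ^+ 2 else 0) + b z x ^+ 2)| <=
    if adj x z then c * U x * (U z + b z x) else 0.
  have [->|zx] := eqVneq z x.
    by rewrite (negPf (adj_irr x)) /b eqxx expr0n addr0 /U (sqr_nrm hH) // subrr normr0.
  rewrite add0r /b (negPf zx); case: ifPn => axz; first exact: (rip_DD_adj hH hD).
  by rewrite (rip_DD_far hH hD) // ?subrr ?normr0 // eq_sym.
apply: le_trans (ler_norm_sum _ _ _) _.
apply: (@le_trans _ _ (\sum_x \sum_(z | adj x z) c * U x * (U z + b z x))).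
  apply: ler_sum => x _; apply: le_trans (ler_norm_sum _ _ _) _.
  by rewrite [leRHS]big_mkcond; apply: ler_sum => z _; exact: bd.
(* The product c U_x U_z is split symmetrically, so that each half is counted k times and the
   leading constant is exactly k c. The mixed term c U_x b_zx costs c^2 U_x^2 / 4 plus one full
   b_zx^2. *)
apply: (@le_trans _ _ (\sum_x \sum_(z | adj x z) ((c / 2 + c ^+ 2 / 4) * U x ^+ 2 + c / 2 * U z ^+ 2 + b z x ^+ 2))).
  apply: ler_sum => x _; apply: ler_sum => z _.
  have s1 := mulr_ge0 c_ge0 (sqr_ge0 (U x - U z)).
  have s2 := sqr_ge0 (c * U x / 2 - b z x).
  lra.
under eq_bigr do rewrite !big_split /=.
rewrite !big_split /=.
have p1 : \sum_x \sum_(z | adj x z) (c / 2 + c ^+ 2 / 4) * U x ^+ 2 <= k * ((c / 2 + c ^+ 2 / 4) * a2).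
  rewrite [_ * a2]mulr_sumr; apply: sum_adj_l => x; rewrite mulr_ge0 ?sqr_ge0 //.
  by rewrite addr_ge0 // divr_ge0 ?sqr_ge0.
have p2 : \sum_x \sum_(z | adj x z) c / 2 * U z ^+ 2 <= k * (c / 2 * a2).
  by rewrite [_ * a2]mulr_sumr; apply: sum_adj_r => x; rewrite mulr_ge0 ?sqr_ge0 ?divr_ge0.
have p3 : \sum_x \sum_(z | adj x z) b z x ^+ 2 <= b2.
  apply: ler_sum => x _; rewrite [leLHS]big_mkcond; apply: ler_sum => z _.
  by case: ifP => // _; exact: sqr_ge0.
lra.
Qed.

(** The sites y for which D_y may fail to commute with the commutator of D_x and D_z, apart from y =
    x. *)
Let near (y x z : X) := [|| y == z, adj y x | adj y z].

(** Pair u = D_y D_x f with D_y D_x applied to the eigenvalue equation. The terms z = x and z = y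
    each give |u|^2, hence the 2; moving D_z to the left in the other terms yields <u, D_z u> >= 0,
    which is dropped, plus commutators. *)
Lemma two_particle_pointwise x y : lam * b y x ^+ 2 >= 2 * b y x ^+ 2
  - \sum_(z | adj y z) 2 * c * b y x * (b y x + b z x)
  - \sum_(z | adj x z) 2 * c * b y x * (b x y + b z y + (if near y x z then U x + U z else 0)).
Proof.
have [->|yx] := eqVneq y x.
  have -> : b x x = 0 by rewrite /b eqxx.
  rewrite expr0n !mulr0 !sub0r !big1 ?oppr0 ?addr0 // => z _; by rewrite mul0r.
set B := b y x; have BE : B = N (D y (D x f)) by rewrite /B /b (negPf yx).
have HD w g : H g -> H (D w g) by exact: DH.
have Hx := HD x f Hf; set u := D y (D x f); have Hu : H u by exact: HD.
have HB : 0 <= B := b_ge0 y x.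
have c2 : 0 <= 2 * c * B by rewrite !mulr_ge0.
have Du : D y u = u by rewrite /u (lp_idem hD).
have -> : lam * B ^+ 2 = \sum_z rip u (D y (D x (D z f))).
  rewrite -(rip_sumr hH) // => [|z _]; last by do 3! apply: DH.
  rewrite -!(proj_sum hD) eig !(projZ hD) (ripZr hH) //.
  by rewrite BE (sqr_nrm hH).
have uu : rip u u = B ^+ 2 by rewrite BE (sqr_nrm hH).
(* First part of the move: D_z already stands to the left of D_x and is taken past D_y. *)
have t1 z : rip u (D y (D z (D x f))) >= (if z == y then B ^+ 2 else 0) + (if z == x then B ^+ 2 else 0)
    - (if adj y z then 2 * c * B * (B + b z x) else 0).
  have [->|zy] := eqVneq z y.
    by rewrite (negPf yx) (negPf (adj_irr y)) (lp_idem hD) uu subr0 addr0.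
  rewrite add0r; have [->|zx] := eqVneq z x.
    rewrite (lp_idem hD) uu lerBlDr lerDl; case: ifP => // _.
    by rewrite mulr_ge0 // addr_ge0 // b_ge0.
  rewrite sub0r.
  have -> : D y (D z (D x f)) = D z u + comm D y z (D x f) by rewrite /comm addrC subrK.
  have HDz := HD z u Hu; have Hc := commH hH hD y z Hx.
  rewrite (ripDr hH) // (proj_rip_sqr hH hD) //.
  case: ifPn => ayz; last by rewrite (comm_far hD) // 1?eq_sym // oppr0 /rip (ip0r hH) // addr0 sqr_ge0.
  have := normr_rip_le hH Hu Hc; rewrite -BE ler_norml => /andP[h _].
  have := nrm_comm hH hD Hx ayz => h2.
  have -> : b z x = N (D z (D x f)) by rewrite /b (negPf zx).
  have h3 : B * N (comm D y z (D x f)) <= 2 * c * B * (B + N (D z (D x f))).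
    have := ler_wpM2l HB h2; rewrite -BE; lra.
  have := sqr_ge0 (N (D z u)); lra.
(* Second part: the commutator of D_x and D_z. If y is far from both sites, D_y passes inside and
   two-particle amplitudes bound the term; otherwise D_y is dropped as a contraction at the price of
   the amplitudes U, for few sites y. *)
have t2 z : z != x -> rip u (D y (comm D x z f)) >= - (if adj x z then
     2 * c * B * (b x y + b z y + (if near y x z then U x + U z else 0)) else 0).
  move=> zx; case: ifPn => axz; last first.
    by rewrite (comm_far hD) // 1?eq_sym // (proj0 hD) oppr0 /rip (ip0r hH).
  have Hc := commH hH hD x z Hf; have HDc := HD y _ Hc.
  have hU := addr_ge0 (U_ge0 x) (U_ge0 z); have hb := addr_ge0 (b_ge0 x y) (b_ge0 z y).
  rewrite lerNl -(ripNr hH) //; apply: le_trans (rip_le hH Hu (prehilbertN hH HDc)) _.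
  rewrite (nrmN hH) // -BE [2 * c * B]mulrC -!mulrA ler_wpM2l // mulrA.
  case: ifPn => [_|].
    apply: le_trans (nrm_proj hH hD y Hc) _; apply: le_trans (nrm_comm hH hD Hf axz) _.
    by rewrite ler_wpM2l ?lerDr // mulr_ge0.
  rewrite !negb_or addr0 => /and3P[yz ayx ayz].
  have -> : D y (comm D x z f) = comm D x z (D y f).
    rewrite /comm (projB hD) (lp_comm hD (D z f) yx ayx) (lp_comm hD (D x f) yz ayz).
    by rewrite (lp_comm hD f yz ayz) (lp_comm hD f yx ayx).
  apply: le_trans (nrm_comm hH hD (HD y f Hf) axz) _.
  by rewrite /b (eq_sym x) (negPf yx) (eq_sym z) (negPf yz).
apply: (@le_trans _ _ (\sum_z ((if z == y then B ^+ 2 else 0) + (if z == x then B ^+ 2 else 0)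
    - (if adj y z then 2 * c * B * (B + b z x) else 0)
    - (if adj x z then
     2 * c * B * (b x y + b z y + (if near y x z then U x + U z else 0)) else 0)))).
  rewrite !sumrB big_split /= -!big_mkcond !big_pred1_eq /=; lra.
apply: ler_sum => z _; have [->|zx] := eqVneq z x.
  by have := t1 x; rewrite eqxx (negPf (adj_irr x)) (lp_idem hD); rewrite subr0.
have -> : D y (D x (D z f)) = D y (D z (D x f)) + D y (comm D x z f).
  by rewrite /comm (projB hD) addrC subrK.
rewrite (ripDr hH) //; first last; first by apply: DH; exact: (commH hH hD _ _ Hf).
  by do 3! apply: DH.
by have := t1 z; have := t2 z zx; rewrite (negPf zx); lra.
Qed.

Lemma sum_near x z : \sum_y (if near y x z then 1 else 0) <= 1 + 2 * k.
Proof.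
apply: (@le_trans _ _ (\sum_y ((if y == z then 1 else 0) + (if adj x y then 1 else 0) + (if adj z y then 1 else 0)))).
  apply: ler_sum => y _; rewrite /near ![adj _ y]adjC.
  by case: (y == z); case: (adj y x); case: (adj y z) => /=; lra.
rewrite !big_split /= -!big_mkcond big_pred1_eq.
have := deg x; have := deg z; lra.
Qed.

Lemma two_particle_bound : (2 - lam) * b2 <=
  8 * c * k * b2 + b2 / 16 + 64 * k ^+ 2 * (1 + 2 * k) * c ^+ 2 * a2.
Proof.
have k0 : 0 < k by apply: lt_le_trans k_ge1.
have kc0 : 0 <= k * c by rewrite mulr_ge0 // ltW.
pose T1 x y := \sum_(z | adj y z) 2 * c * b y x * (b y x + b z x).
pose T2 x y := \sum_(z | adj x z) 2 * c * b y x * (b x y + b z y + (if near y x z then U x + U z else 0)).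
have main : (2 - lam) * b2 <= \sum_x \sum_y T1 x y + \sum_x \sum_y T2 x y.
  rewrite -big_split mulr_sumr; apply: ler_sum => x _ /=.
  rewrite -big_split mulr_sumr; apply: ler_sum => y _ /=.
  have := two_particle_pointwise x y; rewrite /T1 /T2; lra.
have b2' : \sum_y \sum_x b y x ^+ 2 = b2 by rewrite exchange_big.
have B1 : \sum_x \sum_y T1 x y <= 4 * c * k * b2.
  rewrite mulr_sumr; apply: ler_sum => x _.
  apply: (@le_trans _ _ (\sum_y \sum_(z | adj y z) (3 * c * b y x ^+ 2 + c * b z x ^+ 2))).
    apply: ler_sum => y _; apply: ler_sum => z _.
    have := mulr_ge0 c_ge0 (sqr_ge0 (b y x - b z x)); lra.
  under eq_bigr do rewrite big_split /=; rewrite big_split /=.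
  have p1 : \sum_y \sum_(z | adj y z) 3 * c * b y x ^+ 2 <= k * (\sum_y 3 * c * b y x ^+ 2).
    have c3 : 0 <= 3 * c by rewrite mulr_ge0.
    exact: (sum_adj_l (F := fun y => 3 * c * b y x ^+ 2) (fun y => mulr_ge0 c3 (sqr_ge0 _))).
  have p2 : \sum_y \sum_(z | adj y z) c * b z x ^+ 2 <= k * (\sum_y c * b y x ^+ 2).
    exact: (sum_adj_r (F := fun z => c * b z x ^+ 2) (fun y => mulr_ge0 c_ge0 (sqr_ge0 _))).
  rewrite -mulr_sumr in p1; rewrite -mulr_sumr in p2; lra.
(* Weights for 2 c b (U_x + U_z) <= e b^2 + w (U_x^2 + U_z^2): e = 1/(16 k) makes the sum over at
   most k neighbours cost only b^2/16, and then w = 2 c^2 / e. *)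
pose w := 32 * k * c ^+ 2.
have w0 : 0 <= w by rewrite /w !mulr_ge0 ?sqr_ge0 // ltW.
pose e := (16 * k)^-1.
have e0 : 0 <= e by rewrite /e invr_ge0 mulr_ge0 // ltW.
have ke : k * e = 16^-1 by rewrite /e; field; rewrite gt_eqF.
have B2 : \sum_x \sum_y T2 x y <= 4 * c * k * b2 + b2 / 16 + 64 * k ^+ 2 * (1 + 2 * k) * c ^+ 2 * a2.
  apply: (@le_trans _ _ (\sum_x \sum_y \sum_(z | adj x z) ((2 * c + e) * b y x ^+ 2 + c * b x y ^+ 2 + c * b z y ^+ 2)
     + \sum_x \sum_y \sum_(z | adj x z) (if near y x z then 1 else 0) * (w * (U x ^+ 2 + U z ^+ 2)))).
    rewrite -big_split; apply: ler_sum => x _ /=.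
    rewrite -big_split; apply: ler_sum => y _ /=.
    rewrite -big_split; apply: ler_sum => z _ /=.
    have s1 := mulr_ge0 c_ge0 (sqr_ge0 (b y x - b x y)).
    have s2 := mulr_ge0 c_ge0 (sqr_ge0 (b y x - b z y)).
    have s0 := mulr_ge0 e0 (sqr_ge0 (b y x)).
    case: ifP => _; last by rewrite addr0 mul0r addr0; lra.
    rewrite mul1r.
    have s3 : 2 * c * b y x * (U x + U z) <= e * b y x ^+ 2 + w * (U x ^+ 2 + U z ^+ 2).
      have h1 := mulr_ge0 e0 (sqr_ge0 (b y x - 16 * k * c * (U x + U z))).
      have h2 : e * (b y x - 16 * k * c * (U x + U z)) ^+ 2 = e * b y x ^+ 2 - 32 * (k * e) * c * b y x * (U x + U z)
          + 256 * (k * e) * k * c ^+ 2 * (U x + U z) ^+ 2 by ring.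
      rewrite h2 ke in h1.
      have h3 := mulr_ge0 w0 (sqr_ge0 (U x - U z)); rewrite /w in h3 *; lra.
    lra.
  have q2 : \sum_x \sum_y \sum_(z | adj x z) (if near y x z then 1 else 0) * (w * (U x ^+ 2 + U z ^+ 2))
      <= (1 + 2 * k) * w * (2 * k * a2).
    apply: (@le_trans _ _ (\sum_x \sum_(z | adj x z) ((1 + 2 * k) * w * U x ^+ 2 + (1 + 2 * k) * w * U z ^+ 2))).
      apply: ler_sum => x _; rewrite exchange_big /=; apply: ler_sum => z _.
      rewrite -mulr_suml -mulrDr -mulrA ler_wpM2r ?sum_near //.
      by rewrite mulr_ge0 ?addr_ge0 ?sqr_ge0.
    have W0 : 0 <= (1 + 2 * k) * w by rewrite mulr_ge0 // addr_ge0 // mulr_ge0 // ltW.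
    under eq_bigr do rewrite big_split /=; rewrite big_split /=.
    have p1 := sum_adj_l (F := fun x => (1 + 2 * k) * w * U x ^+ 2) (fun x => mulr_ge0 W0 (sqr_ge0 _)).
    have p2 := sum_adj_r (F := fun x => (1 + 2 * k) * w * U x ^+ 2) (fun x => mulr_ge0 W0 (sqr_ge0 _)).
    by move: p1 p2; rewrite -!mulr_sumr -/a2; lra.
  have q1 : \sum_x \sum_y \sum_(z | adj x z) ((2 * c + e) * b y x ^+ 2 + c * b x y ^+ 2 + c * b z y ^+ 2)
      <= 4 * c * k * b2 + b2 / 16.
    rewrite exchange_big /=.
    apply: (@le_trans _ _ (\sum_y (k * (2 * c + e) * (\sum_x b y x ^+ 2) + 2 * k * c * \sum_x b x y ^+ 2))).
      apply: ler_sum => y _; under eq_bigr do rewrite !big_split /=; rewrite !big_split /=.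
      have ce0 : 0 <= 2 * c + e by rewrite addr_ge0 // mulr_ge0.
      have p1 := sum_adj_l (F := fun x => (2 * c + e) * b y x ^+ 2) (fun x => mulr_ge0 ce0 (sqr_ge0 _)).
      have p2 := sum_adj_l (F := fun x => c * b x y ^+ 2) (fun x => mulr_ge0 c_ge0 (sqr_ge0 _)).
      have p3 := sum_adj_r (F := fun x => c * b x y ^+ 2) (fun x => mulr_ge0 c_ge0 (sqr_ge0 _)).
      by move: p1 p2 p3; rewrite -!mulr_sumr; lra.
    rewrite big_split /= -!mulr_sumr b2' -/b2.
    have -> : k * (2 * c + e) * b2 + 2 * k * c * b2 = 4 * c * k * b2 + (k * e) * b2 by ring.
    by rewrite ke; lra.
  have -> : 64 * k ^+ 2 * (1 + 2 * k) * c ^+ 2 * a2 = (1 + 2 * k) * w * (2 * k * a2) by rewrite /w; ring.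
  lra.
lra.
Qed.

Lemma eigenvalue_localisation (delta : R) : 128 * c * k <= 1 -> N f != 0 ->
  k * c + (1024 * k ^+ 2 * (1 + 2 * k) + k) * c ^+ 2 <= delta ->
  lam = 0 \/ (1 - delta <= lam /\ (lam <= 1 + delta \/ 7 / 4 <= lam)).
Proof.
move=> ck Nf hdelta.
have k0 : 0 < k by apply: lt_le_trans k_ge1.
have [->|l0] := eqVneq lam 0; [by left|right].
have a20 : 0 <= a2 by apply: sumr_ge0 => x _; exact: sqr_ge0.
have b20 : 0 <= b2 by apply: sumr_ge0 => x _; apply: sumr_ge0 => y _; exact: sqr_ge0.
have a2p : 0 < a2.
  by rewrite lt_def a20 andbT -one_particle_eq mulf_neq0 // expf_neq0.
have := one_particle_bound; rewrite ler_norml => /andP[lo hi].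
have P : 0 <= k * c ^+ 2 by rewrite mulr_ge0 ?sqr_ge0 // ltW.
have Q : 0 <= k ^+ 2 * (1 + 2 * k) * c ^+ 2.
  have h : 0 <= 1 + 2 * k by lra.
  exact: mulr_ge0 (mulr_ge0 (sqr_ge0 k) h) (sqr_ge0 c).
split.
  rewrite lerBlDr -lerBlDl -(ler_pM2r a2p).
  have : (k * c + k * c ^+ 2 / 4) * a2 <= delta * a2 by rewrite ler_pM2r //; lra.
  lra.
have [l74|l74] := leP (7 / 4) lam; [by right|left].
have tb := two_particle_bound.
(* Since 2 - lam >= 1/4 and 8 c k <= 1/16, the factor left on b2 is 1/4 - 1/16 - 1/16 = 1/8, so 64
   becomes 512. The upper bound uses b2 twice, whence the 1024 in the condition on delta. *)
have b2a : b2 <= 512 * k ^+ 2 * (1 + 2 * k) * c ^+ 2 * a2.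
  have h1 : (1 / 4) * b2 <= (2 - lam) * b2 by rewrite ler_wpM2r //; lra.
  have h2 : 8 * c * k * b2 <= (1 / 16) * b2 by rewrite ler_wpM2r //; lra.
  lra.
rewrite -lerBlDl -(ler_pM2r a2p).
have : (k * c + k * c ^+ 2 / 4 + 1024 * k ^+ 2 * (1 + 2 * k) * c ^+ 2) * a2 <= delta * a2.
  by rewrite ler_pM2r //; lra.
lra.
Qed.

End Localisation.

(** * Exponential decay of finite-volume resolvents *)

Section Decay.
Variables (R : realType) (V : lmodType R[i]) (H : set V) (ip : V -> V -> R[i]).
Hypothesis hH : prehilbert H ip.
Local Notation N := (nrm ip).
Local Notation rip := (rip ip).
Variables (X : eqType) (D : X -> V -> V) (adj : rel X) (c k : R) (lev : X -> nat).
Hypothesis hD : local_projections H ip D adj c.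
Let adjC := lp_adjC hD.
Let DH := lp_H hD.
Hypothesis lev_adj : forall x y, adj x y -> (lev x <= (lev y).+1)%N.
Variables (S : seq X) (n : nat) (f g : V).
Hypothesis deg : forall x, \sum_(y <- S | adj x y) 1 <= k.
Hypothesis Hf : H f.
Hypothesis resolvent_eq : (- (3 * k + 1))%:C *: f - \sum_(x <- S | (lev x <= n)%N) D x f = g.

(** Apply D_x to the resolvent equation, move it past the sum, and pair with u = D_x f; the diagonal
    part of the sum is nonnegative. Commutators are bounded crudely by |D_x f| + |D_y f|, which over
    at most k neighbours lowers 3 k + 1 to 2 k + 1. *)
Lemma decay_pointwise x : (2 * k + 1) * N (D x f) <=
  N (D x g) + \sum_(y <- S | adj x y && (lev y <= n)%N) N (D y f).
Proof.
have HD y : H (D y f) by exact: DH.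
set u := D x f; have Hu : H u := HD x.
have Hs : H (\sum_(y <- S | (lev y <= n)%N) D y f) by apply: (prehilbert_sum hH).
have Hg : H g by rewrite -resolvent_eq; apply: (prehilbertB hH) => //; exact: (prehilbertZ hH).
set e := \sum_(y <- S | adj x y && (lev y <= n)%N) comm D x y f.
have He : H e by apply: (prehilbert_sum hH) => y _; exact: (commH hH hD).
have HDg := DH x Hg.
have E : (3 * k + 1)%:C *: u + \sum_(y <- S | (lev y <= n)%N) D y u = - (D x g + e).
  rewrite -resolvent_eq (projB hD) (projZ hD) (proj_sum hD) -/u rmorphN scaleNr !opprD !opprK -addrA; congr (_ + _).
  rewrite /e; under [X in _ - X]eq_bigl do rewrite andbC.
  rewrite big_mkcondr -sumrB; apply: eq_bigr => y _; rewrite /comm.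
  case: ifPn => [_|axy]; first by rewrite opprB addrC subrK.
  have [xy|xy] := eqVneq x y; first by rewrite subr0 /u xy.
  by rewrite subr0 (lp_comm hD).
have p : (3 * k + 1) * N u ^+ 2 <= N u * (N (D x g) + N e).
  have HSu : H (\sum_(y <- S | (lev y <= n)%N) D y u).
    by apply: (prehilbert_sum hH) => y _; exact: DH.
  have h1 : rip u ((3 * k + 1)%:C *: u + \sum_(y <- S | (lev y <= n)%N) D y u) =
      (3 * k + 1) * N u ^+ 2 + \sum_(y <- S | (lev y <= n)%N) N (D y u) ^+ 2.
    rewrite (ripDr hH) //; last exact: (prehilbertZ hH).
    rewrite (ripZr hH) // (sqr_nrm hH) // (rip_sumr hH) // => [|y _]; last exact: DH.
    by congr (_ + _); apply: eq_bigr => y _; rewrite (proj_rip_sqr hH hD).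
  have h2 : 0 <= \sum_(y <- S | (lev y <= n)%N) N (D y u) ^+ 2.
    by apply: sumr_ge0 => y _; exact: sqr_ge0.
  have HgE := prehilbertD hH HDg He.
  have := rip_le hH Hu (prehilbertN hH HgE); rewrite -E h1 E (nrmN hH HgE).
  have := ler_wpM2l (nrm_ge0 ip u) (ler_nrmD hH HDg He).
  lra.
have q : N e <= \sum_(y <- S | adj x y && (lev y <= n)%N) (N u + N (D y f)).
  apply: le_trans (nrm_sum hH _ _) _ => [y _|]; first exact: (commH hH hD).
  apply: ler_sum => y _; rewrite addrC.
  apply: le_trans (ler_nrmB hH (DH x (HD y)) (DH y Hu)) _.
  by apply: lerD; exact: (nrm_proj hH hD).
have r : \sum_(y <- S | adj x y && (lev y <= n)%N) N u <= k * N u.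
  apply: (@le_trans _ _ ((\sum_(y <- S | adj x y) 1) * N u)); last by rewrite ler_wpM2r ?nrm_ge0.
  rewrite mulr_suml big_mkcondr; apply: ler_sum => y _; rewrite mul1r.
  by case: ifP => // _; exact: nrm_ge0.
rewrite big_split /= in q.
have [->|n0] := eqVneq (N u) 0.
  by rewrite mulr0 addr_ge0 ?nrm_ge0 // sumr_ge0 // => y _; exact: nrm_ge0.
have np : 0 < N u by rewrite lt_def n0 nrm_ge0.
have p' : (3 * k + 1) * N u <= N (D x g) + N e.
  by rewrite -(ler_pM2l np); move: p; rewrite expr2; lra.
lra.
Qed.

(** With at most k neighbours and a weight ratio of at most 2, the neighbour terms take 2 k of the
    factor 2 k + 1 and leave 1. Together with the k lost to commutators this accounts for the shift
    3 k + 1. *)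
Lemma decay_sum : \sum_(x <- S) 2 ^+ lev x * N (D x f) <= \sum_(x <- S) 2 ^+ lev x * N (D x g).
Proof.
set W := \sum_(x <- S) _; set G := \sum_(x <- S) _.
have h : (2 * k + 1) * W <= G + \sum_(x <- S) 2 ^+ lev x * \sum_(y <- S | adj x y && (lev y <= n)%N) N (D y f).
  rewrite /W /G mulr_sumr -big_split /=; apply: ler_sum => x _.
  have := ler_wpM2l (exprn_ge0 (lev x) (ler0n R 2)) (decay_pointwise x); lra.
have h2 : \sum_(x <- S) 2 ^+ lev x * \sum_(y <- S | adj x y && (lev y <= n)%N) N (D y f) <= 2 * k * W.
  apply: (@le_trans _ _ (\sum_(x <- S) \sum_(y <- S | adj x y) 2 * (2 ^+ lev y * N (D y f)))).
    apply: ler_sum => x _; rewrite mulr_sumr big_mkcondr; apply: ler_sum => y axy.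
    have p2 : 0 <= 2 * (2 ^+ lev y * N (D y f)) by rewrite !mulr_ge0 ?exprn_ge0 ?nrm_ge0.
    case: ifP => // _; rewrite mulrA ler_wpM2r ?nrm_ge0 // -exprS.
    by rewrite ler_eXn2l ?lev_adj // ltr1n.
  rewrite (exchange_big_dep xpredT) //= mulr_sumr; apply: ler_sum => y _.
  under eq_bigl do rewrite adjC.
  have p2 : 0 <= 2 * (2 ^+ lev y * N (D y f)) by rewrite !mulr_ge0 ?exprn_ge0 ?nrm_ge0.
  have -> : 2 * k * (2 ^+ lev y * N (D y f)) = k * (2 * (2 ^+ lev y * N (D y f))) by ring.
  have -> : \sum_(i <- S | adj y i) 2 * (2 ^+ lev y * N (D y f)) =
     (\sum_(i <- S | adj y i) 1) * (2 * (2 ^+ lev y * N (D y f))).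
    by rewrite mulr_suml; apply: eq_bigr => i _; rewrite mul1r.
  by rewrite ler_wpM2r.
lra.
Qed.

(* Neighbouring levels differ by 1, so the weights 2^lev lose only a factor 2
   along a bond, which the shift 3k + 1 absorbs. *)
Lemma decay_boundary : N (\sum_(x <- S | ~~ (lev x <= n)%N) D x f) <=
  2 ^- n * \sum_(x <- S) 2 ^+ lev x * N (D x g).
Proof.
have HD y : H (D y f) by exact: DH.
apply: le_trans (nrm_sum hH _ (fun y _ => HD y)) _.
have p : 0 < 2 ^+ n :> R by rewrite exprn_gt0.
rewrite mulrC ler_pdivlMr // mulrC; apply: le_trans decay_sum.
rewrite mulr_sumr big_mkcond; apply: ler_sum => x _.
case: ifPn => [ln|_]; last by rewrite mulr_ge0 ?exprn_ge0 ?nrm_ge0.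
rewrite ler_wpM2r ?nrm_ge0 // ler_eXn2l ?ltr1n //.
by rewrite -ltnNge in ln; exact: ltnW.
Qed.

End Decay.

(** * The complex Hilbert space of square-integrable functions *)

Section SquareIntegrable.
Context {dT : measure_display} {T : measurableType dT} {R : realType}.
Variable mu : probability T R.

Definition sqint (f : T -> R) := measurable_fun setT f /\
  mu.-integrable setT (EFin \o (fun x => f x ^+ 2)).

Lemma Lfun2P (f : T -> R) : f \in Lfun mu 2%:E <-> sqint f.
Proof.
split=> [h|[mf intf]].
  split; last exact: Lfun2_integrable_sqr.
  by move: h; rewrite inE => /andP[/[!inE]].
rewrite inE; apply/andP; split; rewrite inE //= /finite_norm unlock /Lnorm poweR_lty //.
have /integrableP[_] := intf; congr (_ < _)%E.
apply: eq_integral => x _ /=.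
by rewrite powR_mulrn // real_normK ?num_real // normrX real_normK ?num_real.
Qed.

Lemma sqintM f g : sqint f -> sqint g -> mu.-integrable setT (EFin \o (fun x => f x * g x)).
Proof.
by move=> /Lfun2P hf /Lfun2P hg; apply/Lfun1_integrable; exact: Lfun2_mul_Lfun1.
Qed.

Lemma sqintZ a f : sqint f -> sqint (fun x => a * f x).
Proof.
move=> [mf intf]; split; first exact: measurable_funM.
have := integrableZl measurableT (a ^+ 2) intf; apply: eq_integrable => //.
by move=> x _ /=; rewrite -EFinM exprMn.
Qed.

Lemma sqintD f g : sqint f -> sqint g -> sqint (fun x => f x + g x).
Proof.
move=> hf hg; have [mf intf] := hf; have [mg intg] := hg; split; first exact: measurable_funD.
have fg := integrableZl measurableT 2 (sqintM hf hg).
have := integrableD measurableT (integrableD measurableT intf fg) intg.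
apply: eq_integrable => //.
by move=> x _ /=; rewrite -EFinM -!EFinD; congr (_%:E); ring.
Qed.

Lemma le_sqint (f g : T -> R) : measurable_fun setT f -> (forall x, `|f x| <= `|g x|) -> sqint g -> sqint f.
Proof.
move=> mf fg [mg intg]; split => //; apply: le_integrable intg => //.
  by apply/measurable_EFinP; exact: measurable_funX.
move=> x _ /=; rewrite lee_fin !normrX; apply: lerXn2r; rewrite ?nnegrE //.
Qed.

Lemma sqint_cst c : sqint (cst c).
Proof. by apply/Lfun2P; exact: Lfun_cst. Qed.

Lemma sqint_bounded (f : T -> R) M : measurable_fun setT f -> (forall x, `|f x| <= M) -> sqint f.
Proof.
move=> mf hM; apply: (le_sqint mf _ (sqint_cst M)) => x.
by apply: le_trans (hM x) _; exact: ler_norm.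
Qed.

Lemma L2E f : L2 mu f <-> sqint (fun t => complex.Re (f t)) /\ sqint (fun t => complex.Im (f t)).
Proof. by split=> [[/Lfun2P h1 /Lfun2P h2]|[/Lfun2P h1 /Lfun2P h2]]; split. Qed.

End SquareIntegrable.

Section ComplexIntegral.
Context {dT : measure_display} {T : measurableType dT} {R : realType}.
Variables (mu : {measure set T -> \bar R}) (D : set T) (mD : measurable D).

Definition Cintegrable (f : T -> R[i]) :=
  mu.-integrable D (EFin \o (fun t => complex.Re (f t))) /\
  mu.-integrable D (EFin \o (fun t => complex.Im (f t))).

Lemma CintegrableD f g : Cintegrable f -> Cintegrable g -> Cintegrable (fun t => f t + g t).
Proof.
move=> [f1 f2] [g1 g2]; split.
  have := integrableD mD f1 g1; apply: eq_integrable => // t _ /=.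
  by rewrite Re_add EFinD.
have := integrableD mD f2 g2; apply: eq_integrable => // t _ /=.
by rewrite Im_add EFinD.
Qed.

Lemma CintegrableZ a f : Cintegrable f -> Cintegrable (fun t => a * f t).
Proof.
case: a => x y [f1 f2]; split.
  have := integrableB mD (integrableZl mD x f1) (integrableZl mD y f2).
  by apply: eq_integrable => // t _ /=; case: (f t).
have := integrableD mD (integrableZl mD x f2) (integrableZl mD y f1).
by apply: eq_integrable => // t _ /=; case: (f t) => u v /=; rewrite -!EFinM -EFinD.
Qed.

Lemma CintegralD f g : Cintegrable f -> Cintegrable g ->
  Cintegral mu D (fun t => f t + g t) = Cintegral mu D f + Cintegral mu D g.
Proof.
move=> [f1 f2] [g1 g2]; rewrite /Cintegral /=.
under eq_Rintegral do rewrite Re_add; under [X in _ +i* X]eq_Rintegral do rewrite Im_add.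
by rewrite !RintegralD.
Qed.

Lemma CintegralZ a f : Cintegrable f ->
  Cintegral mu D (fun t => a * f t) = a * Cintegral mu D f.
Proof.
case: a => x y [f1 f2]; rewrite /Cintegral.
have -> : (fun t => complex.Re ((x +i* y) * f t)) = fun t => x * complex.Re (f t) - y * complex.Im (f t).
  by apply/funext => t; case: (f t).
have -> : (fun t => complex.Im ((x +i* y) * f t)) = fun t => x * complex.Im (f t) + y * complex.Re (f t).
  by apply/funext => t; case: (f t).
have i1 : mu.-integrable D (EFin \o (fun t => x * complex.Re (f t))).
  by have := integrableZl mD x f1; apply: eq_integrable.
have i2 : mu.-integrable D (EFin \o (fun t => y * complex.Im (f t))).
  by have := integrableZl mD y f2; apply: eq_integrable.
have i3 : mu.-integrable D (EFin \o (fun t => x * complex.Im (f t))).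
  by have := integrableZl mD x f2; apply: eq_integrable.
have i4 : mu.-integrable D (EFin \o (fun t => y * complex.Re (f t))).
  by have := integrableZl mD y f1; apply: eq_integrable.
by rewrite RintegralB // RintegralD // !RintegralZl.
Qed.

Lemma Cintegral_conj f : Cintegrable f -> Cintegral mu D (fun t => (f t)^*%C) = (Cintegral mu D f)^*%C.
Proof.
move=> [f1 f2]; rewrite /Cintegral /=.
have -> : (fun t => complex.Re (f t)^*%C) = fun t => complex.Re (f t) by apply/funext => t; case: (f t).
have -> : (fun t => complex.Im (f t)^*%C) = fun t => (-1) * complex.Im (f t).
  by apply/funext => t; case: (f t) => a b; rewrite mulN1r.
by rewrite RintegralZl // mulN1r.
Qed.

Lemma Cintegral_sum (I : Type) (r : seq I) (P : pred I) (F : I -> T -> R[i]) :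
  (forall i, P i -> Cintegrable (F i)) ->
  Cintegral mu D (fun t => \sum_(i <- r | P i) F i t) = \sum_(i <- r | P i) Cintegral mu D (F i).
Proof.
move=> hF.
have c0 : Cintegrable (fun=> 0) by split; exact: integrable0.
suff [] : Cintegrable (fun t => \sum_(i <- r | P i) F i t) /\
  Cintegral mu D (fun t => \sum_(i <- r | P i) F i t) = \sum_(i <- r | P i) Cintegral mu D (F i) by [].
elim: r => [|i r [IH1 IH2]].
  rewrite big_nil; have -> : (fun t => \sum_(i <- [::] | P i) F i t) = fun=> 0.
    by apply/funext => t; rewrite big_nil.
  split => //; rewrite /Cintegral /=.
  have -> : Rintegral mu D (fun=> 0 : R) = 0.
    by rewrite /Rintegral integral0.
  by [].
rewrite big_cons; case: ifP => Pi; last first.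
  by have -> : (fun t => \sum_(i <- i :: r | P i) F i t) = (fun t => \sum_(i <- r | P i) F i t);
    [apply/funext => t; rewrite big_cons Pi|split].
have -> : (fun t => \sum_(i <- i :: r | P i) F i t) = (fun t => F i t + \sum_(i <- r | P i) F i t).
  by apply/funext => t; rewrite big_cons Pi.
by split; [apply: CintegrableD => //; exact: hF|rewrite CintegralD ?IH2 //; exact: hF].
Qed.

End ComplexIntegral.

Section L2space.
Context {dT : measure_display} {T : measurableType dT} {R : realType}.
Variable mu : probability T R.

Lemma L2D f g : L2 mu f -> L2 mu g -> L2 mu (f + g).
Proof.
move=> /L2E[f1 f2] /L2E[g1 g2]; apply/L2E; split.
  have := sqintD f1 g1; congr (sqint _ _); apply/funext => t; by rewrite -Re_add.
have := sqintD f2 g2; congr (sqint _ _); apply/funext => t; by rewrite -Im_add.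
Qed.

Lemma L2Z a f : L2 mu f -> L2 mu (a *: f).
Proof.
case: a => x y /L2E[f1 f2]; apply/L2E; split.
  have := sqintD (sqintZ x f1) (sqintZ (- y) f2); congr (sqint _ _); apply/funext => t.
  by rewrite /GRing.scale /=; case: (f t) => u v /=; rewrite mulNr.
have := sqintD (sqintZ x f2) (sqintZ y f1); congr (sqint _ _); apply/funext => t.
by rewrite /GRing.scale /=; case: (f t) => u v /=.
Qed.

Lemma L2_0 : L2 mu 0.
Proof. by apply/L2E; split; exact: sqint_cst. Qed.

Lemma L2_Cintegrable f g : L2 mu f -> L2 mu g -> Cintegrable mu setT (fun t => (f t)^*%C * g t).
Proof.
move=> /L2E[f1 f2] /L2E[g1 g2]; split.
  have := integrableD measurableT (sqintM f1 g1) (sqintM f2 g2).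
  apply: eq_integrable => // t _ /=; rewrite -EFinD; congr (_%:E).
  by case: (f t) => a b; case: (g t) => c e /=; rewrite mulNr opprK.
have := integrableB measurableT (sqintM f1 g2) (sqintM f2 g1).
apply: eq_integrable => // t _ /=; congr (_%:E).
by case: (f t) => a b; case: (g t) => c e /=; rewrite mulNr.
Qed.

Lemma L2_prehilbert : prehilbert (L2 mu) (inner mu).
Proof.
split; [exact: L2D|exact: L2Z|exact: L2_0|..].
- move=> f g h Hf Hg Hh; rewrite /inner -CintegralD //; try exact: L2_Cintegrable.
  by congr Cintegral; apply/funext => t; rewrite mulrDr.
- move=> a f g Hf Hg; rewrite /inner -CintegralZ //; last exact: L2_Cintegrable.
  by congr Cintegral; apply/funext => t; rewrite mulrCA.
- move=> f g Hf Hg; rewrite /inner -Cintegral_conj //; last exact: L2_Cintegrable.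
  by congr Cintegral; apply/funext => t; rewrite rmorphM /= conjcK mulrC.
- move=> f Hf; apply: Rintegral_ge0 => t _; rewrite conj_mul_normc /=; exact: sqr_ge0.
Qed.

Lemma integrable_sqr_normc f : L2 mu f ->
  mu.-integrable setT (EFin \o (fun t => normc (f t) ^+ 2)).
Proof.
move=> Hf; have [i1 _] := L2_Cintegrable Hf Hf; apply: eq_integrable i1 => // t _ /=.
by rewrite conj_mul_normc.
Qed.

Lemma sqr_nrm_inner f : L2 mu f ->
  nrm (inner mu) f ^+ 2 = \int[mu]_t (normc (f t) ^+ 2).
Proof.
move=> Hf; rewrite (sqr_nrm L2_prehilbert) //.
by rewrite /rip /inner /=; apply: eq_Rintegral => t _; rewrite conj_mul_normc.
Qed.

Lemma L2normE f : L2 mu f -> L2norm mu f = (nrm (inner mu) f)%:E.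
Proof.
move=> Hf; rewrite /L2norm unlock /=.
have i1 := integrable_sqr_normc Hf.
have -> : (\int[mu]_x (`|normc (f x)| `^ 2)%:E = (nrm (inner mu) f ^+ 2)%:E)%E.
  rewrite sqr_nrm_inner // /Rintegral fineK; last exact: integrable_fin_num.
  by apply: eq_integral => t _; rewrite powR_mulrn ?ger0_norm ?normc_ge0.
rewrite poweR_EFin -powR_mulrn ?nrm_ge0 // -powRrM mulfV ?pnatr_eq0 // powRr1 ?nrm_ge0 //.
Qed.

End L2space.

(** * Completeness of L^2 *)

Section RieszFischer.
Context {dT : measure_display} {T : measurableType dT} {R : realType}.
Variable mu : probability T R.

Local Notation I2 h := (\int[mu]_x (h x ^+ 2)%:E)%E.

Lemma limn_einf_le (w : nat -> \bar R) (l : \bar R) n0 :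
  (forall n, (n0 <= n)%N -> (w n <= l)%E) -> (limn_einf w <= l)%E.
Proof.
move=> h; rewrite limn_einf_lim; apply: lime_le; first exact: is_cvg_einfs.
exists n0 => // n /= /h; apply: le_trans.
by apply: ereal_inf_lbound; exists n => /=.
Qed.

Lemma sum_geometric_cvg (w : nat -> R) (M : R) :
  (forall j, `|w j.+1 - w j| <= M * (2^-1) ^+ j) -> cvgn w.
Proof.
move=> h.
have c : cvgn (series (telescope w)).
  apply: normed_cvg; apply: (@series_le_cvg _ _ (geometric M 2^-1)) => [n|n|n|].
  - exact: normr_ge0.
  - by apply: le_trans (h n); exact: normr_ge0.
  - exact: h.
  - by apply: is_cvg_geometric_series; rewrite ger0_norm; lra.
have -> : w = fun n => w 0%N + series (telescope w) n by apply/funext => n; exact: eq_sum_telescope.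
by apply: is_cvgD => //; exact: is_cvg_cst.
Qed.

(** A rapidly Cauchy subsequence converges almost everywhere, and Fatou's lemma turns this pointwise
    limit into a limit of the whole sequence in L^2. *)
Lemma sqint_complete (u : nat -> T -> R) : (forall n, sqint mu (u n)) ->
  (forall e : R, 0 < e -> exists n0, forall n m, (n0 <= n)%N -> (n0 <= m)%N ->
    (I2 (fun x => u n x - u m x)%R <= e%:E)%E) ->
  exists2 f, sqint mu f & forall e : R, 0 < e -> exists n0, forall n, (n0 <= n)%N ->
    (I2 (fun x => u n x - f x)%R <= e%:E)%E.
Proof.
move=> hu hc.
have mu_ n : measurable_fun setT (u n) by have [] := hu n.
(* Squared distances at most 16^-j leave room for the weight 4^j: the weighted series still has a
   finite integral, and where it converges the increments are at most a constant times 2^-j. *)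
have /choice[k hk] j : exists n0, forall n m, (n0 <= n)%N -> (n0 <= m)%N ->
    (I2 (fun x => u n x - u m x)%R <= ((16^-1) ^+ j)%:E)%E.
  by apply: hc; rewrite exprn_gt0 // invr_gt0.
(* The running maximum makes the chosen indices nondecreasing. *)
pose m j := \max_(i < j.+1) k i.
have km j : (k j <= m j)%N by exact: (@leq_bigmax _ (fun i : 'I_j.+1 => k i) ord_max).
have mm j : (m j <= m j.+1)%N by rewrite /m [leqRHS]big_ord_recr /= leq_maxl.
have mle i j : (i <= j)%N -> (k i <= m j)%N.
  move=> ij; have ij' : (i < j.+1)%N by [].
  exact: (@leq_bigmax _ (fun i : 'I_j.+1 => k i) (Ordinal ij')).
pose v j := u (m j).
have hv j : (I2 (fun x => v j.+1 x - v j x)%R <= ((16^-1) ^+ j)%:E)%E.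
  by apply: hk; [exact: leq_trans (km j) (mm j)|exact: km].
pose F j x : \bar R := (4 ^+ j * (v j.+1 x - v j x) ^+ 2)%:E.
have mF j : measurable_fun setT (F j).
  apply/measurable_EFinP; apply: measurable_funM => //.
  by apply: measurable_funX; apply: measurable_funB; exact: mu_.
have F0 j x : (0 <= F j x)%E by rewrite lee_fin; apply: mulr_ge0; [exact: exprn_ge0|exact: sqr_ge0].
pose G x := (\sum_(0 <= j <oo) F j x)%E.
have mG : measurable_fun setT G.
  exact: (ge0_emeasurable_sum (P := xpredT) (fun k x _ _ => F0 k x) (fun k _ => mF k)).
have G0 x : (0 <= G x)%E by exact: nneseries_ge0.
have iG : mu.-integrable setT G.
  apply/integrableP; split => //.
  have -> : (\int[mu]_x `|G x| = \int[mu]_x G x)%E.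
    by apply: eq_integral => x _; rewrite gee0_abs.
  rewrite integral_nneseries //.
  apply: (@le_lt_trans _ _ (\sum_(0 <= j <oo) (2 / (2 ^ j.+1)%:R)%:E)%E); last first.
    by apply: le_lt_trans (epsilon_trick0 xpredT (ler0n R 2)) _; rewrite ltry.
  apply: lee_nneseries => [j _ _|j _]; first by apply: integral_ge0.
  have -> : (\int[mu]_x F j x = (4 ^+ j)%:E * I2 (fun x => v j.+1 x - v j x)%R)%E.
    rewrite -ge0_integralZl_EFin //.
    - by move=> x _; rewrite lee_fin sqr_ge0.
    - apply/measurable_EFinP; apply: measurable_funX; apply: measurable_funB; exact: mu_.
  apply: (@le_trans _ _ ((4 ^+ j)%:E * ((16^-1) ^+ j)%:E)%E).
    by apply: lee_wpmul2l; rewrite ?lee_fin ?exprn_ge0 // hv.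
  rewrite -EFinM lee_fin -exprMn natrX exprS invfM mulrA mulfV // mul1r -exprVn.
  by apply: lerXn2r; rewrite ?nnegrE //; lra.
have [N [mN N0 hN]] := integrable_ae measurableT iG.
have cvx x : ~ N x -> cvgn (v ^~ x).
  move=> Nx; have Gfin : G x \is a fin_num by apply: contrapT => h; apply: Nx; apply: hN => /= /(_ I).
  apply: (@sum_geometric_cvg _ (1 + fine (G x))) => j.
  have h1 : 4 ^+ j * (v j.+1 x - v j x) ^+ 2 <= fine (G x).
    rewrite -lee_fin fineK //.
    apply: le_trans (nneseries_lim_ge j.+1 (fun i _ _ => F0 i x)).
    by rewrite big_nat_recr //= leeDr // sume_ge0.
  have g0 : 0 <= fine (G x) by rewrite fine_ge0.
  have p : 0 < 2 ^+ j :> R by rewrite exprn_gt0.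
  rewrite exprVn ler_pdivlMr // -(@ler_pXn2r _ 2) ?nnegrE ?mulr_ge0 ?exprn_ge0 ?addr_ge0 //.
  rewrite exprMn real_normK ?num_real // -exprM mulnC exprM mulrC.
  have -> : (2 : R) ^+ 2 = 4 by ring.
  nra.
(* Setting the subsequence to 0 on the null set [N] makes it converge everywhere, so that the limit
   is measurable. *)
pose w j x := v j x * \1_(~` N) x.
pose f x := if x \in ~` N then limn (v ^~ x) else 0.
have wf x : w ^~ x @ \oo --> f x.
  rewrite /w /f /= indicE; case: ifPn => xN.
    rewrite /=; under eq_fun do rewrite mulr1.
    by apply: cvx; move: xN; rewrite inE.
  by under eq_fun do rewrite mulr0; exact: cvg_cst.
have mw j : measurable_fun setT (w j).
  apply: measurable_funM; first exact: mu_.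
  exact: measurable_indic (measurableC mN).
have mf : measurable_fun setT f by exact: (measurable_fun_cvg mw (fun x _ => wf x)).
(* Fatou in the index j: the integral of |u_n - f|^2 is at most the lower limit of those of |u_n -
   v_j|^2. *)
have key e n0 : (forall n m, (n0 <= n)%N -> (n0 <= m)%N -> (I2 (fun x => u n x - u m x)%R <= e%:E)%E) ->
    forall n, (n0 <= n)%N -> (exists j0, (n0 <= k j0)%N) -> (I2 (fun x => u n x - f x)%R <= e%:E)%E.
  move=> he n nn [j0 hj0].
  have e1 : I2 (fun x => u n x - f x)%R = (\int[mu]_x limn_einf (fun j => ((u n x - w j x) ^+ 2)%:E))%E.
    apply: eq_integral => x _; apply/esym; apply: (cvg_limn_einf_sup _).1.
    apply: cvg_EFin; first exact: nearW.
    have c1 : u n x - w j x @[j --> \oo] --> u n x - f x 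
      by apply: (@cvgB _ _ _ _ _ (fun=> u n x) (w ^~ x)); [exact: cvg_cst|exact: (wf x)].
    have c2 : (u n x - w j x) ^+ 2 @[j --> \oo] --> (u n x - f x) ^+ 2.
      by under eq_fun do rewrite expr2; rewrite expr2; exact: (cvgM c1 c1).
    exact: c2.
  rewrite e1; apply: le_trans (fatou _ _ _ _) _ => //.
  - move=> j; apply/measurable_EFinP; apply: measurable_funX; apply: measurable_funB => //; exact: mu_.
  - by move=> j x _; rewrite lee_fin sqr_ge0.
  apply: (@limn_einf_le _ _ j0) => j jj.
  have -> : (\int[mu]_x ((u n x - w j x) ^+ 2)%:E = I2 (fun x => u n x - v j x)%R)%E.
    apply: ae_eq_integral => //.
    - by apply/measurable_EFinP; apply: measurable_funX; apply: measurable_funB; [exact: mu_|exact: mw].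
    - by apply/measurable_EFinP; apply: measurable_funX; apply: measurable_funB; exact: mu_.
    - exists N; split => // x /= h; apply: contrapT => Nx; apply: h => _.
      by rewrite /w indicE mem_set //= mulr1.
  by apply: he => //; apply: leq_trans hj0 (mle _ _ jj).
have conc (e : R) : 0 < e -> exists n0, forall n, (n0 <= n)%N -> (I2 (fun x => u n x - f x)%R <= e%:E)%E.
  move=> e0; have [n0 h0] := hc e e0.
  have : (16^-1 : R) ^+ i @[i --> \oo] --> (0 : R) by apply: cvg_expr; rewrite ger0_norm; lra.
  move=> /cvgrPdist_lt /(_ e e0)[j0 _ /(_ j0 (leqnn j0)) /=].
  rewrite sub0r normrN ger0_norm ?exprn_ge0 // => hj0.
  exists (k j0) => n nn; apply: (key _ (k j0)) => //; last by exists j0.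
  move=> a b ka kb; apply: le_trans (hk _ _ _ ka kb) _; rewrite lee_fin; exact: ltW.
exists f => //.
have [n0 /(_ n0 (leqnn n0)) h0] := conc 1 ltr01.
have hd : sqint mu (fun x => u n0 x - f x).
  split; first by apply: measurable_funB => //; exact: mu_.
  apply/integrableP; split.
    by apply/measurable_EFinP; apply: measurable_funX; apply: measurable_funB => //; exact: mu_.
  apply: le_lt_trans (ltry 1); apply: le_trans h0.
  apply: ge0_le_integral => //.
  - by apply: measurableT_comp => //; apply/measurable_EFinP; apply: measurable_funX; apply: measurable_funB => //; exact: mu_.
  - by apply/measurable_EFinP; apply: measurable_funX; apply: measurable_funB => //; exact: mu_.
  - by move=> x _; rewrite /= ger0_norm ?sqr_ge0.
have := sqintD (hu n0) (sqintZ (-1) hd); congr (sqint _ _).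
by apply/funext => x; ring.
Qed.

Lemma sqr_nrm_Re_le f : L2 mu f ->
  (I2 (fun x => complex.Re (f x)) <= (nrm (inner mu) f ^+ 2)%:E)%E /\
  (I2 (fun x => complex.Im (f x)) <= (nrm (inner mu) f ^+ 2)%:E)%E /\
  ((nrm (inner mu) f ^+ 2)%:E = I2 (fun x => complex.Re (f x)) + I2 (fun x => complex.Im (f x)))%E.
Proof.
move=> Hf; have /L2E[[m1 i1] [m2 i2]] := Hf.
have e : ((nrm (inner mu) f ^+ 2)%:E = I2 (fun x => complex.Re (f x)) + I2 (fun x => complex.Im (f x)))%E.
  rewrite sqr_nrm_inner // /Rintegral fineK; last first.
    by apply: integrable_fin_num => //; exact: integrable_sqr_normc.
  rewrite -ge0_integralD //; last 4 first.
  - by move=> x _; rewrite lee_fin sqr_ge0.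
  - by apply/measurable_EFinP; exact: measurable_funX.
  - by move=> x _; rewrite lee_fin sqr_ge0.
  - by apply/measurable_EFinP; exact: measurable_funX.
  by apply: eq_integral => x _; rewrite sqr_normcE EFinD.
rewrite e; split; last split => //.
  by apply: leeDl; apply: integral_ge0 => x _; rewrite lee_fin sqr_ge0.
by apply: leeDr; apply: integral_ge0 => x _; rewrite lee_fin sqr_ge0.
Qed.

Lemma L2_complete (u : nat -> T -> R[i]) : (forall n, L2 mu (u n)) -> scauchy (inner mu) u ->
  exists2 l, L2 mu l & scvg (inner mu) u l.
Proof.
move=> hu hc; have hH := L2_prehilbert mu.
have cau e : 0 < e -> exists n0, forall n m, (n0 <= n)%N -> (n0 <= m)%N ->
    nrm (inner mu) (u n - u m) ^+ 2 <= e.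
  move=> e0; have s0 : 0 < Num.sqrt e by rewrite sqrtr_gt0.
  have [n0 h0] := hc _ s0; exists n0 => n m nn mm.
  rewrite -(sqr_sqrtr (ltW e0)) ler_pXn2r ?nnegrE ?nrm_ge0 ?sqrtr_ge0 //.
  by apply/ltW; exact: h0.
have hd n m : L2 mu (u n - u m) by exact: (prehilbertB hH).
have cR e : 0 < e -> exists n0, forall n m, (n0 <= n)%N -> (n0 <= m)%N ->
    (I2 (fun x => complex.Re (u n x) - complex.Re (u m x))%R <= e%:E)%E.
  move=> /cau[n0 h0]; exists n0 => n m nn mm.
  have [a _] := sqr_nrm_Re_le (hd n m).
  apply: (@le_trans _ _ (nrm (inner mu) (u n - u m) ^+ 2)%:E); last by rewrite lee_fin h0.
  apply: le_trans a; rewrite le_eqVlt; apply/orP; left; apply/eqP.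
  by apply: eq_integral => x _; rewrite -[(u n - u m) x]/(u n x - u m x) Re_add; case: (u m x).
have cI e : 0 < e -> exists n0, forall n m, (n0 <= n)%N -> (n0 <= m)%N ->
    (I2 (fun x => complex.Im (u n x) - complex.Im (u m x))%R <= e%:E)%E.
  move=> /cau[n0 h0]; exists n0 => n m nn mm.
  have [_ [a _]] := sqr_nrm_Re_le (hd n m).
  apply: (@le_trans _ _ (nrm (inner mu) (u n - u m) ^+ 2)%:E); last by rewrite lee_fin h0.
  apply: le_trans a; rewrite le_eqVlt; apply/orP; left; apply/eqP.
  by apply: eq_integral => x _; rewrite -[(u n - u m) x]/(u n x - u m x) Im_add; case: (u m x).
have [f1 Hf1 c1] := sqint_complete (fun n => ((L2E _ _).1 (hu n)).1) cR.
have [f2 Hf2 c2] := sqint_complete (fun n => ((L2E _ _).1 (hu n)).2) cI.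
have Hl : L2 mu (fun x => f1 x +i* f2 x) by apply/L2E.
exists (fun x => f1 x +i* f2 x) => // e e0.
have e2 : 0 < e ^+ 2 / 4 by rewrite divr_gt0 ?exprn_gt0.
have [n1 h1] := c1 _ e2; have [n2 h2] := c2 _ e2.
exists (maxn n1 n2) => n; rewrite geq_max => /andP[/h1 {}h1 /h2 {}h2].
have Hd := prehilbertB hH (hu n) Hl.
rewrite -(@ltr_pXn2r _ 2) ?nnegrE ?nrm_ge0 ?ltW //.
have [_ [_ eq]] := sqr_nrm_Re_le Hd; rewrite -lte_fin eq.
have -> : (I2 (fun x => complex.Re ((u n - (fun x => f1 x +i* f2 x)) x)) = I2 (fun x => complex.Re (u n x) - f1 x)%R)%E.
  by apply: eq_integral => x _; rewrite -[(u n - _) x]/(u n x - (f1 x +i* f2 x)) Re_add.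
have -> : (I2 (fun x => complex.Im ((u n - (fun x => f1 x +i* f2 x)) x)) = I2 (fun x => complex.Im (u n x) - f2 x)%R)%E.
  by apply: eq_integral => x _; rewrite -[(u n - _) x]/(u n x - (f1 x +i* f2 x)) Im_add.
apply: le_lt_trans (leeD h1 h2) _; rewrite -EFinD lte_fin.
have := exprn_gt0 2 e0; lra.
Qed.

End RieszFischer.

Lemma cvge_lt (R : realType) (u : nat -> \bar R) (l e : \bar R) :
  u n @[n --> \oo] --> l -> (l < e)%E -> exists n, (u n < e)%E.
Proof.
move=> c le; have [n _ h] := c _ (open_ereal_lt' le).
by exists n; apply: (h n); exact: leqnn.
Qed.

(** * Density in L^2 by approximation of sets *)

Section SetApproximation.
Context {dT : measure_display} {T : measurableType dT} {R : realType}.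
Variable mu : probability T R.
Variable Alg : set (set T).
Hypothesis AlgM : forall A, Alg A -> measurable A.
Hypothesis Alg0 : Alg set0.
Hypothesis AlgC : forall A, Alg A -> Alg (~` A).
Hypothesis AlgU : forall A B, Alg A -> Alg B -> Alg (A `|` B).

Definition sdiff (A B : set T) := (A `\` B) `|` (B `\` A).

Lemma measurable_sdiff A B : measurable A -> measurable B -> measurable (sdiff A B).
Proof. by move=> mA mB; apply: measurableU; exact: measurableD. Qed.

Definition approximable (A : set T) := measurable A /\
  forall e : R, 0 < e -> exists2 C, Alg C & (mu (sdiff A C) < e%:E)%E.

Lemma approximableU A B : approximable A -> approximable B -> approximable (A `|` B).
Proof.
move=> [mA hA] [mB hB]; split; first exact: measurableU.
move=> e e0; have e2 : 0 < e / 2 by rewrite divr_gt0.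
have [C AC hC] := hA _ e2; have [D AD hD] := hB _ e2.
exists (C `|` D); first exact: AlgU.
have m1 := measurable_sdiff mA (AlgM AC); have m2 := measurable_sdiff mB (AlgM AD).
apply: (@le_lt_trans _ _ (mu (sdiff A C `|` sdiff B D))).
  apply: le_measure; rewrite ?inE //.
  - apply: measurable_sdiff; apply: measurableU => //; exact: AlgM.
  - exact: measurableU.
  - move=> x [[[Ax|Bx] /not_orP[nC nD]]|[[Cx|Dx] /not_orP[nA nB]]].
    + by left; left.
    + by right; left.
    + by left; right.
    + by right; right.
apply: le_lt_trans (measureU2 mu m1 m2) _.
by rewrite [e]splitr EFinD; exact: lteD.
Qed.

(** A countable union is first truncated to a finite one, the remainder having small measure by
    continuity from above, and the finite union is then approximated. *)
Lemma approximable_sigma_algebra : sigma_algebra setT approximable.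
Proof.
split.
- split => // e e0; exists set0 => //.
  by rewrite /sdiff setDv setU0 measure0 lte_fin.
- move=> A [mA hA]; rewrite setTD; split; first exact: measurableC.
  move=> e /hA[C AC hC]; exists (~` C); first exact: AlgC.
  have -> : sdiff (~` A) (~` C) = sdiff A C.
    by rewrite /sdiff !setDE !setCK setUC [~` C `&` A]setIC [~` A `&` C]setIC.
  by [].
- move=> A hA; have mA n : measurable (A n) by have [] := hA n.
  have mU : measurable (\bigcup_k A k) by exact: bigcupT_measurable.
  split => // e e0; have e2 : 0 < e / 2 by rewrite divr_gt0.
  pose F n := \big[setU/set0]_(i < n) A i.
  have hF n : approximable (F n).
    elim: n => [|n IH]; rewrite /F.
      rewrite big_ord0; split => // e' e'0; exists set0 => //.
      by rewrite /sdiff setDv setU0 measure0 lte_fin.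
    by rewrite big_ord_recr; apply: approximableU.
  have mF n : measurable (F n) by have [] := hF n.
  have c : (mu \o (fun n => (\bigcup_k A k) `\` F n)) n @[n --> \oo] --> mu set0.
    have <- : \bigcap_n ((\bigcup_k A k) `\` F n) = set0.
      apply/seteqP; split=> // x h; have [[k _ Akx] _] := h 0%N I.
      have [_] := h k.+1 I; apply; rewrite /F -bigcup_mkord; by exists k => /=.
    apply: nonincreasing_cvg_mu.
    - by rewrite (le_lt_trans (probability_le1 _ _)) ?ltry //; exact: measurableD.
    - by move=> n; exact: measurableD.
    - by apply: bigcapT_measurable => n; exact: measurableD.
    - move=> n m nm; apply/subsetPset; apply: setDS.
      by rewrite /F -!bigcup_mkord; apply: bigcup_subset => i /= /leq_trans; exact.
  have [n hn] : exists n, (mu ((\bigcup_k A k) `\` F n) < (e / 2)%:E)%E.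
    by apply: (cvge_lt c); rewrite measure0 lte_fin.
  have [_ /(_ _ e2)[C AC hC]] := hF n; exists C => //.
  have m1 : measurable ((\bigcup_k A k) `\` F n) by exact: measurableD.
  have m2 := measurable_sdiff (mF n) (AlgM AC).
  apply: (@le_lt_trans _ _ (mu (((\bigcup_k A k) `\` F n) `|` sdiff (F n) C))).
    apply: le_measure; rewrite ?inE //.
    - by apply: measurable_sdiff => //; exact: AlgM.
    - exact: measurableU.
    - move=> x [[Ux nC]|[Cx nU]].
        by have [Fx|nF] := pselect (F n x); [right; left|left].
      right; right; split => // Fx; apply: nU.
      by move: Fx; rewrite /F -bigcup_mkord => -[i /= _ Aix]; exists i.
  apply: le_lt_trans (measureU2 mu m1 m2) _.
  by rewrite [e]splitr EFinD; exact: lteD.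
Qed.

End SetApproximation.

Section Density.
Context {dT : measure_display} {T : measurableType dT} {R : realType}.
Variable mu : probability T R.
Variable K : set (T -> R[i]).
Hypothesis KL2 : K `<=` L2 mu.
Hypothesis K0 : K 0.
Hypothesis KD : forall f g, K f -> K g -> K (f + g).
Hypothesis KZ : forall a f, K f -> K (a *: f).
Local Notation N := (nrm (inner mu)).
Let hH := L2_prehilbert mu.

Definition approx_by (g : T -> R[i]) := L2 mu g /\ forall e : R, 0 < e -> exists2 f, K f & N (f - g) < e.

Lemma approx_byD f g : approx_by f -> approx_by g -> approx_by (f + g).
Proof.
move=> [Hf cf] [Hg cg]; split; first exact: L2D.
move=> e e0; have e2 : 0 < e / 2 by rewrite divr_gt0.
have [f' Kf hf] := cf _ e2; have [g' Kg hg] := cg _ e2.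
exists (f' + g'); first exact: KD.
have -> : f' + g' - (f + g) = (f' - f) + (g' - g) by rewrite opprD addrACA.
have Hf' := KL2 Kf; have Hg' := KL2 Kg.
apply: le_lt_trans (ler_nrmD hH (prehilbertB hH Hf' Hf) (prehilbertB hH Hg' Hg)) _; lra.
Qed.

Lemma approx_byZ a f : approx_by f -> approx_by (a *: f).
Proof.
move=> [Hf cf]; split; first exact: L2Z.
move=> e e0; have c0 : 0 < normc a + 1 by rewrite ltr_wpDl ?normc_ge0.
have [f' Kf hf] := cf _ (divr_gt0 e0 c0); exists (a *: f'); first exact: KZ.
rewrite -scalerBr (nrmZ hH); last by apply: (prehilbertB hH) => //; exact: KL2.
rewrite ltr_pdivlMr // in hf; apply: le_lt_trans hf.
by rewrite mulrC ler_wpM2l ?nrm_ge0 //; lra.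
Qed.

Lemma cl0 : approx_by 0.
Proof. by split; [exact: L2_0|move=> e e0; exists 0 => //; rewrite subr0 (nrm0 hH)]. Qed.

Lemma cl_lim g : L2 mu g -> (forall e : R, 0 < e -> exists2 f, approx_by f & N (f - g) < e) -> approx_by g.
Proof.
move=> Hg h; split => // e e0; have e2 : 0 < e / 2 by rewrite divr_gt0.
have [f [Hf cf] fg] := h _ e2; have [f' Kf hf] := cf _ e2.
exists f' => //; apply: le_lt_trans (ler_dist_nrmD hH (KL2 Kf) Hg Hf) _; lra.
Qed.

Definition toC (f : T -> R) : T -> R[i] := fun x => (f x)%:C.

Lemma L2_toC f : sqint mu f -> L2 mu (toC f).
Proof. by move=> hf; apply/L2E; split => //=; exact: sqint_cst. Qed.

(** The squared distance between two indicators is the measure of the symmetric difference of the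
    sets. *)
Lemma approx_by_indic A : measurable A ->
  (forall e : R, 0 < e -> exists C, [/\ measurable C, K (toC \1_C) & (mu (sdiff A C) < e%:E)%E]) ->
  approx_by (toC \1_A).
Proof.
move=> mA h.
have sA B : measurable B -> sqint mu (\1_B : T -> R).
  move=> mB; apply: (@sqint_bounded _ _ _ _ _ 1); first exact: measurable_indic.
  by move=> x; rewrite indicE; case: (_ \in _) => /=; rewrite ?normr0 ?normr1.
split; first exact/L2_toC/sA.
move=> e e0; have e2 : 0 < e ^+ 2 by rewrite exprn_gt0.
have [C [mC KC hC]] := h _ e2; exists (toC \1_C) => //.
have HCA : L2 mu (toC \1_C - toC \1_A) by apply: (prehilbertB hH); apply: L2_toC; exact: sA.
rewrite -(@ltr_pXn2r _ 2) ?nnegrE ?nrm_ge0 ?ltW // sqr_nrm_inner //.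
rewrite -lte_fin /Rintegral fineK; last first.
  by apply: integrable_fin_num => //; exact: integrable_sqr_normc.
have mS := measurable_sdiff mA mC.
have -> : (\int[mu]_x (normc ((toC \1_C - toC \1_A) x) ^+ 2)%:E = \int[mu]_x (\1_(sdiff A C) x)%:E)%E.
  apply: eq_integral => x _; rewrite -[(_ - _) x]/((\1_C x)%:C - (\1_A x)%:C) -rmorphB normcR.
  rewrite real_normK ?num_real // !indicE /sdiff in_setU !in_setD.
  by case: (x \in A); case: (x \in C); rewrite /= ?subrr ?expr0n ?subr0 ?sub0r ?expr1n ?sqrrN ?expr1n.
by rewrite integral_indic // setIT.
Qed.

Hypothesis cl_ind : forall A, measurable A -> approx_by (toC \1_A).

Lemma cl_nnsfun (h : {nnsfun T >-> R}) : approx_by (toC h).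
Proof.
have -> : toC h = \sum_(y <- fset_set (range h)) (y%:C *: toC \1_(h @^-1` [set y])).
  apply/funext => x; rewrite /toC fimfunE fsbig_finite //= rmorph_sum fct_sumE.
  by apply: eq_bigr => y _; rewrite rmorphM.
elim/big_rec: _ => [|y f _ IH]; first exact: cl0.
by apply: approx_byD => //; apply: approx_byZ; apply: cl_ind; exact: measurable_funPTI.
Qed.

Lemma cl_ge0 f : sqint mu f -> (forall x, 0 <= f x) -> approx_by (toC f).
Proof.
move=> hf f0; have [mf intf] := hf; apply: cl_lim; first exact: L2_toC.
have mEf : measurable_fun setT (EFin \o f) by exact/measurable_EFinP.
have Ef0 x : setT x -> (0 <= (EFin \o f) x)%E by rewrite /= lee_fin.
pose g := nnsfun_approx measurableT mEf.
have gf n x : g n x <= f x.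
  by rewrite -lee_fin /g nnsfun_approxE; exact: (le_approx n Ef0).
have mg n : measurable_fun setT (g n : T -> R) by exact: measurable_funPT.
have hg n : sqint mu (g n).
  apply: (le_sqint (mg n) _ hf) => x; rewrite !ger0_norm //; exact: gf.
(* Since 0 <= g_n <= f, the squared differences are dominated by f^2. *)
have c : (\int[mu]_x ((g n x - f x) ^+ 2)%:E)%E @[n --> \oo] --> (\int[mu]_x (cst 0 x)%:E)%E.
  apply: (@dominated_cvg _ _ _ mu setT measurableT (fun n x => ((g n x - f x) ^+ 2)%:E) _ (fun x => (f x ^+ 2)%:E)) => //.
  - move=> n; apply/measurable_EFinP; apply: measurable_funX; exact: measurable_funB.
  - move=> x _; apply: cvg_EFin; first exact: nearW.
    have c1 : (g n x - f x) @[n --> \oo] --> (f x - f x).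
      apply: cvgB; last exact: cvg_cst.
      have := cvg_nnsfun_approx measurableT mEf Ef0 (x := x) I.
      by move=> /fine_cvgP[].
    have c2 : (g n x - f x) ^+ 2 @[n --> \oo] --> (f x - f x) ^+ 2.
      by under eq_fun do rewrite expr2; rewrite expr2; exact: (cvgM c1 c1).
    by move: c2; rewrite subrr expr0n.
  - move=> n x _; rewrite lee_fin ger0_norm ?sqr_ge0 // -sqrrN opprB.
    by apply: lerXn2r; rewrite ?nnegrE ?subr_ge0 ?gf // lerBlDr lerDl.
rewrite integral0 in c.
move=> e e0; have e2 : 0 < e ^+ 2 by rewrite exprn_gt0.
have [n hn] : exists n, (\int[mu]_x ((g n x - f x) ^+ 2)%:E < (e ^+ 2)%:E)%E.
  by apply: (cvge_lt c); rewrite lte_fin.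
exists (toC (g n)); first exact: cl_nnsfun.
have Hd : L2 mu (toC (g n) - toC f) by apply: (prehilbertB hH); exact: L2_toC.
rewrite -(@ltr_pXn2r _ 2) ?nnegrE ?nrm_ge0 ?ltW // sqr_nrm_inner //.
rewrite -lte_fin /Rintegral fineK; last first.
  by apply: integrable_fin_num => //; exact: integrable_sqr_normc.
apply: le_lt_trans hn; rewrite le_eqVlt; apply/orP; left; apply/eqP.
apply: eq_integral => x _; rewrite -[(_ - _) x]/((g n x)%:C - (f x)%:C) -rmorphB normcR.
by rewrite real_normK ?num_real.
Qed.

Lemma cl_real f : sqint mu f -> approx_by (toC f).
Proof.
move=> hf; have [mf _] := hf.
have hp : sqint mu (fun x => Num.max (f x) 0).
  apply: (le_sqint _ _ hf) => [|x]; first by apply: measurable_maxr => //; exact: measurable_cst.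
  by rewrite /Num.max; case: ifP; rewrite ?normr0.
have hn : sqint mu (fun x => Num.max (- f x) 0).
  apply: (le_sqint _ _ hf) => [|x].
    by apply: measurable_maxr; [exact: measurableT_comp|exact: measurable_cst].
  by rewrite /Num.max; case: ifP; rewrite ?normr0 ?normrN.
have -> : toC f = toC (fun x => Num.max (f x) 0) + (-1) *: toC (fun x => Num.max (- f x) 0).
  apply/funext => x; rewrite -[RHS]/((Num.max (f x) 0)%:C + (-1) * (Num.max (- f x) 0)%:C).
  rewrite mulN1r -rmorphB; congr (_%:C).
  by rewrite /Num.max oppr_lt0; case: ltgtP => [_|_|->]; rewrite ?subr0 ?sub0r ?opprK ?oppr0 ?addr0.
by apply: approx_byD; last apply: approx_byZ; apply: cl_ge0 => // x; rewrite le_max lexx orbT.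
Qed.

Lemma cl_L2 g : L2 mu g -> approx_by g.
Proof.
move=> Hg; have /L2E[h1 h2] := Hg.
have -> : g = toC (fun x => complex.Re (g x)) + 'i%C *: toC (fun x => complex.Im (g x)).
  apply/funext => x; rewrite -[RHS]/((complex.Re (g x))%:C + 'i%C * (complex.Im (g x))%:C).
  by rewrite -complexE.
by apply: approx_byD; last apply: approx_byZ; exact: cl_real.
Qed.

Lemma sdense_L2 : sdense (L2 mu) (inner mu) K.
Proof. by move=> g /cl_L2[]. Qed.

End Density.

(** * Heat-bath operators on the lattice *)

Section Lattice.
Variable d : nat.
Implicit Types (x y z : site d).

Definition adj x y := \sum_(i < d) (x 0 i - y 0 i) ^+ 2 == 1.

Lemma adjP x y : reflect (nn x y) (adj x y).
Proof. exact: eqP. Qed.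

Lemma adjC : symmetric adj.
Proof.
by move=> x y; rewrite /adj; congr (_ == _); apply: eq_bigr => i _; rewrite -sqrrN opprB.
Qed.

Lemma adj_irr x : ~~ adj x x.
Proof. by rewrite /adj big1 // => i _; rewrite subrr expr0n. Qed.

Definition nbrs x : seq (site d) :=
  [seq x + e *: delta_mx 0 i | i <- enum 'I_d, e <- [:: 1; -1]].

Lemma size_nbrs x : size (nbrs x) = (2 * d)%N.
Proof. by rewrite size_allpairs size_enum_ord mulnC. Qed.

(** A sum of integer squares equal to 1 has exactly one nonzero term, and that term is 1. *)
Lemma adj_nbrs x y : adj x y -> y \in nbrs x.
Proof.
move=> /eqP h.
have [i hi] : exists i, x 0 i - y 0 i != 0.
  apply/existsP; apply: contraT; rewrite negb_exists => /forallP h0.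
  by move: h; rewrite big1 // => i _; have := h0 i; rewrite negbK => /eqP ->; rewrite expr0n.
have sq (a : int) : a != 0 -> 1 <= a ^+ 2 by rewrite -sqrf_eq0 => a0; rewrite -gtz0_ge1 lt_def a0 sqr_ge0.
have h1 := sq _ hi.
move: h; rewrite (bigD1 i) //= => h.
have r0 : 0 <= \sum_(j < d | j != i) (x 0 j - y 0 j) ^+ 2 by apply: sumr_ge0 => j _; exact: sqr_ge0.
have e1 : (x 0 i - y 0 i) ^+ 2 = 1.
  by apply/le_anti; rewrite h1 andbT -[leRHS]h lerDl.
have e0 : \sum_(j < d | j != i) (x 0 j - y 0 j) ^+ 2 = 0.
  by apply: (addrI ((x 0 i - y 0 i) ^+ 2)); rewrite h e1 addr0.
have ej j : j != i -> x 0 j = y 0 j.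
  move=> ji; have := psumr_eq0P (fun (j : 'I_d) (_ : j != i) => sqr_ge0 (x 0 j - y 0 j)) e0 ji.
  by move=> /eqP; rewrite sqrf_eq0 subr_eq0 => /eqP.
have yE (e : int) : y 0 i = x 0 i + e -> y = x + e *: delta_mx 0 i.
  move=> he; apply/rowP => j; rewrite !mxE eqxx /=.
  have [->|ji] := eqVneq j i; first by rewrite mulr1.
  by rewrite mulr0 addr0 ej.
have /orP[/eqP h2|/eqP h2] : (x 0 i - y 0 i == 1) || (x 0 i - y 0 i == -1) by rewrite -sqrf_eq1 e1.
  have -> : y = x + (-1) *: delta_mx 0 i by apply: yE; lia.
  by apply: allpairs_f; rewrite ?mem_enum // !inE eqxx orbT.
have -> : y = x + 1 *: delta_mx 0 i by apply: yE; lia.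
by apply: allpairs_f; rewrite ?mem_enum // !inE eqxx.
Qed.

Lemma sum_adj_le (R : realType) (S : seq (site d)) x : uniq S ->
  \sum_(y <- S | adj x y) (1 : R) <= (2 * d)%:R.
Proof.
move=> uS; rewrite -big_filter big_const_seq count_predT iter_addr_0 ler_nat -(size_nbrs x).
apply: uniq_leq_size; first exact: filter_uniq.
by move=> y; rewrite mem_filter => /andP[/adj_nbrs].
Qed.

(** The sup norm: its balls are the boxes, and it varies by at most 1 along a bond. *)
Definition lev x : nat := \max_(i < d) `|x 0%R i|%N.

Lemma lev_adj x y : adj x y -> (lev x <= (lev y).+1)%N.
Proof.
move=> /eqP h; apply/bigmax_leqP => i _.
have hy : (`|y 0%R i| <= lev y)%N by exact: (@leq_bigmax _ (fun i => `|y 0%R i|%N) i).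
have : (x 0 i - y 0 i) ^+ 2 <= 1.
  by rewrite -h (bigD1 i) //= lerDl; apply: sumr_ge0 => j _; exact: sqr_ge0.
move=> h1; have h2 : -1 <= x 0 i - y 0 i <= 1 by nia.
lia.
Qed.

Lemma finite_lev n : finite_set [set x | (lev x <= n)%N].
Proof.
pose F (r : 'rV['I_(2 * n).+1]_d) : site d := \row_i ((r 0 i : nat)%:Z - n%:Z).
apply: (sub_finite_set (B := F @` setT)); last by apply: finite_image; exact: finite_finset.
move=> x /= hx.
have hi i : (`|x 0%R i| <= n)%N by apply: leq_trans hx; exact: (@leq_bigmax _ (fun i => `|x 0%R i|%N) i).
exists (\row_i inord (absz (x 0 i + n%:Z))) => //.
apply/rowP => i; rewrite !mxE inordK; have := hi i; lia.
Qed.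

Definition box n : {fset site d} := fset_set [set x | (lev x <= n)%N].

Lemma in_box n x : (x \in box n) = (lev x <= n)%N.
Proof. by rewrite in_fset_set ?inE; [apply/idP/idP; rewrite inE|exact: finite_lev]. Qed.

Lemma sub_box (L : {fset site d}) : exists n, forall m, (n <= m)%N -> {subset L <= box m}.
Proof.
exists (\max_(x <- L) lev x) => m nm x xL; rewrite in_box; apply: leq_trans nm.
by apply: leq_bigmax_seq.
Qed.

Lemma finite_nn x : finite_set [set y | nn x y].
Proof.
apply: (sub_finite_set (B := [set` nbrs x])); last exact: finite_seq.
by move=> y /= /adjP/adj_nbrs.
Qed.

Definition nbr x : {fset site d} := fset_set [set y | nn x y].

Lemma in_nbr x y : (y \in nbr x) = adj x y.
Proof. by rewrite in_fset_set ?inE; [apply/idP/adjP; rewrite inE|exact: finite_nn]. Qed.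

Lemma card_nbr x : (#|` nbr x| <= 2 * d)%N.
Proof.
rewrite -(size_nbrs x); apply: uniq_leq_size; first exact: fset_uniq.
by move=> y; rewrite in_nbr; exact: adj_nbrs.
Qed.

End Lattice.

Section Rates.
Variables (R : realType) (d : nat) (beta J : R) (omega : {fset site d} -> R).
Hypothesis beta_ge0 : 0 <= beta.
Hypothesis omega_le : forall x y, nn x y -> `|omega [fset x; y]%fset| <= J.
Implicit Types (x y : site d) (s t : config d).

Lemma flipK s x : flip (flip s x) x = s.
Proof. by apply/funext => y; rewrite /flip; case: eqP => // ->; rewrite negbK. Qed.

Lemma flip_comm s x y : flip (flip s x) y = flip (flip s y) x.
Proof. by apply/funext => z; rewrite /flip; case: eqP => [->|_]; case: eqP => // ->. Qed.

Lemma spin_flip s x y : spin R (flip s x) y = if y == x then - spin R s y else spin R s y.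
Proof. by rewrite /spin /flip; case: eqP => // _; case: (s y); rewrite ?opprK. Qed.

Lemma normr_spin s x : `|spin R s x| = 1.
Proof. by rewrite /spin; case: ifP => _; rewrite ?normrN1 ?normr1. Qed.

Lemma DeltaHE x s : DeltaH omega x s =
  - 2 * spin R s x * \sum_(y <- nbr x) omega [fset x; y]%fset * spin R s y.
Proof. by rewrite /DeltaH fsbig_finite //; exact: finite_nn. Qed.

Lemma DeltaH_local x s t : s x = t x -> (forall y, adj x y -> s y = t y) ->
  DeltaH omega x s = DeltaH omega x t.
Proof.
move=> h1 h2; rewrite !DeltaHE /spin h1; congr (_ * _).
by apply: eq_big_seq => y; rewrite in_nbr => /h2 ->.
Qed.

Lemma DeltaH_flip x s : DeltaH omega x (flip s x) = - DeltaH omega x s.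
Proof.
rewrite !DeltaHE spin_flip eqxx mulrN mulNr; congr (- (_ * _)).
apply: eq_big_seq => y; rewrite in_nbr spin_flip; case: eqP => // -> h.
by have := adj_irr x; rewrite h.
Qed.

Lemma J_ge0 : (0 < d)%N -> 0 <= J.
Proof.
move=> d0; pose i0 := Ordinal d0; pose e : site d := delta_mx 0 i0.
apply: le_trans (omega_le (_ : nn 0 e)); first exact: normr_ge0.
rewrite /nn (bigD1 i0) //= big1 => [|i ii].
  by rewrite !mxE !eqxx /= sub0r sqrrN expr1n addr0.
by rewrite !mxE eqxx (negPf ii) /= subr0 expr0n.
Qed.

Lemma normr_DeltaH x s : 0 <= J -> `|DeltaH omega x s| <= 4 * d%:R * J.
Proof.
move=> J0; rewrite DeltaHE !normrM normr_spin mulr1 normrN normr_nat.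
have -> : 4 * d%:R * J = 2 * ((2 * d)%:R * J) by rewrite natrM; ring.
rewrite ler_wpM2l //; apply: le_trans (ler_norm_sum _ _ _) _.
apply: (@le_trans _ _ (\sum_(y <- nbr x) J)).
  rewrite big_seq [leRHS]big_seq; apply: ler_sum => y; rewrite in_nbr => /adjP h.
  by rewrite normrM normr_spin mulr1 omega_le.
rewrite big_const_seq count_predT iter_addr_0 -[J *+ _]mulr_natl ler_wpM2r // ler_nat.
exact: card_nbr.
Qed.

(** Only the bond between x and y contributes, and its term changes sign. *)
Lemma DeltaH_flip_nbr x y s : adj x y ->
  `|DeltaH omega y s - DeltaH omega y (flip s x)| <= 4 * J.
Proof.
move=> axy; have yx : y != x by apply: contraTN axy => /eqP ->; exact: adj_irr.
rewrite !DeltaHE spin_flip (negPf yx) -mulrBr -sumrB normrM normrM normr_spin mulr1 normrN normr_nat.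
have -> : 4 * J = 2 * (2 * J) by ring.
rewrite ler_wpM2l // (big_fsetD1 x) /=; last by rewrite in_nbr adjC.
rewrite big1_seq ?addr0 => [|z]; last first.
  by rewrite /= in_fsetD1 => /andP[zx _]; rewrite spin_flip (negPf zx) subrr.
rewrite spin_flip eqxx mulrN opprK -mulr2n -mulrnAr normrM -[_ *+ 2]mulr_natl normrM normr_spin mulr1 normr_nat mulrC.
by rewrite ler_wpM2l // omega_le //; apply/adjP; rewrite adjC.
Qed.

Definition logistic (t : R) : R := (1 + expR (- t))^-1.

(** With v = exp(-t) the derivative is v / (1 + v)^2, at most 1/4 because (1 - v)^2 >= 0. *)
Lemma logistic_lipschitz (t u : R) : `|logistic t - logistic u| <= `|t - u| / 4.
Proof.
wlog tu : t u / u <= t.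
  by move=> h; have [/h //|/ltW/h] := leP u t; rewrite distrC (distrC u).
have der (v : R) : is_derive v 1 logistic ((1 + expR (- v)) ^- 2 * expR (- v)).
  have p : 1 + expR (- v) != 0 by rewrite gt_eqF // addr_gt0 ?expR_gt0.
  rewrite /logistic; apply: is_derive_eq.
  by rewrite /GRing.scale /=; ring.
have cont : {within `[u, t], continuous logistic}.
  by apply: derivable_within_continuous => v _; have [] := der v.
have [c _ ->] := MVT_segment tu (fun v _ => der v) cont.
rewrite normrM mulrC ler_wpM2l ?normr_ge0 // ger0_norm; last first.
  by rewrite mulr_ge0 ?expR_ge0 // invr_ge0 exprn_ge0 // addr_ge0 // expR_ge0.
rewrite mulrC ler_pdivrMr ?exprn_gt0 ?addr_gt0 ?expR_gt0 //.
have := sqr_ge0 (1 - expR (- c)); lra.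
Qed.

Local Notation w := (rate beta omega).

Lemma rateE x s : w x s = logistic (beta * DeltaH omega x s).
Proof. by rewrite /rate /logistic mulNr. Qed.

Lemma rate_gt0 x s : 0 < w x s.
Proof. by rewrite invr_gt0 addr_gt0 ?expR_gt0. Qed.

(** The rate at s is the conditional probability of the flipped configuration given the spins off x,
    so the two rates sum to 1. This is what makes D_x idempotent. *)
Lemma rate_flip x s : w x s + w x (flip s x) = 1.
Proof.
rewrite /rate DeltaH_flip mulrNN mulNr expRN; set u := expR _.
have u0 : 0 < u by exact: expR_gt0.
have -> : 1 + u^-1 = (1 + u) / u by field; rewrite gt_eqF.
by field; rewrite !gt_eqF // addr_gt0.
Qed.

Lemma rate_local x s t : s x = t x -> (forall y, adj x y -> s y = t y) -> w x s = w x t.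
Proof. by move=> h1 h2; rewrite /rate (DeltaH_local h1 h2). Qed.

Lemma rate_flip_far x y s : x != y -> ~~ adj x y -> w y (flip s x) = w y s.
Proof.
move=> xy a; apply: rate_local => [|z az]; rewrite /flip; case: eqP => // e.
  by rewrite e eqxx in xy.
by rewrite e adjC (negPf a) in az.
Qed.

(** Write the rates as 1/(1 + v) and 1/(1 + u), with u <= e^a and 1 <= e^a v. Comparing the summands
    crosswise gives 1 + u <= e^a (1 + v), with a single factor e^a. *)
Lemma rate_le x y s t : 0 <= J -> w x s <= expR (4 * d%:R * J * beta) * w y t.
Proof.
move=> J0; rewrite /rate.
set a := 4 * d%:R * J * beta; have a0 : 0 <= a by rewrite !mulr_ge0.
have hb z v : `|- beta * DeltaH omega z v| <= a.
  rewrite normrM normrN (ger0_norm beta_ge0) /a [leRHS]mulrC ler_wpM2l //; exact: normr_DeltaH.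
have := hb x s; have := hb y t; rewrite !ler_norml => /andP[_ h1] /andP[h2 _].
have e1 : expR (- beta * DeltaH omega y t) <= expR a by rewrite ler_expR.
have e2 : (expR a)^-1 <= expR (- beta * DeltaH omega x s) by rewrite -expRN ler_expR.
set u := expR (- beta * DeltaH omega y t) in e1 *; set v := expR (_ * DeltaH omega x s) in e2 *.
have u0 : 0 < u by exact: expR_gt0.
have v0 : 0 < v by exact: expR_gt0.
have A0 : 0 < expR a by exact: expR_gt0.
rewrite -[leLHS]mul1r ler_pdivrMr ?addr_gt0 // mulrAC ler_pdivlMr ?addr_gt0 //.
have : 1 <= expR a * v by rewrite -ler_pdivrMl // mulr1.
lra.
Qed.

(** The change 4 J of the energy difference meets the Lipschitz constant 1/4, leaving exactly beta
    J; this fixes the linear coefficient of the final bound. *)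
Lemma rate_flip_nbr x y s : adj x y -> `|w y s - w y (flip s x)| <= beta * J.
Proof.
move=> a; rewrite !rateE; apply: le_trans (logistic_lipschitz _ _) _.
rewrite -mulrBr normrM ger0_norm //; have := ler_wpM2l beta_ge0 (DeltaH_flip_nbr s a); lra.
Qed.

Definition Dop x (f : config d -> R[i]) : config d -> R[i] :=
  fun s => (w x s)%:C * (f s - f (flip s x)).

Lemma Dop_lin x a f g : Dop x (a *: f + g) = a *: Dop x f + Dop x g.
Proof.
apply/funext => s; rewrite -[RHS]/(a * Dop x f s + Dop x g s) /Dop.
rewrite -[(_ + _) s]/(a * f s + g s) -[(_ + _) (flip s x)]/(a * f (flip s x) + g (flip s x)); ring.
Qed.

Lemma rate_flipC x s : (w x (flip s x))%:C = 1 - (w x s)%:C :> R[i].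
Proof. by rewrite -[1]/((1 : R)%:C) -(rate_flip x s) rmorphD addrAC subrr add0r. Qed.

Lemma Dop_idem x f : Dop x (Dop x f) = Dop x f.
Proof.
apply/funext => s; rewrite /Dop flipK.
rewrite rate_flipC.
have key (a b c : R[i]) : a * (a * (b - c) - (1 - a) * (c - b)) = a * (b - c) by ring.
exact: key.
Qed.

Lemma Dop_comm x y f : x != y -> ~~ adj x y -> Dop x (Dop y f) = Dop y (Dop x f).
Proof.
move=> xy a; apply/funext => s; rewrite /Dop.
have a' : ~~ adj y x by rewrite adjC.
have yx : y != x by rewrite eq_sym.
rewrite (rate_flip_far s xy a) (rate_flip_far s yx a') (flip_comm s x y).
have key (a1 a2 a3 a4 a5 a6 : R[i]) :
  a1 * (a2 * (a3 - a5) - a2 * (a4 - a6)) = a2 * (a1 * (a3 - a4) - a1 * (a5 - a6)) by ring.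
exact: key.
Qed.

(** f - D_x f is the conditional expectation E_x f, an average over the spin at x. *)
Lemma Dop_inv x f : let g := f - Dop x f in forall s, g (flip s x) = g s.
Proof.
move=> g s; rewrite /g -[(_ - _) (flip s x)]/(f (flip s x) - Dop x f (flip s x)).
rewrite -[(_ - _) s]/(f s - Dop x f s) /Dop flipK rate_flipC.
have key (a b c : R[i]) : b - (1 - a) * (b - c) = c - a * (c - b) by ring.
exact: key.
Qed.

(** Since g = E_x f is invariant under the flip at x, D_x D_y g differs from D_y g only in its
    prefactor: w_x times the variation of w_y under the flip, instead of w_y. *)
Lemma Dop_adj_pointwise x y f s : 0 <= J -> adj x y ->
  normc (Dop x (Dop y (f - Dop x f)) s) <=
  beta * J * expR (4 * d%:R * J * beta) * normc (Dop y (f - Dop x f) s).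
Proof.
move=> J0 a; set g := f - Dop x f; have gi := Dop_inv x f : forall s, g (flip s x) = g s.
have -> : Dop x (Dop y g) s = (w x s)%:C * (w y s - w y (flip s x))%:C * (g s - g (flip s y)).
  rewrite /Dop gi flip_comm gi rmorphB.
  have key (a1 a2 a3 a4 a5 : R[i]) :
    a1 * (a2 * (a4 - a5) - a3 * (a4 - a5)) = a1 * (a2 - a3) * (a4 - a5) by ring.
  exact: key.
have e1 (p q : R) (z : R[i]) : normc (p%:C * q%:C * z) = `|p| * `|q| * normc z.
  by rewrite !normcM !normcR.
have e2 (q : R) (z : R[i]) : 0 <= q -> normc (q%:C * z) = q * normc z.
  by move=> q0; rewrite normcM normcR ger0_norm.
have wx := ltW (rate_gt0 x s); have wy := ltW (rate_gt0 y s).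
rewrite e1 (e2 (w y s) (g s - g (flip s y)) wy) mulrA (ger0_norm wx).
apply: ler_wpM2r; first exact: normc_ge0.
have h1 := rate_flip_nbr s a; have h2 := rate_le x y s s J0.
have e3 (p q r t u : R) : q * p <= r * (t * u) -> p * q <= r * t * u.
  by rewrite mulrA [q * p]mulrC.
exact: e3 (ler_pM (normr_ge0 _) wx h1 h2).
Qed.

Definition supported (L : {fset site d}) (f : config d -> R[i]) :=
  forall s t, (forall x, x \in L -> s x = t x) -> f s = f t.

Lemma supportedW (L L' : {fset site d}) f : {subset L <= L'} -> supported L f -> supported L' f.
Proof. by move=> sub h s t e; apply: h => x /sub; exact: e. Qed.

Lemma Dop_supported x L L' f : x \in L' -> {subset nbr x <= L'} -> {subset L <= L'} ->
  supported L f -> supported L' (Dop x f).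
Proof.
move=> xL nL sub h s t e; rewrite /Dop.
have -> : w x s = w x t by apply: rate_local => [|y]; [exact: e|rewrite -in_nbr => /nL; exact: e].
congr (_ * (_ - _)); apply: h => y /sub yL; first exact: e.
by rewrite /flip; case: eqP => // _; rewrite e.
Qed.

Lemma Dop_out x L f : x \notin L -> supported L f -> Dop x f = 0.
Proof.
move=> xL h; apply/funext => s; rewrite /Dop (h (flip s x) s) ?subrr ?mulr0 // => y yL.
by rewrite /flip; case: eqP => // e; move: xL; rewrite -e yL.
Qed.

Lemma cylinder_Dop x f : cylinder f -> cylinder (Dop x f).
Proof.
move=> [L hL]; exists (x |` (nbr x `|` L))%fset; apply: Dop_supported hL.
- by rewrite !inE eqxx.
- by move=> y; rewrite !inE => ->; rewrite orbT.
- by move=> y; rewrite !inE => ->; rewrite !orbT.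
Qed.

Lemma cylinder0 : cylinder (0 : config d -> R[i]).
Proof. by exists fset0. Qed.

Lemma cylinderD (f g : config d -> R[i]) : cylinder f -> cylinder g -> cylinder (f + g).
Proof.
move=> [L hL] [L' hL']; exists (L `|` L')%fset => s t e.
rewrite -[(f + g) s]/(f s + g s) (hL s t) ?(hL' s t) // => x xL; apply: e; rewrite inE xL ?orbT //.
Qed.

Lemma cylinderZ a (f : config d -> R[i]) : cylinder f -> cylinder (a *: f).
Proof. by move=> [L hL]; exists L => s t e; rewrite /GRing.scale /= (hL s t e). Qed.

Lemma pregeneratorE L S f : supported L f -> {subset L <= S} ->
  pregenerator beta omega f = \sum_(x <- S : {fset site d}) Dop x f.
Proof.
move=> hL LS; apply/funext => s; rewrite /pregenerator fct_sumE.
apply: fsbigTE => x xS.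
by have := Dop_out (contra (LS x) xS) hL => /(congr1 (fun g => g s)).
Qed.

End Rates.

Section Cylinders.
Variables (R : realType) (d : nat) (mu : probability (config d) R).
Implicit Types (L : {fset site d}) (s t : config d).

Definition loc L s : {ffun L -> bool} := [ffun x => s (val x)].

(** The value [false] outside [L] is an arbitrary extension, invisible to functions supported on
    [L]. *)
Definition ext L (eta : {ffun L -> bool}) : config d :=
  fun y => if insub y is Some u then eta u else false.

Lemma ext_loc L s x : x \in L -> ext (loc L s) x = s x.
Proof. by move=> xL; rewrite /ext insubT ffunE. Qed.

Lemma loc_eq L s t : (forall x, x \in L -> s x = t x) -> loc L s = loc L t.
Proof. by move=> e; apply/ffunP => x; rewrite !ffunE; apply: e; exact: valP. Qed.

Definition cyl_set L (eta : {ffun L -> bool}) : set (config d) := [set s | loc L s = eta].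

Definition cyl_indic L (eta : {ffun L -> bool}) : config d -> R[i] := toC \1_(cyl_set eta).

Lemma cyl_indicE L (eta : {ffun L -> bool}) s : cyl_indic eta s = (loc L s == eta)%:R.
Proof.
rewrite /cyl_indic /toC indicE /cyl_set; case: eqP => h.
  by rewrite mem_set.
by rewrite memNset.
Qed.

Lemma measurable_coordinate x b : measurable [set s : config d | s x = b].
Proof. by apply: sub_sigma_algebra; exists x, b. Qed.

Lemma measurable_cyl_set L (eta : {ffun L -> bool}) : measurable (cyl_set eta).
Proof.
have -> : cyl_set eta = \bigcap_(x in [set: L]) [set s : config d | s (val x) = eta x].
  apply/seteqP; split => [s /= <- x _|s h]; first by rewrite /= ffunE.
  by apply/ffunP => x; rewrite ffunE; exact: (h x I).
apply: fin_bigcap_measurable; first exact: finite_finset.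
by move=> x _; exact: measurable_coordinate.
Qed.

Lemma supported_expand L (f : config d -> R[i]) : supported L f ->
  f = \sum_(eta : {ffun L -> bool}) f (ext eta) *: cyl_indic eta.
Proof.
move=> h; apply/funext => s; rewrite fct_sumE (bigD1 (loc L s)) //= big1 => [|eta ne].
  rewrite addr0 -[(_ *: _) s]/(f (ext (loc L s)) * cyl_indic (loc L s) s) cyl_indicE eqxx mulr1; apply: h => x xL.
  by rewrite ext_loc.
by rewrite -[(_ *: _) s]/(f (ext eta) * cyl_indic eta s) cyl_indicE eq_sym (negPf ne) mulr0.
Qed.

Lemma supported_cyl_indic L (eta : {ffun L -> bool}) : supported L (cyl_indic eta).
Proof. by move=> s t e; rewrite !cyl_indicE (loc_eq e). Qed.

Lemma L2_indic A : measurable A -> L2 mu (toC (\1_A : config d -> R)).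
Proof.
move=> mA; apply: L2_toC; apply: (@sqint_bounded _ _ _ _ _ 1); first exact: measurable_indic.
by move=> x; rewrite indicE; case: (_ \in _) => /=; rewrite ?normr0 ?normr1.
Qed.

Lemma cylinder_L2 (f : config d -> R[i]) : cylinder f -> L2 mu f.
Proof.
move=> [L hL]; rewrite (supported_expand hL).
apply: (prehilbert_sum (L2_prehilbert mu)) => eta _; apply: L2Z.
by apply: L2_indic; exact: measurable_cyl_set.
Qed.

Lemma L2_Cintegrable1 (f : config d -> R[i]) : L2 mu f -> Cintegrable mu setT f.
Proof.
move=> Hf; have H1 : L2 mu (fun=> 1) by apply/L2E; split; exact: sqint_cst.
have := L2_Cintegrable H1 Hf; congr (Cintegrable _ _ _).
by apply/funext => s; rewrite conjc1 mul1r.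
Qed.

Definition cylinder_set (A : set (config d)) := exists L, forall s t,
  (forall x, x \in L -> s x = t x) -> A s -> A t.

Lemma cylinder_set_indic A : cylinder_set A -> cylinder (toC (\1_A : config d -> R)).
Proof.
move=> [L hL]; exists L => s t e; rewrite /toC !indicE; congr ((nat_of_bool _)%:R%:C).
by apply/idP/idP; rewrite !inE; apply: hL => // x /e.
Qed.

Lemma measurable_cylinder_set A : cylinder_set A -> measurable A.
Proof.
move=> hA; have /cylinder_L2/L2E[[mf _] _] := cylinder_set_indic hA.
have -> : A = [set: config d] `&` (fun s => complex.Re (toC (\1_A : config d -> R) s)) @^-1` [set 1].
  rewrite setTI; apply/seteqP; split => s /=; rewrite indicE.
    by move=> As; rewrite mem_set.
  by case: (boolP (s \in A)); rewrite ?inE //= => _ /eqP; rewrite eq_sym oner_eq0.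
exact: mf.
Qed.

(** The cylinder sets form an algebra containing the coordinate sets, which generate the
    sigma-algebra; hence every measurable set is approximable by them. *)
Lemma sdense_cylinder : sdense (L2 mu) (inner mu) (@cylinder R d).
Proof.
apply: sdense_L2; [exact: cylinder_L2|exact: cylinder0|exact: cylinderD|exact: cylinderZ|].
move=> A mA; apply: approx_by_indic => //.
have S : sigma_algebra setT (approximable mu cylinder_set).
  apply: approximable_sigma_algebra.
  - exact: measurable_cylinder_set.
  - by exists fset0.
  - move=> B [L hL]; exists L => s t e nB Bt; apply: nB; apply: hL Bt => x xL; by rewrite e.
  - move=> B C [L hL] [L' hL']; exists (L `|` L')%fset => s t e [Bs|Cs].
      by left; apply: hL Bs => x xL; apply: e; rewrite inE xL.
    by right; apply: hL' Cs => x xL; apply: e; rewrite inE xL orbT.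
have G : @coordinate_sets d `<=` approximable mu cylinder_set.
  move=> _ [x [b ->]]; split; first exact: measurable_coordinate.
  move=> e e0; exists [set s : config d | s x = b].
    exists [fset x]%fset => s t h /= <-; apply/esym/h; by rewrite inE.
  by rewrite /sdiff setDv setU0 measure0 lte_fin.
have [_ h] := smallest_sub S G mA.
move=> e /h[C AC hC]; exists C; split => //; first exact: measurable_cylinder_set.
exact: cylinder_set_indic.
Qed.

Lemma cylinder_prehilbert : prehilbert (@cylinder R d) (inner mu).
Proof.
have hH := L2_prehilbert mu; have K := cylinder_L2.
split; [exact: cylinderD|exact: cylinderZ|exact: cylinder0|..].
- by move=> f g h /K Hf /K Hg /K Hh; rewrite (ipDr hH).
- by move=> a f g /K Hf /K Hg; rewrite (ipZr hH).
- by move=> f g /K Hf /K Hg; rewrite (ip_conj hH Hf).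
- by move=> f /K Hf; exact: (ip_ge0 hH).
Qed.

Lemma nrm_le_pointwise (f g : config d -> R[i]) (c : R) : 0 <= c -> L2 mu f -> L2 mu g ->
  (forall s, normc (f s) <= c * normc (g s)) -> nrm (inner mu) f <= c * nrm (inner mu) g.
Proof.
move=> c0 Hf Hg h; rewrite -(@ler_pXn2r _ 2) ?nnegrE ?mulr_ge0 ?nrm_ge0 //.
rewrite exprMn !sqr_nrm_inner // -RintegralZl //; last exact: integrable_sqr_normc.
apply: le_Rintegral => //; first exact: integrable_sqr_normc.
  have := integrableZl measurableT (c ^+ 2) (integrable_sqr_normc Hg).
  by apply: eq_integrable.
move=> s _; rewrite -exprMn; apply: lerXn2r; rewrite ?nnegrE ?mulr_ge0 ?normc_ge0 //.
Qed.

End Cylinders.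

(** * Consequences of the Dobrushin-Lanford-Ruelle equations *)

Section DLR.
Variables (R : realType) (d : nat) (beta : R) (omega : {fset site d} -> R).
Variable mu : probability (config d) R.
Hypothesis hmu : gibbs beta omega mu.
Local Notation w := (rate beta omega).
Local Notation D := (@Dop R d beta omega).

(** Each bond at x occurs as two ordered pairs, which cancels the factor 1/2 of the Hamiltonian;
    [DeltaH] carries a further factor 2 because it compares opposite spins. *)
Lemma energy_site x (s : config d) : energy omega [fset x]%fset s = DeltaH omega x s / 2.
Proof.
rewrite /energy DeltaHE.
set F := fun p : site d * site d => spin R s p.1 * omega [fset p.1; p.2]%fset * spin R s p.2.
have xn y : y \in nbr x -> y != x.
  by rewrite in_nbr => h; apply: contraTneq h => ->; exact: adj_irr.
rewrite (fsbig_fwiden ([seq (x, y) | y <- nbr x] ++ [seq (y, x) | y <- nbr x])).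
- rewrite big_cat !big_map /=.
  have -> : \sum_(y <- nbr x) spin R s y * omega [fset y; x]%fset * spin R s x =
     \sum_(y <- nbr x) spin R s x * omega [fset x; y]%fset * spin R s y.
    by apply: eq_bigr => y _; rewrite fsetUC; ring.
  have -> : \sum_(y <- nbr x) spin R s x * omega [fset x; y]%fset * spin R s y =
     spin R s x * \sum_(y <- nbr x) omega [fset x; y]%fset * spin R s y.
    by rewrite mulr_sumr; apply: eq_bigr => y _; rewrite mulrA.
  by field.
- move=> [y z] /= [yz]; rewrite !inE mem_cat => -[/eqP e|/eqP e]; apply/orP.
    by left; rewrite e; apply: map_f; rewrite in_nbr -e; exact/adjP.
  by right; rewrite e; apply: (map_f (fun y => (y, x))); rewrite in_nbr adjC -e; exact/adjP.
- rewrite cat_uniq !map_inj_uniq ?fset_uniq /= ?andbT; last 2 first.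
    by move=> a b [].
    by move=> a b [].
  apply/hasPn => _ /mapP[y /xn yx ->]; apply/mapP => -[z zn [e1 e2]].
  by rewrite e1 eqxx in yx.
- move=> [y z] /= [h nP]; exfalso; apply: nP.
  move: h; rewrite mem_cat => /orP[/mapP[y' + [-> ->]]|/mapP[y' + [-> ->]]]; rewrite in_nbr => h.
    by split; [exact/adjP|left; rewrite inE].
  by split; [apply/adjP; rewrite adjC|right; rewrite inE].
Qed.

Lemma same_outside_site x (s : config d) :
  same_outside [fset x]%fset s = [set` [:: s; flip s x]].
Proof.
apply/seteqP; split => t /=; rewrite !inE => h.
  have [e|ne] := eqVneq (t x) (s x).
    apply/orP; left; apply/eqP/funext => y; have [->//|yx] := eqVneq y x.
    by apply: h; rewrite inE.
  apply/orP; right; apply/eqP/funext => y; rewrite /flip; case: eqVneq => [->|yx].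
    by move: ne; case: (t x); case: (s x).
  by apply: h; rewrite inE.
by move=> y; rewrite inE => yx; move: h => /orP[/eqP ->//|/eqP ->]; rewrite /flip (negPf yx).
Qed.

(** The right-hand side is E_x = 1 - D_x applied to the indicator of A: the heat bath resamples the
    spin at x from the single-site Gibbs specification. *)
Lemma specification_site x (s : config d) (A : set (config d)) :
  specification beta omega [fset x]%fset s A =
  \1_A s - w x s * (\1_A s - \1_A (flip s x)).
Proof.
have sne : flip s x != s.
  by apply/eqP => /(congr1 (fun t => t x)); rewrite /flip eqxx; case: (s x).
have u : uniq [:: s; flip s x] by rewrite /= inE eq_sym sne.
rewrite /specification same_outside_site.
set b := boltzmann beta omega [fset x]%fset.
have -> : \sum_(t \in [set` [:: s; flip s x]] `&` A) b t = \1_A s * b s + \1_A (flip s x) * b (flip s x).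
  rewrite fsbig_mkcondr (fsbig_fwiden [:: s; flip s x]) //.
    rewrite !big_cons big_nil /= addr0 !indicE.
    by case: (s \in A); case: (flip s x \in A); rewrite ?mul1r ?mul0r.
  by rewrite setDv; exact: sub0set.
have -> : \sum_(t \in [set` [:: s; flip s x]]) b t = b s + b (flip s x).
  rewrite (fsbig_fwiden [:: s; flip s x]) //; last by rewrite setDv; exact: sub0set.
  by rewrite !big_cons big_nil /= addr0.
rewrite /b /boltzmann !energy_site DeltaH_flip /rate.
have -> : - beta * (- DeltaH omega x s / 2) = - (- beta * (DeltaH omega x s / 2)) by ring.
have -> : - beta * DeltaH omega x s = - beta * (DeltaH omega x s / 2) + - beta * (DeltaH omega x s / 2) by field.
rewrite expRN expRD; set p := expR _.
have p0 : 0 < p by exact: expR_gt0.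
field; rewrite !gt_eqF // addr_gt0 // mulr_gt0 //.
Qed.

(** The single-site DLR equation says that the mean of E_x applied to an indicator equals the mean
    of the indicator. *)
Lemma Cint_Dop_indic x (L : {fset site d}) (eta : {ffun L -> bool}) :
  Cintegral mu setT (D x (cyl_indic R eta)) = 0.
Proof.
set A := cyl_set eta; have mA : measurable A := measurable_cyl_set eta.
have cI : cylinder (cyl_indic R eta) by exists L; exact: supported_cyl_indic.
have LI := cylinder_L2 mu cI.
have LD := cylinder_L2 mu (cylinder_Dop beta omega x cI).
have [i1 _] := L2_Cintegrable1 LI; have [i2 _] := L2_Cintegrable1 LD.
have DE s : D x (cyl_indic R eta) s = (w x s * (\1_A s - \1_A (flip s x)))%:C.
  by rewrite /Dop /cyl_indic /toC -rmorphB -rmorphM.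
have e0 : \int[mu]_s complex.Re (D x (cyl_indic R eta) s) = 0.
  have h := hmu [fset x]%fset mA.
  have h1 : mu A = (\int[mu]_s (complex.Re (cyl_indic R eta s))%:E)%E.
    by rewrite -[in LHS](setIT A) -integral_indic.
  have : (\int[mu]_s (complex.Re (cyl_indic R eta s))%:E =
     \int[mu]_s (complex.Re (cyl_indic R eta s) - complex.Re (D x (cyl_indic R eta) s))%:E)%E.
    rewrite -h1 h; apply: eq_integral => s _; rewrite specification_site DE //.
  move=> /(congr1 fine); rewrite -[RHS]/(\int[mu]_s (complex.Re (cyl_indic R eta s) - complex.Re (D x (cyl_indic R eta) s))).
  rewrite RintegralB // => /eqP; rewrite -[fine _]/(\int[mu]_s (complex.Re (cyl_indic R eta s))).
  by rewrite -subr_eq0 opprB addrC subrK => /eqP.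
rewrite /Cintegral e0; congr Complex.
have -> : (fun s => complex.Im (D x (cyl_indic R eta) s)) = cst 0.
  by apply/funext => s; rewrite DE.
by rewrite /Rintegral integral0.
Qed.

Lemma DopZ x a (f : config d -> R[i]) : D x (a *: f) = a *: D x f.
Proof.
have key (u v p q : R[i]) : u * (v * p - v * q) = v * (u * (p - q)) by ring.
by apply/funext => s; rewrite /GRing.scale /= /Dop key.
Qed.

Lemma Dop_sum x (I : Type) (r : seq I) (P : pred I) (F : I -> config d -> R[i]) :
  D x (\sum_(i <- r | P i) F i) = \sum_(i <- r | P i) D x (F i).
Proof.
have z : D x 0 = 0 by apply/funext => s; rewrite /Dop subrr mulr0.
apply: (big_morph _ _ z) => f g.
by rewrite -[f]scale1r Dop_lin !scale1r.
Qed.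

Lemma Cint_Dop x (F : config d -> R[i]) : cylinder F -> Cintegral mu setT (D x F) = 0.
Proof.
move=> [L hL]; rewrite (supported_expand hL) Dop_sum.
have c eta : Cintegrable mu setT (D x (F (ext eta) *: cyl_indic R (L := L) eta)).
  apply: L2_Cintegrable1; apply: cylinder_L2; apply: cylinder_Dop; apply: cylinderZ.
  by exists L; exact: supported_cyl_indic.
have -> : \sum_(eta : {ffun L -> bool}) D x (F (ext eta) *: cyl_indic R eta) =
   (fun s => \sum_(eta : {ffun L -> bool}) D x (F (ext eta) *: cyl_indic R eta) s).
  by apply/funext => s; rewrite fct_sumE.
rewrite Cintegral_sum // big1 // => eta _; rewrite DopZ.
rewrite -[Cintegral _ _ _]/(Cintegral mu setT (fun s => F (ext eta) * D x (cyl_indic R eta) s)).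
rewrite CintegralZ // ?Cint_Dop_indic ?mulr0 //.
apply: L2_Cintegrable1; apply: cylinder_L2; apply: cylinder_Dop.
by exists L; exact: supported_cyl_indic.
Qed.

(** The difference of the two integrands is D_x F for F(s) = conj(f(s)) g(flip s x), and D_x F has
    mean 0. *)
Lemma Dop_sym x (f g : config d -> R[i]) : cylinder f -> cylinder g ->
  inner mu (D x f) g = inner mu f (D x g).
Proof.
move=> cf cg; have Lf := cylinder_L2 mu cf; have Lg := cylinder_L2 mu cg.
have LDf := cylinder_L2 mu (cylinder_Dop beta omega x cf).
have LDg := cylinder_L2 mu (cylinder_Dop beta omega x cg).
pose F : config d -> R[i] := fun s => (f s)^*%C * g (flip s x).
have cF : cylinder F.
  have [L hL] := cf; have [L' hL'] := cg; exists (L `|` L')%fset => s t e; rewrite /F.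
  rewrite (hL s t) => [|y yL]; last by apply: e; rewrite inE yL.
  rewrite (hL' (flip s x) (flip t x)) // => y yL; rewrite /flip.
  by case: eqP => _; rewrite e // inE yL orbT.
have i1 := L2_Cintegrable LDf Lg; have i2 := L2_Cintegrable Lf LDg.
have iF := L2_Cintegrable1 (cylinder_L2 mu (cylinder_Dop beta omega x cF)).
have key (a : R) (p q u v : R[i]) : (a%:C * (p - q))^*%C * u = p^*%C * (a%:C * (u - v)) + a%:C * (p^*%C * v - q^*%C * u).
  have cM (y z : R[i]) : (y * z)^*%C = y^*%C * z^*%C by exact: rmorphM.
  have cB (y z : R[i]) : (y - z)^*%C = y^*%C - z^*%C by exact: rmorphB.
  by rewrite cM cB conjc_real; ring.
rewrite /inner; have -> : (fun s => (D x f s)^*%C * g s) = (fun s => (f s)^*%C * D x g s + D x F s).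
  by apply/funext => s; rewrite /Dop /F flipK; exact: key.
by rewrite CintegralD // Cint_Dop // addr0.
Qed.

(* Conditioning at the single site x gives both spin values positive probability. *)
Lemma cyl_set_flip0 (L : {fset site d}) (x : L) (xi : {ffun L -> bool}) b :
  mu (cyl_set xi) = 0 -> mu (cyl_set [ffun y => if y == x then b else xi y]) = 0.
Proof.
move=> h0; have [e|ne] := eqVneq (xi x) b.
  have -> // : [ffun y => if y == x then b else xi y] = xi.
  by apply/ffunP => y; rewrite ffunE; case: eqP => // ->.
have bN : b = ~~ xi x by move: ne; case: (xi x); case: (b).
set xi' := [ffun y => _].
have cE (s : config d) : loc L (flip s (val x)) = xi <-> loc L s = xi'.
  split=> /ffunP h; apply/ffunP => y; have := h y; rewrite !ffunE /flip val_eqE;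
    case: eqP => // ->; rewrite bN.
    by move=> <-; rewrite negbK.
  by move=> ->; rewrite negbK.
have proj0 := Cint_Dop_indic (val x) xi.
pose g (xi : {ffun L -> bool}) : config d -> R[i] := fun s => (w (val x) s)%:C * cyl_indic R xi s.
have gE (zeta : {ffun L -> bool}) s : complex.Re (g zeta s) = w (val x) s * \1_(cyl_set zeta) s.
  by rewrite /g /cyl_indic /toC -rmorphM.
have Lg (zeta : {ffun L -> bool}) : L2 mu (g zeta).
  apply: cylinder_L2; exists (val x |` (nbr (val x) `|` L))%fset => s t e.
  rewrite /g (rate_local beta omega (x:=val x) (s:=s) (t:=t)) => [||y]; last 2 first.
  - by apply: e; rewrite !inE eqxx.
  - by rewrite -in_nbr => yn; apply: e; rewrite !inE yn orbT.
  congr (_ * _); apply: (supported_cyl_indic R zeta) => y yL.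
  by apply: e; rewrite !inE yL !orbT.
have ig (zeta : {ffun L -> bool}) : mu.-integrable setT (EFin \o (fun s => w (val x) s * \1_(cyl_set zeta) s)).
  by have [i _] := L2_Cintegrable1 (Lg zeta); apply: eq_integrable i => // s _; exact: (congr1 EFin (gE zeta s)).
have m1 : measurable (cyl_set xi) := measurable_cyl_set xi.
have m2 : measurable (cyl_set xi') := measurable_cyl_set xi'.
have DE s : complex.Re (D (val x) (cyl_indic R xi) s) =
    w (val x) s * \1_(cyl_set xi) s - w (val x) s * \1_(cyl_set xi') s.
  rewrite /Dop /cyl_indic /toC -rmorphB -rmorphM /= mulrBr !indicE; congr (_ - _ * (nat_of_bool _)%:R).
  by apply/idP/idP; rewrite !inE /= => /cE.
(* The mean of D_x of the indicator vanishes, so w_x has equal integrals over the two cylinders; one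
   integral is 0, and w_x > 0 makes the other cylinder null. *)
have I0 : \int[mu]_s (w (val x) s * \1_(cyl_set xi) s) = 0.
  rewrite /Rintegral (ae_eq_integral (cst 0)%E) ?integral0 //.
    by have /integrableP[] := ig xi.
  exists (cyl_set xi); split => // s /= h; apply: contrapT => ns; apply: h => _.
  by rewrite /= indicE memNset // mulr0.
have I1 : \int[mu]_s (w (val x) s * \1_(cyl_set xi') s) = 0.
  have : \int[mu]_s complex.Re (D (val x) (cyl_indic R xi) s) = 0 by move: proj0 => /(congr1 (@complex.Re R)).
  under eq_Rintegral do rewrite DE.
  by rewrite RintegralB // I0 sub0r => /eqP; rewrite oppr_eq0 => /eqP.
have : (\int[mu]_s `|(w (val x) s * \1_(cyl_set xi') s)%:E| = 0)%E.
  rewrite -[RHS]/(0%:E) -I1 /Rintegral fineK; last exact: (integrable_fin_num measurableT (ig _)).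
  apply: eq_integral => s _; rewrite gee0_abs // lee_fin mulr_ge0 //.
  exact/ltW/rate_gt0.
have mg : measurable_fun setT (EFin \o (fun s => w (val x) s * \1_(cyl_set xi') s)).
  by have /integrableP[] := ig xi'.
move=> /(ae_eq_integral_abs mu measurableT mg).1 [N [mN N0 hN]].
apply/negligibleP => //; exists N; split => // s xs; apply: hN => /= /(_ I) /eqP.
by rewrite indicE mem_set //= mulr1 eqe gt_eqF // rate_gt0.
Qed.

(** If one cylinder on [L] were null, changing its spins one site at a time would make all of them
    null, against total mass 1. Positivity allows the indicators to be normalised to an orthonormal
    basis. *)
Lemma cyl_set_gt0 (L : {fset site d}) (eta : {ffun L -> bool}) : (0 < mu (cyl_set eta))%E.
Proof.
rewrite lt_neqAle measure_ge0 andbT eq_sym; apply/eqP => h0.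
have all0 (zeta : {ffun L -> bool}) : mu (cyl_set zeta) = 0.
  have h (r : seq L) : mu (cyl_set [ffun y => if y \in r then zeta y else eta y]) = 0.
    elim: r => [|x r IH].
      by have -> : [ffun y => if y \in [::] then zeta y else eta y] = eta by apply/ffunP => y; rewrite ffunE.
    have := cyl_set_flip0 x (zeta x) IH; congr (mu (cyl_set _) = 0).
    by apply/ffunP => y; rewrite !ffunE inE; case: eqP => [->|].
  have := h (enum {: L}); congr (mu (cyl_set _) = 0).
  by apply/ffunP => y; rewrite ffunE mem_enum.
have : mu [set: config d] = 1%E := probability_setT mu.
have h1 : mu.-negligible (\bigcup_(zeta in [set: {ffun L -> bool}]) cyl_set zeta).
  rewrite -bigsetU_fset_set; last exact: finite_finset.
  elim/big_ind: _ => [|A B nA nB|zeta _]; [exact: negligible_set0|exact: negligibleU|].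
  by apply/negligibleP; [exact: measurable_cyl_set|exact: all0].
have e : [set: config d] = \bigcup_(zeta in [set: {ffun L -> bool}]) cyl_set zeta.
  by apply/seteqP; split => // s _; exists (loc L s).
rewrite -e in h1; rewrite (measure_negligible measurableT h1) => /eqP.
by rewrite eq_sym onee_eq0.
Qed.

End DLR.

(** * Finite-volume spectra *)

Section Eigenbasis.
Local Open Scope sesquilinear_scope.
Variables (R : realType) (V : lmodType R[i]) (H : set V) (ip : V -> V -> R[i]).
Hypothesis hH : prehilbert H ip.
Variables (n : nat) (b : 'I_n -> V) (T : V -> V).
Hypothesis bH : forall i, H (b i).
Hypothesis b_ortho : forall i j, ip (b i) (b j) = (i == j)%:R.
Hypothesis b_span : forall f, H f -> f = \sum_i ip (b i) f *: b i.
Hypothesis TH : forall f, H f -> H (T f).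
Hypothesis T_lin : forall a f g, T (a *: f + g) = a *: T f + T g.
Hypothesis T_sym : forall f g, H f -> H g -> ip (T f) g = ip f (T g).

Lemma linear_op_sum (x : 'I_n -> R[i]) (v : 'I_n -> V) : T (\sum_i x i *: v i) = \sum_i x i *: T (v i).
Proof.
have T0 : T 0 = 0.
  have := T_lin 1 0 0; rewrite !scale1r addr0 => /eqP; rewrite -subr_eq0 opprD addNKr oppr_eq0.
  by move=> /eqP.
elim/big_rec2: _ => [|i y1 y2 _ <-]; first exact: T0.
by rewrite T_lin.
Qed.

(** The spectral theorem for the Hermitian matrix of T in the basis [b]; the vectors [e i] are the
    columns of the conjugate transpose of the diagonalising unitary matrix. *)
Lemma hermitian_eigenbasis : exists (e : 'I_n -> V) (lam : 'I_n -> R),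
  [/\ forall i, H (e i), forall i j, ip (e i) (e j) = (i == j)%:R,
      forall i, T (e i) = (lam i)%:C *: e i &
      forall f, H f -> f = \sum_i ip (e i) f *: e i].
Proof.
pose A : 'M[R[i]]_n := \matrix_(i, j) ip (b i) (T (b j)).
have Aherm : A \is hermsymmx.
  apply/is_hermitianmxP; rewrite expr0 scale1r; apply/matrixP => i j; rewrite !mxE.
  by rewrite -(T_sym (bH i) (bH j)) (ip_conj hH (bH j) (TH (bH i))).
set P := spectralmx A; set D := spectral_diag A.
have PU : P *m P^t* = 1%:M by apply/unitarymxP; exact: spectral_unitarymx.
have PV : P^t* *m P = 1%:M by exact: mulmx1C.
have AE : A *m P^t* = P^t* *m diag_mx D.
  have /orthomx_spectralP := hermitian_normalmx Aherm.
  rewrite -/P -/D => ->.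
  have -> : invmx P = P^t* by rewrite -[LHS]mulmx1 -PU mulmxA mulVmx ?mul1mx // spectral_unit.
  by rewrite -!mulmxA PU mulmx1.
have Dreal i : D 0 i = (complex.Re (D 0 i))%:C.
  have /mxOverP/(_ 0 i) := hermitian_spectral_diag_real Aherm.
  by move=> /RRe_real h; exact: (esym h).
pose e i := \sum_j (P^t* j i) *: b j.
have He i : H (e i) by apply: (prehilbert_sum hH) => j _; exact: (prehilbertZ hH).
have coef (x : 'I_n -> R[i]) k : ip (b k) (\sum_j x j *: b j) = x k.
  rewrite (ip_sumr hH) // => [|j _]; last exact: (prehilbertZ hH).
  rewrite (bigD1 k) //= big1 => [|j jk]; rewrite (ipZr hH) // b_ortho.
    by rewrite eqxx mulr1 addr0.
  by rewrite eq_sym (negPf jk) mulr0.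
have ipe i f : H f -> ip (e i) f = \sum_j P i j * ip (b j) f.
  move=> Hf; rewrite (ip_conj hH Hf (He i)) (ip_sumr hH) // => [|j _]; last exact: (prehilbertZ hH).
  rewrite rmorph_sum; apply: eq_bigr => j _; rewrite (ipZr hH) // rmorphM !mxE /=.
  by rewrite conjcK -(ip_conj hH Hf (bH j)).
exists e, (fun i => complex.Re (D 0 i)); split.
- exact: He.
- move=> i k; rewrite ipe //; move/matrixP/(_ i k): PU; rewrite !mxE => <-.
  by apply: eq_bigr => j _; rewrite /e coef.
- move=> i; rewrite -Dreal [in LHS]/e linear_op_sum.
  have HT : H (\sum_j P^t* j i *: T (b j)).
    by apply: (prehilbert_sum hH) => j _; apply: (prehilbertZ hH); exact: TH.
  rewrite (b_span HT).
  rewrite scaler_sumr; apply: eq_bigr => k _; rewrite scalerA; congr (_ *: _).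
  rewrite (ip_sumr hH) // => [|j _]; last by apply: (prehilbertZ hH); exact: TH.
  move/matrixP/(_ k i): AE; rewrite mul_mx_diag !mxE => h.
  rewrite [RHS]mulrC -[RHS]h; apply: eq_bigr => j _.
  by rewrite (ipZr hH) ?mxE; [rewrite mulrC|exact: bH|apply: TH].
- move=> f Hf; rewrite [LHS](b_span Hf).
  have -> : \sum_i ip (e i) f *: e i = \sum_k (\sum_i P^t* k i * ip (e i) f) *: b k.
    under eq_bigr do rewrite scaler_sumr.
    rewrite exchange_big; apply: eq_bigr => k _; rewrite scaler_suml.
    by apply: eq_bigr => i _; rewrite scalerA mulrC.
  apply: eq_bigr => k _; congr (_ *: _).
  under eq_bigr do rewrite ipe // mulr_sumr.
  rewrite exchange_big /=.
  under eq_bigr do under eq_bigr do rewrite mulrA.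
  have PVE j : \sum_i P^t* k i * P i j = (k == j)%:R.
    by move/matrixP/(_ k j): PV; rewrite [LHS]mxE [RHS]mxE.
  under eq_bigr do rewrite -mulr_suml PVE.
  rewrite (bigD1 k) //= eqxx mul1r big1 ?addr0 // => j jk.
  by rewrite eq_sym (negPf jk) mul0r.
Qed.

End Eigenbasis.

Lemma dependent_choice2 (I : Type) (A B : I -> Type) (P : forall i, A i -> B i -> Prop) :
  (forall i, exists a b, P i a b) ->
  exists (f : forall i, A i) (g : forall i, B i), forall i, P i (f i) (g i).
Proof.
move=> h; pose f i := projT1 (cid (h i)); have hf i := projT2 (cid (h i)).
by exists f, (fun i => projT1 (cid (hf i))) => i; exact: projT2 (cid (hf i)).
Qed.

(** Restricts the lattice structure to the finite type of sites of a box, where the eigenvalue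
    estimates are available. *)
Lemma local_projections_comp (R : realType) (V : lmodType R[i]) (H : set V)
  (ip : V -> V -> R[i]) (X Y : eqType) (h : Y -> X) (D : X -> V -> V) (adj : rel X) (c : R) :
  injective h -> local_projections H ip D adj c ->
  local_projections H ip (fun y => D (h y)) (fun y z => adj (h y) (h z)) c.
Proof.
move=> hi hD; split.
- exact: lp_ge0 hD.
- by move=> y z; exact: (lp_adjC hD).
- by move=> y; exact: (lp_H hD).
- by move=> y; exact: (lp_lin hD).
- by move=> y; exact: (lp_idem hD).
- by move=> y; exact: (lp_sym hD).
- by move=> y z f; rewrite -(inj_eq hi); exact: (lp_comm hD).
- by move=> y z f; exact: (lp_adj hD).
Qed.

Section CylinderBasis.
Variables (R : realType) (d : nat) (mu : probability (config d) R).

Lemma supported_cylinder (L : {fset site d}) (f : config d -> R[i]) : supported L f -> cylinder f.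
Proof. by exists L. Qed.

Lemma supported_prehilbert (L : {fset site d}) : prehilbert (@supported R d L) (inner mu).
Proof.
have [_ _ _ h1 h2 h3 h4] := cylinder_prehilbert mu; have K := @supported_cylinder L.
split.
- by move=> f g hf hg s t e; rewrite -[LHS]/(f s + g s) (hf s t e) (hg s t e).
- by move=> a f hf s t e; rewrite -[LHS]/(a * f s) (hf s t e).
- by [].
- by move=> f g h /K Hf /K Hg /K Hh; exact: h1.
- by move=> a f g /K Hf /K Hg; exact: h2.
- by move=> f g /K Hf /K Hg; exact: h3.
- by move=> f /K Hf; exact: h4.
Qed.

Variable L : {fset site d}.
Local Notation mass eta := (fine (mu (cyl_set (L := L) eta))).

Lemma inner_cyl_indic (eta zeta : {ffun L -> bool}) :
  inner mu (cyl_indic R eta) (cyl_indic R zeta) = ((eta == zeta)%:R * mass eta)%:C.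
Proof.
have -> : inner mu (cyl_indic R eta) (cyl_indic R zeta) =
    Cintegral mu setT (fun s => ((eta == zeta)%:R * \1_(cyl_set eta) s)%:C).
  congr Cintegral; apply/funext => s; rewrite !cyl_indicE indicE.
  have key (a b : bool) : (a%:R : R[i])^*%C * b%:R = (b%:R * a%:R)%:C.
    by rewrite rmorphM !rmorph_nat mulrC.
  rewrite key; congr (_%:C); case: (eqVneq (loc L s) eta) => [e|ne].
    by rewrite mem_set // -e.
  by rewrite memNset ?mulr0 //; exact/eqP.
have m : measurable (cyl_set eta) := measurable_cyl_set eta.
rewrite /Cintegral /=; congr Complex; last by rewrite /Rintegral integral0.
case: eqP => _; last by rewrite mul0r; under eq_Rintegral do rewrite mul0r; rewrite /Rintegral integral0.
under eq_Rintegral do rewrite mul1r.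
by rewrite mul1r /Rintegral integral_indic // setIT.
Qed.

Hypothesis mass_gt0 : forall eta, 0 < mass eta.

Definition cyl_basis eta : config d -> R[i] := ((Num.sqrt (mass eta))^-1)%:C *: cyl_indic R eta.

Lemma supported_cyl_basis eta : supported L (cyl_basis eta).
Proof. exact: prehilbertZ (supported_prehilbert L) _ _ (supported_cyl_indic R eta). Qed.

Lemma inner_cyl_basis eta zeta : inner mu (cyl_basis eta) (cyl_basis zeta) = (eta == zeta)%:R.
Proof.
have S := supported_cyl_indic R (L := L); have hH := supported_prehilbert L.
rewrite (ipZl hH) //; last exact: supported_cyl_basis.
rewrite (ipZr hH) // inner_cyl_indic conjc_real; case: eqP => [->|_]; last by rewrite mul0r !mulr0.
rewrite mul1r -!rmorphM mulrA -expr2 exprVn sqr_sqrtr ?mulVf ?gt_eqF // ltW //.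
Qed.

Lemma cyl_basis_span f : supported L f -> f = \sum_eta inner mu (cyl_basis eta) f *: cyl_basis eta.
Proof.
move=> hf; have S := supported_cyl_indic R (L := L); have hH := supported_prehilbert L.
rewrite {1}(supported_expand hf); apply: eq_bigr => eta _.
have -> : inner mu (cyl_basis eta) f = ((Num.sqrt (mass eta))^-1)%:C * (f (ext eta) * (mass eta)%:C).
  rewrite (ipZl hH) // conjc_real; congr (_ * _).
  rewrite {1}(supported_expand hf) (ip_sumr hH) // => [|zeta _]; last exact: (prehilbertZ hH).
  rewrite (bigD1 eta) //= big1 => [|zeta ne]; rewrite (ipZr hH) // inner_cyl_indic.
    by rewrite eqxx mul1r addr0.
  by rewrite eq_sym (negPf ne) mul0r mulr0.
rewrite scalerA; congr (_ *: _).
have key (a b m : R[i]) : a * (b * m) * a = b * (a ^+ 2 * m) by ring.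
by rewrite key -rmorphXn -rmorphM exprVn sqr_sqrtr ?mulVf ?gt_eqF ?mulr1 // ltW.
Qed.

End CylinderBasis.

Section FiniteVolume.
Variables (R : realType) (d : nat) (beta J : R) (omega : {fset site d} -> R).
Hypothesis d_gt0 : (0 < d)%N.
Hypothesis beta_ge0 : 0 <= beta.
Hypothesis omega_le : forall x y, nn x y -> `|omega [fset x; y]%fset| <= J.
Variable mu : probability (config d) R.
Hypothesis hmu : gibbs beta omega mu.
Local Notation D := (Dop beta omega).
Local Notation k := ((2 * d)%:R : R).
Local Notation c := (beta * J * expR (4 * d%:R * J * beta)).
Local Notation N := (nrm (inner mu)).

Lemma lattice_projections : local_projections (@cylinder R d) (inner mu) D (@adj d) c.
Proof.
have J0 := J_ge0 omega_le d_gt0.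
have c0 : 0 <= c by rewrite mulr_ge0 ?expR_ge0 // mulr_ge0.
split.
- exact: c0.
- exact: adjC.
- exact: cylinder_Dop.
- exact: Dop_lin.
- exact: Dop_idem.
- by move=> *; exact: (Dop_sym hmu).
- by move=> *; exact: Dop_comm.
- move=> x y f Hf xy; have hH := cylinder_prehilbert mu.
  have c1 : cylinder (D y (f - D x f)).
    by apply: cylinder_Dop; apply: (prehilbertB hH) => //; exact: cylinder_Dop.
  apply: nrm_le_pointwise => //; first by apply: cylinder_L2; exact: cylinder_Dop.
    exact: cylinder_L2.
  by move=> s; exact: Dop_adj_pointwise.
Qed.

Definition Lbox n f := \sum_(x <- box d n) D x f.

Lemma box_sub n m : (n <= m)%N -> {subset box d n <= box d m}.
Proof. by move=> nm x; rewrite !in_box => /leq_trans; exact. Qed.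

(** Sites of box n are updated at rates that look at their neighbours, so the invariant space
    consists of functions of the spins in box n + 1. *)
Lemma Lbox_supported n f : supported (box d n.+1) f -> supported (box d n.+1) (Lbox n f).
Proof.
move=> hf; rewrite /Lbox big_seq_cond.
apply: (prehilbert_sum (supported_prehilbert mu (box d n.+1))) => x /andP[xn _].
apply: Dop_supported hf => //; first exact: box_sub xn.
move=> y; rewrite in_nbr !in_box in xn *; rewrite adjC => /lev_adj h.
exact: leq_trans h _.
Qed.

Lemma Lbox_lin n a f g : Lbox n (a *: f + g) = a *: Lbox n f + Lbox n g.
Proof. by rewrite /Lbox scaler_sumr -big_split; apply: eq_bigr => x _; exact: Dop_lin. Qed.

Lemma Lbox_sym n f g : cylinder f -> cylinder g ->
  inner mu (Lbox n f) g = inner mu f (Lbox n g).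
Proof.
move=> hf hg; have hH := cylinder_prehilbert mu; have DH x f := @cylinder_Dop R d beta omega x f.
rewrite (ip_conj hH) //; last by apply: (prehilbert_sum hH) => x _; exact: DH.
rewrite !(ip_sumr hH) //; try by move=> x _; exact: DH.
rewrite rmorph_sum; apply: eq_bigr => x _.
rewrite -(Dop_sym hmu) //; exact: (esym (ip_conj hH (DH x g hg) hf)).
Qed.

Lemma box_eigenbasis n : exists (e : 'I_#|{ffun box d n.+1 -> bool}| -> config d -> R[i])
    (lam : 'I_#|{ffun box d n.+1 -> bool}| -> R),
  [/\ forall i, supported (box d n.+1) (e i), forall i j, inner mu (e i) (e j) = (i == j)%:R,
      forall i, Lbox n (e i) = (lam i)%:C *: e i &
      forall f, supported (box d n.+1) f -> f = \sum_i inner mu (e i) f *: e i].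
Proof.
have mass_gt0 eta : 0 < fine (mu (cyl_set (L := box d n.+1) eta)).
  by apply: fine_gt0; rewrite (cyl_set_gt0 hmu) ltey_eq fin_num_measure //; exact: measurable_cyl_set.
apply: (@hermitian_eigenbasis _ _ _ _ (supported_prehilbert mu (box d n.+1)) _
  (fun i => cyl_basis mu (enum_val i)) (Lbox n)).
- by move=> i; exact: supported_cyl_basis.
- by move=> i j; rewrite inner_cyl_basis // (inj_eq enum_val_inj).
- move=> f hf; rewrite {1}(cyl_basis_span mass_gt0 hf).
  by rewrite (reindex _ (onW_bij _ (@enum_val_bij _))).
- exact: Lbox_supported.
- exact: Lbox_lin.
- by move=> f g hf hg; exact: Lbox_sym (supported_cylinder hf) (supported_cylinder hg).
Qed.

Lemma Lbox_eigenvalue n f (lam delta : R) : cylinder f -> N f != 0 -> Lbox n f = lam%:C *: f ->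
  128 * c * k <= 1 -> k * c + (1024 * k ^+ 2 * (1 + 2 * k) + k) * c ^+ 2 <= delta ->
  lam = 0 \/ (1 - delta <= lam /\ (lam <= 1 + delta \/ 7 / 4 <= lam)).
Proof.
move=> cf f0 eig ck cd.
pose h := fun x : box d n => val x.
have hD := local_projections_comp (h := h) val_inj lattice_projections.
have irr (x : box d n) : ~~ adj (h x) (h x) by exact: adj_irr.
have k1 : 1 <= k by rewrite ler1n muln_gt0 d_gt0.
have deg (x : box d n) : \sum_(y : box d n | adj (h x) (h y)) (1 : R) <= k.
  by have := sum_adj_le R (h x) (fset_uniq (box d n)); rewrite big_seq_fsetE.
have eig' : \sum_(z : box d n) D (h z) f = lam%:C *: f by rewrite -eig /Lbox big_seq_fsetE.
exact: (eigenvalue_localisation (cylinder_prehilbert mu) hD irr k1 deg cf eig' ck f0 cd).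
Qed.

(* The finite-volume resolvent applied to a cylinder function solves the equation
   up to a boundary term, which decays exponentially in the size of the box. *)
Lemma dense_shift : sdense (L2 mu) (inner mu)
  [set (- (3 * k + 1))%:C *: f - pregenerator beta omega f | f in @cylinder R d].
Proof.
have hH := cylinder_prehilbert mu; have hL := L2_prehilbert mu.
have k1 : 1 <= k by rewrite ler1n muln_gt0 d_gt0.
move=> g Hg e e0; have [f Kf fg] := @sdense_cylinder R d mu g Hg (e / 2) (divr_gt0 e0 (ltr0n R 2)).
have [L hLf] := Kf; have [m hm] := sub_box L.
have fm : supported (box d m) f := supportedW (hm m (leqnn m)) hLf.
pose B := \sum_(x <- box d m) 2 ^+ lev x * N (D x f).
have B0 : 0 <= B by apply: sumr_ge0 => x _; rewrite mulr_ge0 ?nrm_ge0 // exprn_ge0.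
have [n mn hn] : exists2 n, (m <= n)%N & 2 ^- n * B < e / 2.
  exists (maxn m (Num.bound (B / (e / 2)))); first exact: leq_maxl.
  have h2 := archi_boundP (divr_ge0 B0 (ltW (divr_gt0 e0 (ltr0n R 2)))).
  rewrite mulrC ltr_pdivrMr ?exprn_gt0 // mulrC -ltr_pdivrMr ?divr_gt0 //.
  apply: lt_le_trans h2 _; apply: le_trans (_ : (maxn m (Num.bound (B / (e / 2))))%:R <= _).
    by rewrite ler_nat leq_maxr.
  by rewrite -natrX ler_nat ltnW // ltn_expl.
have [ev [lam [evS evO evE evX]]] := box_eigenbasis n.
have Kev i : cylinder (ev i) := supported_cylinder (evS i).
have lam0 i : 0 <= lam i.
  have hD := local_projections_comp (h := fun x : box d n => val x) val_inj lattice_projections.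
  have eig : \sum_(z : box d n) D (val z) (ev i) = (lam i)%:C *: ev i by rewrite -evE /Lbox big_seq_fsetE.
  have := one_particle_eq hH hD (Kev i) eig.
  have -> : N (ev i) ^+ 2 = 1 by rewrite (sqr_nrm hH) // /rip evO eqxx.
  by rewrite mulr1 => ->; apply: sumr_ge0 => x _; exact: sqr_ge0.
set z0 := - (3 * k + 1).
have zl i : z0%:C - (lam i)%:C != 0.
  by rewrite -rmorphB; apply/eqP => -[] h; have := lam0 i; rewrite /z0 in h *; lra.
(* The finite-volume resolvent at [z0] applied to f, in the eigenbasis; the eigenvalues are
   nonnegative, so the denominators do not vanish. *)
pose phi := \sum_i ((z0%:C - (lam i)%:C)^-1 * inner mu (ev i) f) *: ev i.
have phiS : supported (box d n.+1) phi.
  by apply: (prehilbert_sum (supported_prehilbert mu _)) => i _; exact: (prehilbertZ (supported_prehilbert mu _)).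
have Kphi := supported_cylinder phiS.
have Lphi : Lbox n phi = \sum_i ((z0%:C - (lam i)%:C)^-1 * inner mu (ev i) f) *: ((lam i)%:C *: ev i).
  rewrite (@linear_op_sum R (config d -> R[i]) _ (Lbox n) (Lbox_lin n)).
  by apply: eq_bigr => i _; rewrite evE.
have fn : supported (box d n.+1) f by apply: supportedW fm; apply: box_sub; exact: leqW.
have req : z0%:C *: phi - Lbox n phi = f.
  rewrite Lphi scaler_sumr -sumrB [RHS](evX _ fn); apply: eq_bigr => i _.
  have key (a b p : R[i]) (v : config d -> R[i]) : a - b != 0 ->
      a *: (((a - b)^-1 * p) *: v) - ((a - b)^-1 * p) *: (b *: v) = p *: v.
    by move=> ab; rewrite !scalerA -scalerBl; congr (_ *: _); field.
  exact: key.
have bE : Lbox n phi = \sum_(x <- box d n.+1 | (lev x <= n)%N) D x phi.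
  rewrite -big_filter; apply: perm_big; apply: uniq_perm; rewrite ?filter_uniq ?fset_uniq //.
  move=> x; rewrite mem_filter !in_box; case: (leqP (lev x) n) => //= h; by rewrite (leqW h).
rewrite bE in req.
have deg x : \sum_(y <- box d n.+1 | adj x y) (1 : R) <= k by apply: sum_adj_le; exact: fset_uniq.
have := decay_boundary hH lattice_projections (@lev_adj d) deg Kphi req.
have -> : \sum_(x <- box d n.+1) 2 ^+ lev x * N (D x f) = B.
  rewrite (bigID (mem (box d m))) /= addrC big1 ?add0r => [|x xm]; last first.
    by rewrite (Dop_out beta omega xm fm) (nrm0 hH) mulr0.
  rewrite -big_filter; apply: perm_big; apply: uniq_perm; rewrite ?filter_uniq ?fset_uniq //.
  move=> x; rewrite mem_filter; case: (boolP (x \in box d m)) => //= h.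
  by apply: box_sub h; exact: leqW.
move=> hb; exists (z0%:C *: phi - pregenerator beta omega phi); first by exists phi.
rewrite (pregeneratorE beta omega phiS (S := box d n.+1)) // (bigID (fun x => (lev x <= n)%N)) /=.
(* As phi depends on box n + 1 only, the generator differs from [Lbox n] on phi by the outermost
   shell of sites, which the decay estimate makes smaller than e/2. *)
set W := \sum_(x <- _ | ~~ _) _ in hb *.
have KW : cylinder W by apply: (prehilbert_sum hH) => x _; exact: cylinder_Dop.
have -> : z0%:C *: phi - (\sum_(x <- box d n.+1 | (lev x <= n)%N) D x phi + W) - g = (f - g) - W.
  by rewrite opprD addrA req addrAC.
have HfB : L2 mu (f - g) by apply: (prehilbertB hL) => //; exact: cylinder_L2.
apply: le_lt_trans (ler_nrmB hL HfB (cylinder_L2 mu KW)) _.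
by have := le_lt_trans hb hn; lra.
Qed.

(** Agreement on cylinder functions is exact: D_x f = 0 off the support of f, so the generator
    reduces to [Lbox n] as soon as box n contains the support. *)
Theorem finite_volume_approximation (wd : R) : 128 * c * k <= 1 ->
    k * c + (1024 * k ^+ 2 * (1 + 2 * k) + k) * c ^+ 2 <= wd ->
  exists (dim : nat -> nat) (ev : forall n, 'I_(dim n) -> config d -> R[i])
    (lam : forall n, 'I_(dim n) -> R),
  [/\ forall n i, L2 mu (ev n i), forall n i j, inner mu (ev n i) (ev n j) = (i == j)%:R,
      forall n i, [\/ lam n i = 0, `|lam n i - 1| <= wd | 7 / 4 <= lam n i] &
      forall f, cylinder f -> exists n0, forall n, (n0 <= n)%N ->
        fcalc (inner mu) ev lam (fun=> 1) n f = f /\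
        fcalc (inner mu) ev lam (fun x => x%:C) n f = pregenerator beta omega f].
Proof.
move=> ck cw; have hH := cylinder_prehilbert mu.
have [ev [lam P]] := dependent_choice2 box_eigenbasis.
exists (fun n => #|{ffun box d n.+1 -> bool}|), ev, lam; split.
- by move=> n i; have [h _ _ _] := P n; apply: cylinder_L2; exact: supported_cylinder (h i).
- by move=> n i j; have [_ h _ _] := P n; exact: h.
- move=> n i; have [h1 h2 h3 _] := P n.
  have Kev := supported_cylinder (h1 i).
  have N0 : N (ev n i) != 0.
    by rewrite -sqrf_eq0 (sqr_nrm hH Kev) /rip h2 eqxx /= oner_eq0.
  case: (Lbox_eigenvalue Kev N0 (h3 i) ck cw) => [|[l1 [l2|l2]]]; [by constructor 1|constructor 2|by constructor 3].
  rewrite ler_norml; lra.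
- move=> f [L hL]; have [m hm] := sub_box L; exists m => n mn; have [h1 h2 h3 h4] := P n.
  have fS : supported (box d n) f := supportedW (hm n mn) hL.
  have fS1 : supported (box d n.+1) f by apply: supportedW fS; apply: box_sub; exact: leqnSn.
  split.
    by rewrite [RHS](h4 _ fS1); apply: eq_bigr => i _; rewrite mul1r.
  rewrite (pregeneratorE beta omega fS (S := box d n)) // -/(Lbox n f) {2}(h4 _ fS1).
  rewrite (@linear_op_sum R (config d -> R[i]) _ (Lbox n) (Lbox_lin n)).
  by apply: eq_bigr => i _; rewrite h3 scalerA mulrC.
Qed.

End FiniteVolume.

(** * Contour integrals of resolvents *)

Section CauchyCircle.
Variable R : realType.
Local Notation leb := (@lebesgue_measure R).

Lemma derivable_FTC2 (F f : R -> R) (a b : R) : a < b ->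
  (forall x : R, is_derive x 1 F (f x)) -> continuous f ->
  leb.-integrable `[a, b] (EFin \o f) /\ \int[leb]_(t in `[a, b]) f t = F b - F a.
Proof.
move=> ab dF cf; have cf' : {within `[a, b], continuous f} by exact: continuous_subspaceT.
have cF : continuous F.
  by move=> x; apply/differentiable_continuous/derivable1_diffP; case: (dF x).
split; first by apply: continuous_compact_integrable => //; exact: segment_compact.
rewrite /Rintegral (continuous_FTC2 (F := F)) //.
- split => [x _||]; first by case: (dF x).
    exact/cvg_at_right_filter/cF.
  exact/cvg_at_left_filter/cF.
- by move=> x _; rewrite derive1E; case: (dF x).
Qed.

Variables (r a : R).
Hypothesis r_gt0 : 0 < r.
Hypothesis ra : `|a| != r.

(** The squared modulus of r e^{it} - a. *)
Definition circle_den (t : R) := r ^+ 2 - 2 * r * a * cos t + a ^+ 2.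
Local Notation q := circle_den.

Lemma circle_den_gt0 t : 0 < q t.
Proof.
have h := cos2Dsin2 t.
have qE : q t = (a - r * cos t) ^+ 2 + (r * sin t) ^+ 2.
  have e : r ^+ 2 = r ^+ 2 * (cos t ^+ 2 + sin t ^+ 2) by rewrite h mulr1.
  by rewrite /q {1}e; ring.
rewrite lt_def qE addr_ge0 ?sqr_ge0 // andbT paddr_eq0 ?sqr_ge0 // !sqrf_eq0 mulf_eq0 (gt_eqF r_gt0) /=.
apply/negP => /andP[/eqP e1 /eqP e2]; move/eqP: ra; apply.
move: h; rewrite e2 expr0n addr0 => /eqP; rewrite sqrf_eq1 => /orP[] /eqP e.
  by have -> : a = r by [rewrite e in e1; lra|]; rewrite ger0_norm // ltW.
have -> : a = - r by rewrite e in e1; lra.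
by rewrite normrN ger0_norm // ltW.
Qed.

Lemma circle_den_neq0 t : q t != 0.
Proof. by rewrite gt_eqF // circle_den_gt0. Qed.

Lemma is_derive_circle_den (t : R) : is_derive t 1 q (2 * r * a * sin t).
Proof.
rewrite /circle_den; apply: is_derive_eq.
by rewrite /GRing.scale /=; ring.
Qed.

(** [cauchy_re] and [cauchy_im] are the real and imaginary parts of i r e^{it} / (r e^{it} - a), the
    Cauchy kernel along the circle. *)
Definition cauchy_re (t : R) := a * r * sin t / q t.
Definition cauchy_im (t : R) := (r ^+ 2 - a * r * cos t) / q t.

Lemma continuous_cauchy (g : R -> R) : (forall t : R, derivable g t 1) -> continuous (fun t => g t / q t).
Proof.
move=> dg t; apply: cvgM; first exact/differentiable_continuous/derivable1_diffP.
apply: cvgV; first exact: circle_den_neq0.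
by apply/differentiable_continuous/derivable1_diffP; case: (is_derive_circle_den t).
Qed.

(** The primitive is the logarithm of |r e^{it} - a|, which is periodic. *)
Lemma integral_cauchy_re : leb.-integrable `[0, 2 * pi] (EFin \o cauchy_re) /\
  \int[leb]_(t in `[0, 2 * pi]) cauchy_re t = 0.
Proof.
have p : 0 < 2 * (pi : R) by rewrite mulr_gt0 // pi_gt0.
have [t||h1 h2] := derivable_FTC2 (F := fun t => 2^-1 * ln (q t)) p (f := cauchy_re).
- have d1 := is_derive_circle_den t; have d2 := is_derive1_ln (circle_den_gt0 t).
  have d3 := is_derive1_comp d2 d1.
  apply: is_derive_eq; rewrite /cauchy_re /GRing.scale /=; field; exact: circle_den_neq0.
- apply: continuous_cauchy => t; apply: ex_derive.
split => //; rewrite h2 /circle_den cos0 (mulr_natl pi 2) cos2pi; ring.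
Qed.

(* The primitives are the continuous arguments of r e^{it} - a: t + atan(..) when
   the circle winds around a, atan(..) when it does not. *)
Lemma integral_cauchy_im : leb.-integrable `[0, 2 * pi] (EFin \o cauchy_im) /\
  \int[leb]_(t in `[0, 2 * pi]) cauchy_im t = if `|a| < r then 2 * pi else 0.
Proof.
have p : 0 < 2 * (pi : R) by rewrite mulr_gt0 // pi_gt0.
have cc : continuous cauchy_im by apply: continuous_cauchy => t; apply: ex_derive.
have [ar|ar] := ltP `|a| r.
  have e0 (t : R) : 0 < r - a * cos t.
    have h : `|a * cos t| <= `|a| by rewrite normrM ler_piMr // cos_max.
    by have := le_lt_trans (le_trans (ler_norm _) h) ar; rewrite subr_gt0.
  pose g (t : R) := a * sin t / (r - a * cos t).
  have [t||h1 h2] := derivable_FTC2 (F := fun t => t + atan (g t)) p (f := cauchy_im).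
  - have nz : r - a * cos t != 0 by rewrite gt_eqF.
    have dd : is_derive t 1 (fun t : R => r - a * cos t) (a * sin t).
      by apply: is_derive_eq; rewrite /GRing.scale /=; ring.
    have dV := is_deriveV (f := fun t : R => r - a * cos t) nz dd.
    have dn : is_derive t 1 (fun t : R => a * sin t) (a * cos t).
      by apply: is_derive_eq; rewrite /GRing.scale /=; ring.
    have dg : is_derive t 1 g (a * sin t * (- (r - a * cos t) ^- 2 * (a * sin t)) + (r - a * cos t)^-1 * (a * cos t)).
      exact: is_deriveM dn dV.
    have da := is_derive1_comp (is_derive1_atan (g t)) dg.
    apply: is_derive_eq.
    have h := cos2Dsin2 t.
    have -> : 1 + g t ^+ 2 = q t / (r - a * cos t) ^+ 2.
      have -> : q t = (r - a * cos t) ^+ 2 + (a * sin t) ^+ 2.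
        have e : a ^+ 2 = a ^+ 2 * (cos t ^+ 2 + sin t ^+ 2) by rewrite h mulr1.
        by rewrite /circle_den {1}e; ring.
      by rewrite /g; field.
    have -> : a * sin t * (- (r - a * cos t) ^- 2 * (a * sin t)) + (r - a * cos t)^-1 * (a * cos t) =
        (a * r * cos t - a ^+ 2 * (cos t ^+ 2 + sin t ^+ 2)) / (r - a * cos t) ^+ 2 by field.
    rewrite h /cauchy_im; have := circle_den_neq0 t; rewrite /circle_den => h'; field.
    by rewrite nz h'.
  - exact: cc.
  by split => //; rewrite h2 /g (mulr_natl (pi : R) 2) sin2pi sin0 !mulr0 !mul0r ?oppr0 ?atan0; ring.
have ar' : r < `|a| by rewrite lt_def ra ar.
have e0 (t : R) : a - r * cos t != 0.
  rewrite subr_eq0; apply: contraTneq ar' => ->; rewrite -leNgt normrM (gtr0_norm r_gt0).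
  by rewrite ler_piMr ?cos_max // ltW.
pose g (t : R) := - (r * sin t / (a - r * cos t)).
have [t||h1 h2] := derivable_FTC2 (F := fun t => atan (g t)) p (f := cauchy_im).
- have nz := e0 t.
  have dd : is_derive t 1 (fun t : R => a - r * cos t) (r * sin t).
    by apply: is_derive_eq; rewrite /GRing.scale /=; ring.
  have dV := is_deriveV (f := fun t : R => a - r * cos t) nz dd.
  have dn : is_derive t 1 (fun t : R => r * sin t) (r * cos t).
    by apply: is_derive_eq; rewrite /GRing.scale /=; ring.
  have dg : is_derive t 1 g (- (r * sin t * (- (a - r * cos t) ^- 2 * (r * sin t)) + (a - r * cos t)^-1 * (r * cos t))).
    exact: is_deriveN (is_deriveM dn dV).
  have da := is_derive1_comp (is_derive1_atan (g t)) dg.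
  apply: is_derive_eq.
  have h := cos2Dsin2 t.
  have -> : 1 + g t ^+ 2 = q t / (a - r * cos t) ^+ 2.
    have -> : q t = (a - r * cos t) ^+ 2 + (r * sin t) ^+ 2.
      have e : r ^+ 2 = r ^+ 2 * (cos t ^+ 2 + sin t ^+ 2) by rewrite h mulr1.
      by rewrite /circle_den {1}e; ring.
    by rewrite /g; field.
  have -> : - (r * sin t * (- (a - r * cos t) ^- 2 * (r * sin t)) + (a - r * cos t)^-1 * (r * cos t)) =
      (r ^+ 2 * (cos t ^+ 2 + sin t ^+ 2) - a * r * cos t) / (a - r * cos t) ^+ 2 by field.
  rewrite h /cauchy_im; have := circle_den_neq0 t; rewrite /circle_den => h'; field.
  by rewrite nz h'.
- exact: cc.
by split => //; rewrite h2 /g (mulr_natl (pi : R) 2) sin2pi sin0 !mulr0 !mul0r ?oppr0 ?atan0; ring.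
Qed.

End CauchyCircle.

Section CircleIntegral.
Variable R : realType.
Local Notation leb := (@lebesgue_measure R).
Local Notation D := (`[0 : R, 2 * pi]%classic).

Definition circle_point (r t : R) : R[i] := r%:C * (cos t +i* sin t).

Lemma normc_circle_point (r t : R) : 0 <= r -> normc (circle_point r t) = r.
Proof.
by move=> r0; rewrite /circle_point normcM normcR /= cos2Dsin2 sqrtr1 mulr1 ger0_norm.
Qed.

Lemma circle_kernel (r a t : R) : 0 < r -> `|a| != r ->
  (circle_point r t - a%:C)^-1 * ('i%C * circle_point r t) = cauchy_re r a t +i* cauchy_im r a t.
Proof.
move=> r0 ra; have q0 := circle_den_neq0 r0 ra t.
have h := cos2Dsin2 t.
have P : circle_point r t = (r * cos t) +i* (r * sin t).
  by apply/eqP; rewrite eq_complex /= !mul0r subr0 addr0 !eqxx.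
have E : (circle_point r t - a%:C) * (cauchy_re r a t +i* cauchy_im r a t) = 'i%C * circle_point r t.
  rewrite P -[LHS]/(((r * cos t - a) * cauchy_re r a t - (r * sin t - 0) * cauchy_im r a t) +i*
      ((r * cos t - a) * cauchy_im r a t + (r * sin t - 0) * cauchy_re r a t)).
  rewrite -[RHS]/((0 * (r * cos t) - 1 * (r * sin t)) +i* (0 * (r * sin t) + 1 * (r * cos t))).
  have qE : circle_den r a t = r ^+ 2 - 2 * r * a * cos t + a ^+ 2 by [].
  rewrite /cauchy_re /cauchy_im; move: (circle_den r a t) q0 (cos t) (sin t) h qE => q q0 c s h qE.
  congr Complex.
    transitivity (- (r * s) * (r ^+ 2 - 2 * r * a * c + a ^+ 2) / q); first by ring.
    by rewrite -qE mulfK //; ring.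
  have e : a * r ^+ 2 = a * r ^+ 2 * (c ^+ 2 + s ^+ 2) by rewrite h mulr1.
  transitivity ((r ^+ 3 * c - a * r ^+ 2 + a ^+ 2 * r * c - a * r ^+ 2 * c ^+ 2 + a * r ^+ 2 * s ^+ 2) / q).
    by ring.
  have -> : r ^+ 3 * c - a * r ^+ 2 + a ^+ 2 * r * c - a * r ^+ 2 * c ^+ 2 + a * r ^+ 2 * s ^+ 2 =
     r * c * (r ^+ 2 - 2 * r * a * c + a ^+ 2) by rewrite {1}e; ring.
  by rewrite -qE mulfK //; ring.
have [e0|ne] := eqVneq (circle_point r t - a%:C) 0.
  exfalso; move/eqP: ra; apply.
  have -> : r = normc (circle_point r t) by rewrite normc_circle_point // ltW.
  by move/eqP: e0; rewrite subr_eq0 => /eqP ->; rewrite normcR.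
by rewrite -E mulrA mulVf // mul1r.
Qed.

Lemma Rintegral_dominated (u : nat -> R -> R) (v : R -> R) (B l : R) :
  (forall n, leb.-integrable D (EFin \o u n)) ->
  (forall t n, D t -> `|u n t| <= B) ->
  (forall t, D t -> u n t @[n --> \oo] --> v t) ->
  (\int[leb]_(t in D) u n t) @[n --> \oo] --> l ->
  \int[leb]_(t in D) v t = l.
Proof.
move=> iu uB uv ul.
have mD : measurable (D : set R) by exact: measurable_itv.
have mu_ n : measurable_fun D (u n) by apply/measurable_EFinP; exact: measurable_int (iu n).
have mv : measurable_fun D v.
  by apply: (measurable_fun_cvg (h := u)) => // t Dt; exact: uv.
have iB : leb.-integrable D (EFin \o cst B).
  apply: continuous_compact_integrable; first exact: segment_compact.
  by apply: continuous_subspaceT => x; exact: cvg_cst.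
have ev t : D t -> (fun n => (u n t)%:E) @ \oo --> (v t)%:E.
  by move=> Dt; apply: cvg_EFin; [exact: nearW|exact: uv].
have mv' : measurable_fun D (EFin \o v) by apply/measurable_EFinP.
have dct := @dominated_convergence _ _ R leb D mD (fun n => EFin \o u n) (EFin \o v) (EFin \o cst B).
have [||||| i1 _ h] := dct.
- by move=> n; exact: measurable_int (iu n).
- exact: mv'.
- by apply: aeW => t Dt; exact: ev.
- exact: iB.
- by apply: aeW => t n Dt; rewrite /= lee_fin; exact: uB.
have vE : (\int[leb]_(t in D) (v t)%:E)%E = (\int[leb]_(t in D) v t)%:E.
  by rewrite /Rintegral fineK //; exact: integrable_fin_num.
move: h; rewrite [X in _ --> X]vE => /fine_cvg h.
have h' : (fun n => \int[leb]_(t in D) u n t) @ \oo --> \int[leb]_(t in D) v t := h.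
exact: cvg_unique h' ul.
Qed.

Lemma Cintegral_dominated (u : nat -> R -> R[i]) (v : R -> R[i]) (B : R) (l : R[i]) :
  (forall n, Cintegrable leb D (u n)) ->
  (forall t n, normc (u n t) <= B) ->
  (forall t (e : R), 0 < e -> exists n0, forall n, (n0 <= n)%N -> normc (u n t - v t) < e) ->
  (forall e : R, 0 < e -> exists n0, forall n, (n0 <= n)%N -> normc (Cintegral leb D (u n) - l) < e) ->
  Cintegral leb D v = l.
Proof.
move=> iu uB uv ul.
have cv (P : R[i] -> R) : (forall z w, P (z - w) = P z - P w) -> (forall z, `|P z| <= normc z) ->
    forall (x : nat -> R[i]) y, (forall e : R, 0 < e -> exists n0, forall n, (n0 <= n)%N -> normc (x n - y) < e) ->
    (fun n => P (x n)) @ \oo --> P y.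
  move=> PB Pn x y h; apply/cvgrPdist_lt => e /h[n0 hn]; exists n0 => // n /hn.
  by apply: le_lt_trans; rewrite -PB normc_sub; exact: Pn.
have ReB (z w : R[i]) : complex.Re (z - w) = complex.Re z - complex.Re w by case: z; case: w.
have ImB (z w : R[i]) : complex.Im (z - w) = complex.Im z - complex.Im w by case: z; case: w.
rewrite /Cintegral; case: l ul => l1 l2 ul; congr Complex.
  apply: (@Rintegral_dominated (fun n t => complex.Re (u n t)) _ B).
  - by move=> n; case: (iu n).
  - by move=> t n _; exact: le_trans (normr_Re_le _) (uB t n).
  - by move=> t _; exact: cv ReB (@normr_Re_le R) _ _ (uv t).
  - exact: (cv _ ReB (@normr_Re_le R) _ _ ul).
apply: (@Rintegral_dominated (fun n t => complex.Im (u n t)) _ B).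
- by move=> n; case: (iu n).
- by move=> t n _; exact: le_trans (normr_Im_le _) (uB t n).
- by move=> t _; exact: cv ImB (@normr_Im_le R) _ _ (uv t).
- exact: (cv _ ImB (@normr_Im_le R) _ _ ul).
Qed.

Lemma Cintegral_circle_kernel (r a : R) : 0 < r -> `|a| != r ->
  Cintegrable leb D (fun t => (circle_point r t - a%:C)^-1 * ('i%C * circle_point r t)) /\
  Cintegral leb D (fun t => (circle_point r t - a%:C)^-1 * ('i%C * circle_point r t)) =
    (2 * pi)%:C * 'i%C * (if `|a| < r then 1 else 0).
Proof.
move=> r0 ra.
have -> : (fun t => (circle_point r t - a%:C)^-1 * ('i%C * circle_point r t)) =
    fun t => cauchy_re r a t +i* cauchy_im r a t by apply/funext => t; exact: circle_kernel.
have [i1 e1] := integral_cauchy_re r0 ra; have [i2 e2] := integral_cauchy_im r0 ra.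
split; first by split.
rewrite /Cintegral /= e1 e2; apply/eqP; rewrite eq_complex.
by case: ifP => _ /=; rewrite ?(mulr0, mul0r, mulr1, subr0, addr0, add0r, oppr0) !eqxx.
Qed.

End CircleIntegral.

Lemma Cintegrable_sum (dT : measure_display) (T : measurableType dT) (R : realType)
  (mu : {measure set T -> \bar R}) (D : set T) (I : Type) (r : seq I) (P : pred I) (F : I -> T -> R[i]) :
  measurable D -> (forall i, P i -> Cintegrable mu D (F i)) ->
  Cintegrable mu D (fun t => \sum_(i <- r | P i) F i t).
Proof.
move=> mD hF; elim: r => [|i r IH].
  have -> : (fun t => \sum_(i <- [::] | P i) F i t) = fun=> 0 by apply/funext => t; rewrite big_nil.
  by split; exact: integrable0.
case: (boolP (P i)) => Pi; last first.
  by under [X in Cintegrable _ _ X]funext do rewrite big_cons (negPf Pi).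
have -> : (fun t => \sum_(i <- i :: r | P i) F i t) = fun t => F i t + \sum_(i <- r | P i) F i t.
  by apply/funext => t; rewrite big_cons Pi.
by apply: CintegrableD => //; exact: hF.
Qed.

Section RieszIntegral.
Variables (R : realType) (V : lmodType R[i]) (H : set V) (ip : V -> V -> R[i]).
Hypothesis hH : prehilbert H ip.
Local Notation N := (nrm ip).
Variables (dim : nat -> nat) (ev : forall n, 'I_(dim n) -> V)
  (lam : forall n, 'I_(dim n) -> R) (Sg : set R) (wd : R).
Hypothesis evH : forall n i, H (@ev n i).
Hypothesis ev_ortho : forall n i j, ip (@ev n i) (@ev n j) = (i == j)%:R.
Hypothesis lamSg : forall n i, Sg (@lam n i).
Hypothesis wd_le : wd <= 4^-1.
Hypothesis Sg_gap : forall x : R, Sg x -> [\/ x = 0, `|x - 1| <= wd | 7 / 4 <= x].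
Hypothesis good_circle : forall z : R[i], normc (z - 1) = 2^-1 -> good H ip ev lam Sg (rs z).
Hypothesis good_chi_wd : good H ip ev lam Sg (chi wd).
Local Notation leb := (@lebesgue_measure R).

(** In finite volume the integrand is a finite sum of Cauchy kernels with poles at the eigenvalues,
    and the circle selects exactly those where [chi] is 1. Dominated convergence in n passes to the
    limit on both sides. *)
Lemma circle_integral_resolvent k g : H k -> H g ->
  circle_integral 1 2^-1 (fun z => ip k (fop H ip ev lam (rs z) g)) =
  (2 * pi)%:C * 'i%C * ip k (fop H ip ev lam (chi wd) g).
Proof.
move=> Hk Hg; pose e := circle_point (2^-1 : R).
have r0 : 0 < (2^-1 : R) by rewrite invr_gt0.
have ne t : normc (e t) = 2^-1 by rewrite normc_circle_point // ltW.
have nz t : normc (1 + e t - 1) = 2^-1 by rewrite addrAC subrr add0r.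
have ni t : normc ('i%C * e t) = 2^-1 by rewrite normcM ne /= expr0n add0r expr1n sqrtr1 mul1r.
have gt t := good_circle (nz t).
pose w n i := ip (@ev n i) g * ip k (@ev n i).
have aE n (i : 'I_(dim n)) : `|lam i - 1| != 2^-1 /\ (`|lam i - 1| < 2^-1) = (`|lam i - 1| <= wd).
  have Sl := lamSg i; have [h|/(Sg_away_from_one Sg_gap Sl) h] := boolP (`|lam i - 1| <= wd).
    have l2 : `|lam i - 1| < 2^-1 by apply: le_lt_trans h _; apply: le_lt_trans wd_le _; lra.
    by rewrite lt_eqF.
  have l2 : 2^-1 < `|lam i - 1| by apply: lt_le_trans h; lra.
  by rewrite gt_eqF // lt_gtF.
pose u n t := ip k (fcalc ip ev lam (rs (1 + e t)) n g) * ('i%C * e t).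
have uE n : u n = fun t => \sum_i w n i * ((e t - (lam i - 1)%:C)^-1 * ('i%C * e t)).
  apply/funext => t; rewrite /u (ip_fcalc hH) // mulr_suml; apply: eq_bigr => i _.
  have -> : e t - (lam i - 1)%:C = 1 + e t - (lam i)%:C by rewrite rmorphB rmorph1 opprB addrCA addrA.
  have key (x y z : R[i]) : x * y * z = y * (x * z) by ring.
  exact: key.
have iw n i : Cintegrable leb `[0 : R, 2 * pi]%classic
    (fun t => w n i * ((e t - (lam i - 1)%:C)^-1 * ('i%C * e t))).
  apply: CintegrableZ => //; have [h _] := aE n i.
  by case: (Cintegral_circle_kernel r0 h).
have mD : measurable (`[0 : R, 2 * pi]%classic) by exact: measurable_itv.
(* The factor 4 bounds the resolvents, whose distance to [Sg] on the circle is at least 1/4; the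
   factor 1/2 is the speed along the circle. *)
apply: (@Cintegral_dominated R u _ (N k * (4 * N g) * 2^-1)).
- by move=> n; rewrite uE; apply: Cintegrable_sum.
- move=> t n; rewrite /u normcM ni ler_wpM2r // ?(ltW r0) //.
  apply: le_trans (normc_ip_le hH Hk (fcalcH hH _ evH _ _ _)) _ => //.
  apply: ler_wpM2l; first exact: nrm_ge0.
  apply: (nrm_fcalc_le hH (Sg := Sg)) => // x Sx; rewrite /rs normcV.
  have := Sg_circle wd_le Sg_gap Sx (nz t) => h.
  by rewrite -[leRHS]invrK lef_pV2 ?posrE ?invr_gt0 // (lt_le_trans _ h).
- move=> t eps eps0; pose C := N k * 2^-1 + 1.
  have C0 : 0 < C by rewrite ltr_wpDl // mulr_ge0 ?nrm_ge0 // ltW.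
  have [n0 hn] := fop_cvg (gt t) Hg (divr_gt0 eps0 C0).
  exists n0 => n /hn h; rewrite /u -mulrBl normcM ni.
  have Ho := fopH (gt t) Hg.
  rewrite -(ipBr hH) //; last exact: (fcalcH hH).
  have Hd := prehilbertB hH (fcalcH hH lam evH (rs (1 + e t)) n g) Ho.
  apply: le_lt_trans (_ : C * N (fcalc ip ev lam (rs (1 + e t)) n g - fop H ip ev lam (rs (1 + e t)) g) < _).
    apply: le_trans (ler_wpM2r (ltW r0) (normc_ip_le hH Hk Hd)) _.
    by rewrite mulrAC ler_wpM2r ?nrm_ge0 // lerDl.
  by rewrite mulrC -ltr_pdivlMr.
- move=> eps eps0; pose C := 2 * pi * N k + 1.
  have p0 := pi_gt0 R.
  have C0 : 0 < C by rewrite ltr_wpDl // !mulr_ge0 ?nrm_ge0 // ltW.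
  have [n0 hn] := fop_cvg good_chi_wd Hg (divr_gt0 eps0 C0).
  exists n0 => n /hn h.
  have -> : Cintegral leb `[0 : R, 2 * pi]%classic (u n) = (2 * pi)%:C * 'i%C * ip k (fcalc ip ev lam (chi wd) n g).
    rewrite uE Cintegral_sum // (ip_fcalc hH) // mulr_sumr; apply: eq_bigr => i _.
    have [h1 h2] := aE n i; have [h3 h4] := Cintegral_circle_kernel r0 h1.
    rewrite CintegralZ // h4 h2 /w /chi mulrCA; congr (_ * _); exact: mulrC.
  have Ho := fopH good_chi_wd Hg.
  have Hd := prehilbertB hH (fcalcH hH lam evH (chi wd) n g) Ho.
  rewrite -mulrBr -(ipBr hH) //; last exact: (fcalcH hH).
  rewrite !normcM normcR ger0_norm ?mulr_ge0 ?(ltW p0) //.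
  have -> : normc ('i%C : R[i]) = 1 by rewrite /= expr0n add0r expr1n sqrtr1.
  rewrite mulr1; apply: le_lt_trans (_ : C * N (fcalc ip ev lam (chi wd) n g - fop H ip ev lam (chi wd) g) < _).
    apply: le_trans (ler_wpM2l _ (normc_ip_le hH Hk Hd)) _; first by rewrite mulr_ge0 // ltW.
    by rewrite mulrA ler_wpM2r ?nrm_ge0 // lerDl.
  by rewrite mulrC -ltr_pdivlMr.
Qed.

End RieszIntegral.

(** * Spectrum of the generator *)

Section GeneratorSpectrum.
Variables (R : realType) (d : nat) (beta : R) (omega : {fset site d} -> R).
Variable mu : probability (config d) R.
Local Notation H := (L2 mu).
Local Notation ip := (inner mu).
Local Notation N := (nrm (inner mu)).
Local Notation K := (@cylinder R d).
Local Notation A := (pregenerator beta omega).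
Local Notation G := (generator beta omega mu).

Let hH := L2_prehilbert mu.
Let complete := @L2_complete _ _ _ mu.

Lemma pregenerator_L2 f : K f -> H (A f).
Proof.
move=> Kf; apply: cylinder_L2; have [L hL] := Kf.
rewrite (pregeneratorE beta omega hL (S := L)) //.
apply: (prehilbert_sum (cylinder_prehilbert mu)) => x _; exact: cylinder_Dop.
Qed.

Lemma cvg_L2normP (u : nat -> config d -> R[i]) l : (forall n, H (u n)) -> H l ->
  L2norm mu (fun t => u n t - l t) @[n --> \oo] --> 0%E <-> scvg ip u l.
Proof.
move=> Hu Hl.
have E n : L2norm mu (fun t => u n t - l t) = (N (u n - l))%:E.
  by apply: (L2normE (f := u n - l)); exact: (prehilbertB hH).
under eq_fun do rewrite E; split.
  move=> /fine_cvg h e e0; move/cvgrPdist_lt: h => /(_ e e0)[n0 _ hn]; exists n0 => n /hn.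
  by rewrite /= sub0r normrN ger0_norm // nrm_ge0.
move=> h; apply: cvg_EFin; first exact: nearW.
apply/cvgrPdist_lt => e /h[n0 hn]; exists n0 => // n /hn.
by rewrite /= sub0r normrN ger0_norm // nrm_ge0.
Qed.

(** Restates the closure in terms of [scvg], so that the abstract functional calculus applies to the
    generator. *)
Lemma generatorE : G = sgraph H ip K A.
Proof.
apply/seteqP; split => -[f h] [/= Hf Hh [u]].
  move=> [Ku c1 c2]; split => //; exists (fun n => (u n).1).
  have K1 n : K (u n).1 by case: (Ku n).
  have E n : (u n).2 = A (u n).1 by case: (Ku n).
  split => //.
    by apply/cvg_L2normP => // n; exact: cylinder_L2.
  apply/cvg_L2normP => // [n|]; first exact: pregenerator_L2.
  by under eq_fun do rewrite -E.
move=> [Ku c1 c2]; split => //; exists (fun n => (u n, A (u n))).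
have Hu n : H (u n) by exact: cylinder_L2.
have HA n : H (A (u n)) by exact: pregenerator_L2.
split; [by move=> n; split; [exact: Ku|]|exact: ((cvg_L2normP Hu Hf).2 c1)|].
exact: ((cvg_L2normP HA Hh).2 c2).
Qed.

Variables (dim : nat -> nat) (ev : forall n, 'I_(dim n) -> config d -> R[i])
  (lam : forall n, 'I_(dim n) -> R) (wd z0 : R).
Let Sg : set R := [set x | [\/ x = 0, `|x - 1| <= wd | 7 / 4 <= x]].
Hypothesis evH : forall n i, H (@ev n i).
Hypothesis ev_ortho : forall n i j, ip (@ev n i) (@ev n j) = (i == j)%:R.
Hypothesis lamSg : forall n i, Sg (@lam n i).
Hypothesis approx : forall f, K f -> exists n0, forall n, (n0 <= n)%N ->
  fcalc ip ev lam (fun=> 1) n f = f /\ fcalc ip ev lam (fun x => x%:C) n f = A f.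
Hypothesis z0_lt0 : z0 < 0.
Hypothesis dense_z0 : sdense H ip [set z0%:C *: f - A f | f in K].
Hypothesis wd_le : wd <= 4^-1.

Let KH : K `<=` H. Proof. exact: cylinder_L2. Qed.
Let AH := pregenerator_L2.
Let dK : sdense H ip K. Proof. exact: sdense_cylinder. Qed.
Let Sg_ge0 (x : R) : Sg x -> 0 <= x.
Proof.
case=> [->//|h|h]; last by lra.
by have := le_trans h wd_le; rewrite ler_norml; lra.
Qed.
Let Sg_gap (x : R) : Sg x -> [\/ x = 0, `|x - 1| <= wd | 7 / 4 <= x]. Proof. by []. Qed.
Let c0 : 0 < (4^-1 : R). Proof. by rewrite invr_gt0. Qed.
Let circle_dist (z : R[i]) : normc (z - 1) = 2^-1 -> forall x : R, Sg x -> 4^-1 <= normc (z - x%:C).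
Proof. by move=> hz x Sx; exact: (Sg_circle wd_le Sg_gap Sx hz). Qed.

Lemma circle_sub_resolvent_set z : normc (z - 1) = 2^-1 -> resolvent_set mu H G z.
Proof.
move=> hz; rewrite generatorE; split.
  move=> g Hg; exists (fop H ip ev lam (rs z) g).
  exact: (resolvent_sgraph hH complete evH ev_ortho lamSg KH AH dK approx z0_lt0 Sg_ge0 dense_z0
    c0 (circle_dist hz) Hg).
exists (4^-1)^-1 => f h fh.
have := sgraph_bounded_below hH complete evH ev_ortho lamSg KH AH dK approx z0_lt0 Sg_ge0 dense_z0
    c0 (circle_dist hz) fh.
have [Hf Hh _] := fh.
have Hs : H (z *: f - h) by apply: (prehilbertB hH) => //; exact: (prehilbertZ hH).
by rewrite (L2normE Hf) -[L2norm mu (fun t => _)]/(L2norm mu (z *: f - h)) (L2normE Hs) -EFinM lee_fin.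
Qed.

Lemma riesz_rangeE : riesz_range mu G 1 2^-1 = branch_space H ip ev lam wd.
Proof.
have gc := good_chi hH complete evH ev_ortho lamSg KH AH approx z0_lt0 Sg_ge0 dense_z0 wd_le Sg_gap.
have gr z (hz : normc (z - 1) = 2^-1) : good H ip ev lam Sg (rs z).
  exact: (good_rs hH complete evH ev_ortho lamSg KH AH approx z0_lt0 Sg_ge0 dense_z0 c0 (circle_dist hz)).
have RP g h : H g -> H h -> riesz_projector mu G 1 2^-1 (g, h) <-> N (h - fop H ip ev lam (chi wd) g) = 0.
  move=> Hg Hh; have Ho := fopH gc Hg.
  have CI k : H k -> ((2 * pi)%:C * 'i%C)^-1 *
      circle_integral 1 2^-1 (fun z => inner mu k (resolvent G z g)) = ip k (fop H ip ev lam (chi wd) g).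
    move=> Hk.
    have -> : circle_integral 1 2^-1 (fun z => inner mu k (resolvent G z g)) =
        circle_integral 1 2^-1 (fun z => ip k (fop H ip ev lam (rs z) g)).
      (* Whichever representative [resolvent] selects, it differs from [fop (rs z) g] by a null
         vector, which the inner product with k does not see. *)
      congr Cintegral; apply/funext => t; congr (_ * _).
      set z := 1 + _; have hz : normc (z - 1) = 2^-1.
        have -> : z - 1 = circle_point 2^-1 t by rewrite /z addrAC subrr add0r.
        by rewrite normc_circle_point // invr_ge0.
      have Hr := fopH (gr z hz) Hg.
      have : G (resolvent G z g, fun t => z * resolvent G z g t - g t).
        rewrite /resolvent; case: xgetP => [f _ //|/(_ (fop H ip ev lam (rs z) g)) nf].
        by case: nf; rewrite generatorE /=;
          exact: (resolvent_sgraph hH complete evH ev_ortho lamSg KH AH dK approx z0_lt0 Sg_ge0 dense_z0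
            c0 (circle_dist hz) Hg).
      move: (resolvent G z g) => f; rewrite generatorE => fG; have [Hf _ _] := fG.
      have e := resolvent_unique hH complete evH ev_ortho lamSg KH AH dK approx z0_lt0 Sg_ge0 dense_z0
            c0 (circle_dist hz) Hg fG.
      apply/eqP; rewrite -subr_eq0 -(ipBr hH) //; apply/eqP/eq0_normc/eqP.
      rewrite eq_le normc_ge0 andbT.
      by have := normc_ip_le hH Hk (prehilbertB hH Hf Hr); rewrite e mulr0.
    rewrite (circle_integral_resolvent hH evH ev_ortho lamSg wd_le Sg_gap gr gc Hk Hg).
    rewrite mulrA mulVf ?mul1r // mulf_neq0 ?neq0Ci //.
    by apply/eqP => -[] /eqP; rewrite gt_eqF // mulr_gt0 // pi_gt0.
  split.
    move=> [_ _ hk]; apply/eqP; rewrite -sqrf_eq0 (sqr_nrm hH); last exact: (prehilbertB hH).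
    (* The weak identity is tested against the difference h - chi(L) g itself. *)
    have Hk := prehilbertB hH Hh Ho; rewrite /rip (ipBr hH) //.
    set k := h - _ in Hk *.
    have e : ip k h = ip k (fop H ip ev lam (chi wd) g) := etrans (hk _ Hk) (CI _ Hk).
    have key (x y : R[i]) : x = y -> complex.Re (x - y) == 0 by move=> ->; rewrite subrr.
    exact: key e.
  move=> h0; split => // k Hk /=; rewrite CI //.
  apply/eqP; rewrite -subr_eq0 -(ipBr hH) //; apply/eqP/eq0_normc/eqP.
  rewrite eq_le normc_ge0 andbT.
  by have := normc_ip_le hH Hk (prehilbertB hH Hh Ho); rewrite h0 mulr0.
apply/seteqP; split => h.
  move=> [g gh]; have [Hg Hh _] := gh; have /RP h0 := gh.
  have Hb := branch_space_fop hH complete evH ev_ortho lamSg KH AH approx z0_lt0 Sg_ge0 dense_z0 wd_le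
    Sg_gap gc Hg.
  have E : (fun x : R => chi wd x * chi wd x) = chi wd by apply/funext => x; exact: chi_idem.
  rewrite E in Hb.
  apply: (branch_space_eq hH complete evH ev_ortho lamSg KH AH approx z0_lt0 Sg_ge0 dense_z0 wd_le
    Sg_gap Hb Hh).
  apply: (nrm_eq0_sym hH) => //; first exact: fopH gc Hg.
  exact: h0.
by move=> [Hh h0]; exists h; apply/RP.
Qed.

(** By contraposition: if z is non-real or farther than [wd] from 1, then chi / (z - x) inverts z -
    L on the branch space, even where z meets another part of the spectrum. *)
Lemma first_branch_sub (z : R[i]) : first_branch beta omega mu z ->
  exists2 x : R, `|x - 1| <= wd & x%:C = z.
Proof.
rewrite /first_branch riesz_rangeE generatorE => sz.
have [[h1 h2]|h] := pselect (complex.Im z = 0 /\ `|complex.Re z - 1| <= wd).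
  by exists (complex.Re z) => //; move: h1; case: (z) => a b /= ->.
exfalso; apply: sz.
have hz : (complex.Im z != 0) \/ (wd < `|complex.Re z - 1|).
  have [e|] := eqVneq (complex.Im z) 0; last by left.
  by right; rewrite ltNge; apply/negP => e2; apply: h.
split.
  move=> g /(branch_onto hH complete evH ev_ortho lamSg KH AH approx z0_lt0 Sg_ge0 dense_z0 wd_le
    Sg_gap hz)[f [fg bf bz]].
  by exists f; split; [exact: fg|exact: bf|exact: bz].
have [C hC] := branch_bounded_below hH complete evH ev_ortho lamSg KH AH approx z0_lt0 Sg_ge0 dense_z0
  wd_le Sg_gap hz.
clear h; exists C => f h [/= fh bf _]; have := hC _ _ fh bf.
have [Hf Hh _] := fh.
have Hs : H (z *: f - h) by apply: (prehilbertB hH) => //; exact: (prehilbertZ hH).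
by rewrite (L2normE Hf) -[L2norm mu (fun t => _)]/(L2norm mu (z *: f - h)) (L2normE Hs) -EFinM lee_fin.
Qed.

End GeneratorSpectrum.

(** * Choice of constants *)

Section Constants.
Variables (R : realType).

Lemma expR_le1D2 (x : R) : 0 <= x <= 2^-1 -> expR x <= 1 + 2 * x.
Proof.
move=> /andP[x0 x1].
have h : 1 - x <= (expR x)^-1 by rewrite -expRN; have := expR_ge1Dx (- x); rewrite -[1 - x]/(1 + - x).
have e0 := expR_gt0 x.
have h2 : expR x * (1 - x) <= 1.
  by have := ler_wpM2l (ltW e0) h; rewrite mulfV // gt_eqF.
have h3 : 1 <= (1 + 2 * x) * (1 - x) by nra.
have p : 0 < 1 - x by lra.
by rewrite -(ler_pM2r p) (le_trans h2).
Qed.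

Lemma analytic_at_quadratic (a b c x : R) : analytic_at (fun y => a + b * y + c * y ^+ 2) x.
Proof.
pose u n : R := if n is 0%N then a + b * x + c * x ^+ 2 else if n is 1%N then b + 2 * c * x
  else if n is 2%N then c else 0.
exists u, 1; split => // y _.
apply: cvg_near_cst; exists 3%N => // n /= n3.
rewrite /series /= (big_cat_nat _ n3) //= [X in _ + X]big_nat_cond [X in _ + X]big1 ?addr0; last first.
  by move=> [|[|[|i]]] //= _; rewrite mul0r.
rewrite !big_nat_recr //= big_nil /u; ring.
Qed.

Lemma littleo_quadratic (c : R) (f : R -> R) : (forall x, f x = c * x ^+ 2) ->
  f =o_ (0 : R) (fun x : R => x).
Proof.
move=> fE; apply/eqoP => eps eps0.
have C0 : 0 < `|c| + 1 by rewrite ltr_wpDl.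
have d0 : 0 < eps / (`|c| + 1) by exact: divr_gt0.
near=> x.
rewrite fE expr2 mulrA normrM ler_wpM2r //.
have xs : `|x| <= eps / (`|c| + 1).
  by near: x; apply/nbhs_ballP; exists (eps / (`|c| + 1)) => //= x; rewrite /ball /= sub0r normrN => /ltW.
rewrite normrM; apply: le_trans (ler_wpM2l (normr_ge0 c) xs) _.
rewrite mulrCA ger_pMr // ler_pdivrMr // mul1r; lra.
Unshelve. all: by end_near.
Qed.

(** Here b stands for beta J. From c <= b (1 + 4 k b) and c <= 2 b one gets k c + C0 c^2 <= k b + (4
    k^2 + 4 C0) b^2, which is the origin of [C1]; the linear coefficient stays equal to k. The
    condition b C1 <= 1 also forces 4096 b k^2 <= 1. *)
Lemma small_coupling (k b C0 C1 : R) : 1 <= k -> C0 = 1024 * k ^+ 2 * (1 + 2 * k) + k ->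
  C1 = 4 * k ^+ 2 + 4 * C0 -> 0 <= b -> b * C1 <= 1 ->
  let c := b * expR (2 * k * b) in
  [/\ 128 * c * k <= 1, k * c + C0 * c ^+ 2 <= k * b + C1 * b ^+ 2 & k * b + C1 * b ^+ 2 <= 4^-1].
Proof.
move=> k1 eC0 eC1 b0 bC c.
have kk : k <= k ^+ 2 by rewrite expr2 ler_peMr //; lra.
have P : 0 <= k ^+ 2 * (1 + 2 * k) by rewrite mulr_ge0 ?sqr_ge0 //; lra.
have Pk : k ^+ 2 <= k ^+ 2 * (1 + 2 * k) by rewrite ler_peMr ?sqr_ge0 //; lra.
have C0p : 1024 * k ^+ 2 <= C0 by rewrite eC0; lra.
have C1p : 4096 * k ^+ 2 <= C1 by rewrite eC1; have := sqr_ge0 k; lra.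
have bk : 4096 * (b * k ^+ 2) <= 1.
  by have := ler_wpM2l b0 C1p; lra.
have C00 : 0 <= C0 by have := sqr_ge0 k; lra.
clear eC0 P Pk C0p C1p.
have bk1 : b * k <= b * k ^+ 2 by rewrite ler_wpM2l.
have b1 : b <= b * k by rewrite ler_peMr.
have ex : expR (2 * k * b) <= 1 + 2 * (2 * k * b).
  apply: expR_le1D2; apply/andP; split; last by lra.
  by rewrite !mulr_ge0 //; lra.
have c0 : 0 <= c by rewrite mulr_ge0 // expR_ge0.
have cb : c <= b * (1 + 4 * k * b).
  by apply: le_trans (ler_wpM2l b0 ex) _; lra.
have c2 : c <= 2 * b.
  apply: le_trans cb _; have : b * (4 * k * b) <= b * 1 by rewrite ler_wpM2l //; lra.
  lra.
split.
- have : c * k <= 2 * b * k by rewrite ler_wpM2r //; lra.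
  lra.
- have h1 : k * c <= k * (b * (1 + 4 * k * b)) by rewrite ler_wpM2l //; lra.
  have h2 : c ^+ 2 <= (2 * b) ^+ 2 by rewrite ler_pXn2r ?nnegrE //; lra.
  have h3 := ler_wpM2l C00 h2.
  have -> : k * b + C1 * b ^+ 2 = k * (b * (1 + 4 * k * b)) + C0 * (2 * b) ^+ 2 by rewrite eC1; ring.
  lra.
- have : C1 * b ^+ 2 <= b by rewrite expr2 mulrA -[leRHS]mul1r ler_wpM2r // mulrC.
  lra.
Qed.

End Constants.

Theorem theorem1 (R : realType) (d : nat) (hd : (1 <= d)%N) :
  exists beta_d : R -> R, forall Jm Jp : R, Jm <= Jp ->
    let J := Num.max `|Jm| `|Jp| in
    0 < beta_d J /\
    exists gm gp : R -> R,
      [/\ forall beta : R, 0 <= beta < beta_d J ->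
            analytic_at gm beta /\ analytic_at gp beta,
          (fun beta : R => gm beta - (1 - 2 * d%:R * J * beta))
            =o_ (0 : R) (fun beta : R => beta),
          (fun beta : R => gp beta - (1 + 2 * d%:R * J * beta))
            =o_ (0 : R) (fun beta : R => beta) &
          forall beta : R, 0 <= beta < beta_d J ->
          forall omega : {fset site d} -> R, Omega Jm Jp omega ->
          forall mu : probability (config d) R, gibbs beta omega mu ->
            (forall z : R[i], `|z - 1| = (2^-1)%:C ->
               resolvent_set mu (L2 mu) (generator beta omega mu) z) /\
            first_branch beta omega mu `<=`
              [set lambda%:C | lambda in `[gm beta, gp beta]]].
Proof.
pose k := (2 * d)%:R : R.
have k1 : 1 <= k by rewrite ler1n muln_gt0.
pose C0 := 1024 * k ^+ 2 * (1 + 2 * k) + k.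
pose C1 := 4 * k ^+ 2 + 4 * C0.
have C1p : 0 < C1.
  have h : 0 <= 1 + 2 * k by lra.
  have := mulr_ge0 (sqr_ge0 k) h; have := sqr_ge0 k; rewrite /C1 /C0; lra.
(* This threshold ensures beta J C1 <= 1; J + 1 in place of J keeps it meaningful when J = 0. *)
exists (fun J => (C1 * (J + 1))^-1) => Jm Jp _ J.
have J0 : 0 <= J by rewrite le_max normr_ge0.
have J1 : 0 < J + 1 by rewrite ltr_wpDl.
split; first by rewrite invr_gt0 mulr_gt0.
have kE : k = 2 * d%:R by rewrite /k natrM.
(* The endpoints are 1 -+ (k b + C1 b^2) with b = beta J and k = 2 d, the half-width supplied by
   [small_coupling]. *)
exists (fun beta => 1 + (- (k * J)) * beta + (- (C1 * J ^+ 2)) * beta ^+ 2),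
  (fun beta => 1 + (k * J) * beta + (C1 * J ^+ 2) * beta ^+ 2); split.
- by move=> beta _; split; exact: analytic_at_quadratic.
- by apply: (@littleo_quadratic R (- (C1 * J ^+ 2))) => beta; rewrite kE; ring.
- by apply: (@littleo_quadratic R (C1 * J ^+ 2)) => beta; rewrite kE; ring.
move=> beta /andP[beta0 betaJ] omega hO mu hmu.
have omega_le (x y : site d) : nn x y -> `|omega [fset x; y]%fset| <= J.
  move=> xy; have /andP[lo hi] := hO _ (ex_intro _ x (ex_intro _ y (conj xy erefl))).
  rewrite /J le_max; have [p|p] := leP 0 (omega [fset x; y]%fset).
    by apply/orP; right; rewrite (ger0_norm p); exact: le_trans hi (ler_norm _).
  by apply/orP; left; rewrite (ltr0_norm p) -normrN; apply: le_trans (ler_norm _); rewrite lerN2.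
have b0 : 0 <= beta * J by exact: mulr_ge0.
have bC : beta * J * C1 <= 1.
  have p : 0 < C1 * (J + 1) by exact: mulr_gt0.
  have := ltW betaJ; rewrite -[(_ * _)^-1]mul1r ler_pdivlMr // => h; apply: le_trans h.
  have : 0 <= beta * C1 by rewrite mulr_ge0 // ltW.
  lra.
have [h1 h2 h3] := small_coupling k1 (erefl C0) (erefl C1) b0 bC.
have cE : beta * J * expR (2 * k * (beta * J)) = beta * J * expR (4 * d%:R * J * beta).
  by congr (_ * expR _); rewrite kE; ring.
rewrite cE in h1 h2.
have [dim [e [lam [eH eO eS eA]]]] := finite_volume_approximation hd beta0 omega_le hmu h1 h2.
have z0 : - (3 * k + 1) < 0 by lra.
have dz := @dense_shift R d beta J omega hd beta0 omega_le mu hmu.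
split=> z.
  move=> hz; apply: (circle_sub_resolvent_set eH eO eS eA z0 dz h3).
  by move: hz; rewrite Normc => /complexI.
move=> /(first_branch_sub eH eO eS eA z0 dz h3)[x hx <-].
exists x => //=; move: hx; rewrite ler_norml in_itv /= => /andP[l1 l2].
apply/andP; split; lra.
Qed.
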